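(* Let $U=\{z\in\mathbb{C}:\operatorname{Im} z>0\}$, $\overline{\mathbb{R}}=\mathbb{R}\cup\{\infty\}$ and $\phi(z)=\frac{z^2-1}{z^2+1}$. Let $f$ and $g$ be odd rational maps of degree at least two such that $f(U)=U$, $g(U)=U$, $J_f\neq\overline{\mathbb{R}}$ and $J_g=\overline{\mathbb{R}}$. Then there exist rational maps $\tilde f$ and $\tilde g$ with $\phi\circ f=\tilde f\circ\phi$ and $\phi\circ g=\tilde g\circ\phi$, and the rational semigroup $\tilde G=\langle\tilde f,\tilde g\rangle$ satisfies $J_{\tilde f}\neq[-1,1]$, $J_{\tilde g}=[-1,1]$ (so $J_{\tilde f}\neq J_{\tilde g}$), and $E(\tilde G)=[-1,1]$. Specifically, $f(z)=2z-\frac1z$ and $g(z)=\frac{z^2-1}{2z}$ satisfy these hypotheses, and the corresponding maps are $\tilde f(z)=\frac{3z+5z^2}{1+3z+4z^2}$ and $\tilde g(z)=2z^2-1$; hence for these two maps $J_{\tilde f}\neq J_{\tilde g}$ and $E(\langle\tilde f,\tilde g\rangle)=[-1,1]$.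
   Context: $\overline{\mathbb{C}}$ is the Riemann sphere. A map $f$ is odd if $f(-z)=-f(z)$. A rational semigroup is a semigroup (under composition) of rational functions of degree at least two on $\overline{\mathbb{C}}$; $\langle f_1,f_2,\dots\rangle$ denotes the semigroup generated by $f_1,f_2,\dots$. For a rational map $h$ of degree at least two, $J_h$ is its usual Julia set (the complement of the set of points having a neighborhood on which the iterates of $h$ form a normal family with respect to the spherical metric). A set $X\subset\overline{\mathbb{C}}$ is completely invariant under $h$ if $h(X)\subset X$ and $h^{-1}(X)\subset X$. For a rational semigroup $G$, the completely invariant Julia set $E(G)$ is the intersection of all closed sets $S\subset\overline{\mathbb{C}}$ with at least three points that are completely invariant under every $g\in G$. *)

(* Defs.v *)
From HB Require Import structures.
From mathcomp Require Import all_boot all_order all_algebra.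
From mathcomp Require Import complex.
From mathcomp Require Import all_classical all_reals all_analysis.

Set Implicit Arguments.
Unset Strict Implicit.
Unset Printing Implicit Defensive.

Import Order.TTheory GRing.Theory Num.Theory.
Import numFieldNormedType.Exports.

Local Open Scope classical_set_scope.
Local Open Scope ring_scope.
Local Open Scope complex_scope.

(* The regular module R[i]^o, which is R[i] itself, carries the metric topology
   given by the complex modulus.  [Some z] is the finite point z, [None] is the
   point at infinity. *)
Definition sphere (R : realType) : Type := one_point_compactification (R[i])^o.
HB.instance Definition _ (R : realType) := Topological.on (sphere R).

Section Sphere.
Variable R : realType.
Implicit Types (p q : {poly R[i]}) (f g h : sphere R -> sphere R).
Implicit Types (S W : set (sphere R)) (G : set (sphere R -> sphere R)).

Definition infty : sphere R := None.
Definition finpt (z : R[i]) : sphere R := Some z.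

Definition cabs (z : R[i]) : R := ComplexField.Normc.normc z.

(* Half the Euclidean distance of the stereographic images on the unit sphere. *)
Definition half_chord_fin (z w : R[i]) : R :=
  cabs (z - w) / (Num.sqrt (1 + cabs z ^+ 2) * Num.sqrt (1 + cabs w ^+ 2)).

Definition half_chord (x y : sphere R) : R :=
  match x, y with
  | Some z, Some w => half_chord_fin z w
  | Some z, None | None, Some z => (Num.sqrt (1 + cabs z ^+ 2))^-1
  | None, None => 0
  end.

(* Great-circle distance on the unit sphere. *)
Definition spherical_dist (x y : sphere R) : R := 2 * asin (half_chord x y).

(* For coprime p and q, the map p / q of the sphere and its degree.  With
   n = max (deg p) (deg q), the value at infinity is the quotient of the
   coefficients of X^n. *)
Definition ratdeg p q : nat := (maxn (size p) (size q)).-1.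

Definition ratmap p q (x : sphere R) : sphere R :=
  match x with
  | Some z => if q.[z] == 0 then infty else finpt (p.[z] / q.[z])
  | None => let n := ratdeg p q in
            if q`_n == 0 then infty else finpt (p`_n / q`_n)
  end.

Definition rational_of_degree (d : nat) f : Prop :=
  exists p q, [/\ coprimep p q, q != 0, ratdeg p q = d & f = ratmap p q].

Definition rational_map f : Prop := exists d, rational_of_degree d f.

Definition rational_ge2 f : Prop :=
  exists2 d, (2 <= d)%N & rational_of_degree d f.

Definition sopp (x : sphere R) : sphere R :=
  if x is Some z then finpt (- (z : R[i])) else infty.

Definition odd_map f : Prop := forall x, f (sopp x) = sopp (f x).

(* Every sequence in F has a subsequence converging, in the spherical metric,
   uniformly on the compact subsets of W. *)
Definition normal_family (W : set (sphere R))
    (F : set (sphere R -> sphere R)) : Prop :=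
  forall u : nat -> sphere R -> sphere R, (forall n, F (u n)) ->
  exists (k : nat -> nat) (l : sphere R -> sphere R),
    {homo k : m n / (m < n)%N} /\
    forall K : set (sphere R), compact K -> K `<=` W ->
    forall e : R, 0 < e ->
    \forall n \near \oo, forall x, K x -> spherical_dist (u (k n) x) (l x) < e.

Definition iterates h : set (sphere R -> sphere R) :=
  range (fun n => iter n.+1 h).

Definition julia h : set (sphere R) :=
  ~` [set x | exists2 W, open_nbhs x W & normal_family W (iterates h)].

Definition completely_invariant h S : Prop := h @` S `<=` S /\ h @^-1` S `<=` S.

Definition comp_closed G : Prop := forall g h, G g -> G h -> G (g \o h).

Definition rational_semigroup G : Prop :=
  comp_closed G /\ G `<=` rational_ge2.

Definition semigroup_gen (A : set (sphere R -> sphere R)) :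
  set (sphere R -> sphere R) := smallest comp_closed A.

Definition has_three_points S : Prop :=
  exists x y z, [/\ S x, S y & S z] /\ [/\ x <> y, y <> z & x <> z].

Definition E_julia G : set (sphere R) :=
  \bigcap_(S in [set S | [/\ closed S, has_three_points S &
                            forall g, G g -> completely_invariant g S]]) S.

Definition upper_half_plane : set (sphere R) := finpt @` [set z | 0 < Im z].

Definition extended_reals : set (sphere R) :=
  range (fun t : R => finpt t%:C) `|` [set infty].

Definition segment : set (sphere R) :=
  (fun t : R => finpt t%:C) @` [set t | -1 <= t <= 1].

Definition phi : sphere R -> sphere R := ratmap ('X^2 - 1) ('X^2 + 1).

(* 2 z - 1 / z = (2 z^2 - 1) / z *)
Definition ex_f : sphere R -> sphere R := ratmap (2%:P * 'X^2 - 1) 'X.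

Definition ex_g : sphere R -> sphere R := ratmap ('X^2 - 1) (2%:P * 'X).

Definition ex_ft : sphere R -> sphere R :=
  ratmap (3%:P * 'X + 5%:P * 'X^2) (1 + 3%:P * 'X + 4%:P * 'X^2).

Definition ex_gt : sphere R -> sphere R := ratmap (2%:P * 'X^2 - 1) 1.

End Sphere.

Arguments infty {R}.
Arguments upper_half_plane {R}.
Arguments extended_reals {R}.
Arguments segment {R}.
Arguments phi {R}.
Arguments ex_f R _ : clear implicits.
Arguments ex_g R _ : clear implicits.
Arguments ex_ft R _ : clear implicits.
Arguments ex_gt R _ : clear implicits.

(* Main.v *)
(* Write chi for half the chordal distance. The map phi is z |-> z^2 followed by
   an isometry, so chi(x, y) chi(x, -y) <= chi(phi x, phi y) <= 2 chi(x, y) chi(x, -y).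
   As normality is local equicontinuity (Arzela-Ascoli) and small connected sets
   lift through phi to small sets, J_f is the preimage of J_ft under phi.

   Since f is odd, it preserves both half planes, so [-1, 1] = phi(R u {oo}) is
   completely invariant and contains E. For the converse, let S be closed and
   completely invariant under gt, and pull it back to S' = phi^-1(S), which is
   symmetric and completely invariant under g. No Montel theorem is needed: a
   rational self-map of the half plane is a z + b - sum c_j / (z - p_j) with
   a >= 0, c_j > 0 and simple real poles.
   - If S' has two real points and misses a real interval, the iterates of g omit
     two values there; the partial fractions give a distortion bound making them
     equi-Lipschitz near the interval, against J_g = R u {oo}.
   - If S' has exactly one real point, by symmetry it is 0 or oo; but it would be
     its own only preimage, whereas the preimages of a real point are simple, so
     there are deg g >= 2 of them.
   - If S' has no real point, S' meets the upper half plane in a compact set A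
     with g(A) = A; the strict Schwarz-Pick inequality (Cauchy-Schwarz on the
     partial fractions) forces A to be a point. *)

Require Import Defs.
From mathcomp Require Import all_boot all_order all_algebra.
From mathcomp Require Import complex.
From mathcomp Require Import all_classical all_reals all_analysis.
From mathcomp Require Import ring lra.

Local Open Scope classical_set_scope.

(** The distortion bound has to be uniform over all iterates, whose poles and residues are out of
    control. It rests on monotonicity: on the real line such a map increases between its poles. If
    it has no zero and no pole within r of u, then a step of r/2 from u towards the zero level
    cannot reach that level, although it moves the value by at least r/3 times the derivative at u.
    So the logarithmic derivative at u is at most 3/r, whatever the iterate. Two omitted real values
    other than 0 and infinity are first sent there by a real Moebius map, which costs a factor
    depending only on that map. A single nonzero real point s of S' already provides two such
    values, s and -s, by symmetry.

    The signs in the partial fractions come from the argument near a pole of order m: the half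
    planes are swept m times too fast unless m = 1, and the direction of the residue is then forced.

    In the example, infinity lies on the extended real line and is an attracting fixed point of f
    with multiplier 1/2, whereas g is Newton's method for z^2 + 1: its basins of i and -i are the
    two half planes, and its Julia set is what separates them. *)

Section Development.
Set Implicit Arguments.
Unset Strict Implicit.
Unset Printing Implicit Defensive.
Import Order.TTheory GRing.Theory Num.Theory.
Import numFieldNormedType.Exports.
Local Open Scope ring_scope.
Local Open Scope complex_scope.

Local Notation Re := complex.Re.
Local Notation Im := complex.Im.

(** * Modulus, homogeneous coordinates and the chordal metric *)

Section Modulus.
Variable R : realType.
Implicit Types (a b c d z w : R[i]) (x y : sphere R).

Lemma cabs_ge0 z : 0 <= cabs z.
Proof. by case: z => a b; rewrite /cabs /= sqrtr_ge0. Qed.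

Lemma cabs_sqr z : cabs z ^+ 2 = Re z ^+ 2 + Im z ^+ 2.
Proof. by case: z => a b; rewrite /cabs /= sqr_sqrtr // addr_ge0 ?sqr_ge0. Qed.

Lemma cabsM z w : cabs (z * w) = cabs z * cabs w.
Proof. exact: ComplexField.Normc.normcM. Qed.

Lemma cabsV z : cabs z^-1 = (cabs z)^-1.
Proof. exact: ComplexField.Normc.normcV. Qed.

Lemma cabsN z : cabs (- z) = cabs z.
Proof. exact: normcN. Qed.

Lemma cabsB z w : cabs (z - w) = cabs (w - z).
Proof. by rewrite -opprB cabsN. Qed.

Lemma cabsD z w : cabs (z + w) <= cabs z + cabs w.
Proof. exact: le_normcD. Qed.

Lemma cabs0 : cabs (0 : R[i]) = 0.
Proof. exact: ComplexField.Normc.normc0. Qed.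

Lemma cabs1 : cabs (1 : R[i]) = 1.
Proof. exact: ComplexField.Normc.normc1. Qed.

Lemma cabs_eq0 z : (cabs z == 0) = (z == 0).
Proof.
apply/eqP/eqP => [|->]; last exact: cabs0.
exact: ComplexField.Normc.eq0_normc.
Qed.

Lemma cabs_gt0 z : (0 < cabs z) = (z != 0).
Proof. by rewrite lt_def cabs_ge0 andbT cabs_eq0. Qed.

Lemma cabsX z n : cabs (z ^+ n) = cabs z ^+ n.
Proof. by elim: n => [|n IH]; rewrite ?expr0 ?cabs1// !exprS cabsM IH. Qed.

Lemma cabs_real (t : R) : cabs t%:C = `|t|.
Proof. by rewrite /cabs /= expr0n /= addr0 sqrtr_sqr. Qed.

Lemma normr_cabs z : `|z| = (cabs z)%:C.
Proof. by case: z. Qed.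

Lemma cabs_conj z : cabs (conjc z) = cabs z.
Proof. by case: z => a b; rewrite /cabs /= sqrrN. Qed.

Lemma cjK (z : R[i]) : conjc (conjc z) = z.
Proof. by case: z => a b /=; rewrite opprK. Qed.

Lemma mul_conj_cabs z : z * conjc z = (cabs z ^+ 2)%:C.
Proof.
rewrite cabs_sqr; case: z => a b.
by apply/eqP; rewrite eq_complex /=; apply/andP; split; apply/eqP; ring.
Qed.

Lemma Re_le_cabs z : `|Re z| <= cabs z.
Proof.
rewrite -ler_sqr ?nnegrE ?cabs_ge0 // real_normK ?num_real // cabs_sqr.
by rewrite lerDl sqr_ge0.
Qed.

Lemma Im_le_cabs z : `|Im z| <= cabs z.
Proof.
rewrite -ler_sqr ?nnegrE ?cabs_ge0 // real_normK ?num_real // cabs_sqr.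
by rewrite lerDr sqr_ge0.
Qed.

Lemma cabs_sub_le z w : cabs z <= cabs w + cabs (z - w).
Proof. by rewrite -{1}[z](subrK w) addrC; exact: le_trans (cabsD _ _) _. Qed.

Lemma cabs_sum (I : Type) (r : seq I) (P : pred I) (F : I -> R[i]) :
  cabs (\sum_(i <- r | P i) F i) <= \sum_(i <- r | P i) cabs (F i).
Proof.
elim/big_rec2: _ => [|i u v _ H]; first by rewrite cabs0.
by apply: le_trans (cabsD _ _) _; rewrite lerD2l.
Qed.

Lemma Re_add z w : Re (z + w) = Re z + Re w. Proof. by case: z; case: w. Qed.
Lemma Im_add z w : Im (z + w) = Im z + Im w. Proof. by case: z; case: w. Qed.
Lemma Re_opp z : Re (- z) = - Re z. Proof. by case: z. Qed.
Lemma Im_opp z : Im (- z) = - Im z. Proof. by case: z. Qed.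
Lemma Re_mul z w : Re (z * w) = Re z * Re w - Im z * Im w.
Proof. by case: z; case: w. Qed.
Lemma Im_mul z w : Im (z * w) = Re z * Im w + Im z * Re w.
Proof. by case: z; case: w. Qed.
Lemma Re_inv z : Re z^-1 = Re z / cabs z ^+ 2.
Proof. by rewrite cabs_sqr; case: z. Qed.
Lemma Im_inv z : Im z^-1 = - Im z / cabs z ^+ 2.
Proof. by rewrite cabs_sqr; case: z => a b /=; rewrite mulNr. Qed.

Lemma complexP z w : Re z = Re w -> Im z = Im w -> z = w.
Proof. by case: z => a b; case: w => c d /= -> ->. Qed.

Lemma real_of_Im0 z : Im z = 0 -> z = (Re z)%:C.
Proof. by move=> h; apply: complexP. Qed.

Definition hnorm a b : R := Num.sqrt (cabs a ^+ 2 + cabs b ^+ 2).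

Lemma hnorm_ge0 a b : 0 <= hnorm a b. Proof. exact: sqrtr_ge0. Qed.

Lemma hnorm_sqr a b : hnorm a b ^+ 2 = cabs a ^+ 2 + cabs b ^+ 2.
Proof. by rewrite sqr_sqrtr // addr_ge0 ?sqr_ge0. Qed.

Lemma hnorm_gt0 a b : (0 < hnorm a b) = (a != 0) || (b != 0).
Proof.
rewrite sqrtr_gt0 lt_def addr_ge0 ?sqr_ge0 // andbT.
by rewrite paddr_eq0 ?sqr_ge0 // !sqrf_eq0 !cabs_eq0 negb_and.
Qed.

Lemma hnorm_l a b : cabs a <= hnorm a b.
Proof.
by rewrite -ler_sqr ?nnegrE ?cabs_ge0 ?hnorm_ge0 // hnorm_sqr lerDl sqr_ge0.
Qed.

Lemma hnorm_r a b : cabs b <= hnorm a b.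
Proof.
by rewrite -ler_sqr ?nnegrE ?cabs_ge0 ?hnorm_ge0 // hnorm_sqr lerDr sqr_ge0.
Qed.

Lemma hnorm_scale a b c : hnorm (c * a) (c * b) = cabs c * hnorm a b.
Proof.
rewrite /hnorm !cabsM !exprMn -mulrDr sqrtrM ?sqr_ge0 // sqrtr_sqr.
by rewrite ger0_norm ?cabs_ge0.
Qed.

(** Lagrange's identity: the difference of the squared sides is |a d - b c|^2, written below as the
    sum of the squares of its real and imaginary parts. *)
Lemma cauchy_schwarz2 a b c d :
  cabs (a * conjc c + b * conjc d) <= hnorm a b * hnorm c d.
Proof.
rewrite -ler_sqr ?nnegrE ?mulr_ge0 ?cabs_ge0 ?hnorm_ge0 //.
rewrite exprMn !hnorm_sqr !cabs_sqr.
case: a => a1 a2; case: b => b1 b2; case: c => c1 c2; case: d => d1 d2 /=.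
rewrite -subr_ge0.
set e := (X in 0 <= X).
suff -> : e = (a1 * d1 - a2 * d2 - (b1 * c1 - b2 * c2)) ^+ 2 +
             (a1 * d2 + a2 * d1 - (b1 * c2 + b2 * c1)) ^+ 2.
  by rewrite addr_ge0 ?sqr_ge0.
rewrite /e; ring.
Qed.

(* The point [a : b] of the projective line; [pt 0 0] is the junk value [infty]. *)
Definition pt a b : sphere R := if b == 0 then infty else finpt (a / b).

Lemma ptP x : exists a b, 0 < hnorm a b /\ x = pt a b.
Proof.
case: x => [z|]; [exists z, 1 | exists 1, 0]; rewrite hnorm_gt0 oner_eq0 ?orbT.
  by split=> //; rewrite /pt oner_eq0 divr1.
by rewrite /pt eqxx.
Qed.

Lemma pt_fin z : finpt z = pt z 1. Proof. by rewrite /pt oner_eq0 divr1. Qed.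
Lemma pt_inf : infty = pt 1 0. Proof. by rewrite /pt eqxx. Qed.

Lemma pt_scale c a b : c != 0 -> pt (c * a) (c * b) = pt a b.
Proof.
move=> c0; rewrite /pt mulf_eq0 (negPf c0) /=; case: eqP => // /eqP b0.
by rewrite -mulf_div divff // mul1r.
Qed.

Lemma ratmap_fin (p q : {poly R[i]}) z : ratmap p q (finpt z) = pt p.[z] q.[z].
Proof. by []. Qed.

(** A determinant over a product of Hermitian norms: in this form infinity is no longer a special
    point, and the effect of a rational map on chords can be read off from its binary forms. *)
Lemma half_chord_pt a b c d : 0 < hnorm a b -> 0 < hnorm c d ->
  half_chord (pt a b) (pt c d) = cabs (a * d - b * c) / (hnorm a b * hnorm c d).
Proof.
have ff z w : half_chord (finpt z) (finpt w)
    = cabs (z * 1 - 1 * w) / (hnorm z 1 * hnorm w 1).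
  rewrite /= /half_chord_fin /hnorm mulr1 mul1r cabs1 expr1n.
  by rewrite [1 + cabs z ^+ 2]addrC [1 + cabs w ^+ 2]addrC.
have fi z : half_chord (finpt z) (infty)
    = cabs (z * 0 - 1 * 1) / (hnorm z 1 * hnorm 1 0).
  rewrite /= /half_chord_fin /hnorm mulr1 mulr0 sub0r cabsN cabs1 expr1n.
  by rewrite cabs0 expr0n addr0 sqrtr1 mulr1 mul1r [1 + cabs z ^+ 2]addrC.
have if_ z : half_chord (infty) (finpt z)
    = cabs (1 * 1 - 0 * z) / (hnorm 1 0 * hnorm z 1).
  rewrite /= /half_chord_fin /hnorm mulr1 mul0r subr0 cabs1 expr1n.
  by rewrite cabs0 expr0n addr0 sqrtr1 !mul1r [1 + cabs z ^+ 2]addrC.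
have nf (e f : R[i]) : f != 0 -> e = f * (e / f) by move=> f0; rewrite mulrC divfK.
rewrite !hnorm_gt0 /pt.
have [->|b0] := eqVneq b 0; have [->|d0] := eqVneq d 0; rewrite ?orbF ?orbT.
- by rewrite /= mulr0 mul0r subr0 cabs0 mul0r.
- move=> a0 _; rewrite if_ mul0r subr0.
  have ha : hnorm a 0 = cabs a * hnorm 1 0 by rewrite -hnorm_scale mulr1 mulr0.
  have hd : hnorm c d = cabs d * hnorm (c / d) 1.
    by rewrite -hnorm_scale mulr1 -nf.
  rewrite ha hd mul0r subr0 !cabsM cabs1 mulr1.
  have h0 : 0 < hnorm 1 0 by rewrite hnorm_gt0 oner_eq0.
  have h1 : 0 < hnorm (c / d) 1 by rewrite hnorm_gt0 oner_eq0 orbT.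
  field; rewrite !cabs_eq0 a0 d0 gt_eqF //= gt_eqF //.
- move=> _ c0; rewrite fi mulr0 sub0r.
  have ha : hnorm c 0 = cabs c * hnorm 1 0 by rewrite -hnorm_scale mulr1 mulr0.
  have hd : hnorm a b = cabs b * hnorm (a / b) 1.
    by rewrite -hnorm_scale mulr1 -nf.
  rewrite ha hd !mulr0 !sub0r !cabsN !cabsM cabs1.
  have h0 : 0 < hnorm 1 0 by rewrite hnorm_gt0 oner_eq0.
  have h1 : 0 < hnorm (a / b) 1 by rewrite hnorm_gt0 oner_eq0 orbT.
  field; rewrite !cabs_eq0 c0 b0 gt_eqF //= gt_eqF //.
- move=> _ _; rewrite ff.
  have hc : hnorm c d = cabs d * hnorm (c / d) 1.
    by rewrite -hnorm_scale mulr1 -nf.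
  have ha : hnorm a b = cabs b * hnorm (a / b) 1.
    by rewrite -hnorm_scale mulr1 -nf.
  have -> : a * d - b * c = b * d * (a / b * 1 - 1 * (c / d)).
    by field; rewrite b0 d0.
  have h0 : 0 < hnorm (c / d) 1 by rewrite hnorm_gt0 oner_eq0 orbT.
  have h1 : 0 < hnorm (a / b) 1 by rewrite hnorm_gt0 oner_eq0 orbT.
  rewrite hc ha !cabsM.
  field; rewrite !cabs_eq0 d0 b0 gt_eqF //= gt_eqF //.
Qed.

Lemma half_chord_ge0 x y : 0 <= half_chord x y.
Proof.
have [a [b [h ->]]] := ptP x; have [c [d [k ->]]] := ptP y.
by rewrite half_chord_pt // divr_ge0 ?cabs_ge0 // mulr_ge0 ?ltW.
Qed.

Lemma half_chordC x y : half_chord x y = half_chord y x.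
Proof.
have [a [b [h ->]]] := ptP x; have [c [d [k ->]]] := ptP y.
by rewrite !half_chord_pt // cabsB [in RHS]mulrC [d * a]mulrC [c * b]mulrC [in RHS]mulrC
  [hnorm c d * _]mulrC.
Qed.

Lemma half_chordxx x : half_chord x x = 0.
Proof.
have [a [b [h ->]]] := ptP x.
by rewrite half_chord_pt // [b * a]mulrC subrr cabs0 mul0r.
Qed.

Lemma half_chord_eq0 x y : half_chord x y = 0 -> x = y.
Proof.
have s1 z : 0 < 1 + cabs z ^+ 2 :> R by rewrite ltr_wpDr ?sqr_ge0.
case: x y => [z|] [w|] //= /eqP; rewrite ?invr_eq0 /half_chord_fin.
- rewrite mulf_eq0 invr_eq0 mulf_eq0 !sqrtr_eq0 !leNgt !s1 !orbF.
  by rewrite cabs_eq0 subr_eq0 => /eqP ->.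
- by rewrite sqrtr_eq0 leNgt s1.
- by rewrite sqrtr_eq0 leNgt s1.
Qed.

Lemma half_chord_le1 x y : half_chord x y <= 1.
Proof.
have [a [b [h ->]]] := ptP x; have [c [d [k ->]]] := ptP y.
rewrite half_chord_pt // ler_pdivrMr ?mulr_gt0 // mul1r.
(* The determinant is the Hermitian product of (a, b) with the conjugate of (d, -c), a vector with
   the norm of (c, d). *)
have := cauchy_schwarz2 a b (conjc d) (conjc (- c)); rewrite !cjK mulrN; congr (_ <= _ * _).
by rewrite /hnorm !cabs_conj cabsN addrC.
Qed.

Lemma half_chord_triangle y x (z : sphere R) :
  half_chord x z <= half_chord x y + half_chord y z.
Proof.
have [u1 [u2 [hu ->]]] := ptP x; have [v1 [v2 [hv ->]]] := ptP y.
have [w1 [w2 [hw ->]]] := ptP z.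
rewrite !half_chord_pt //.
set U := hnorm u1 u2 in hu *; set V := hnorm v1 v2 in hv *.
set W := hnorm w1 w2 in hw *.
(* the Plücker relation u (v /\ w) + v (w /\ u) + w (u /\ v) = 0, paired with v *)
have key : (u1 * w2 - u2 * w1) * (V ^+ 2)%:C =
   (u1 * v2 - u2 * v1) * (w1 * conjc v1 + w2 * conjc v2)
   + (v1 * w2 - v2 * w1) * (u1 * conjc v1 + u2 * conjc v2).
  by rewrite hnorm_sqr rmorphD /= -!mul_conj_cabs; ring.
have c1 := cauchy_schwarz2 w1 w2 v1 v2.
have c2 := cauchy_schwarz2 u1 u2 v1 v2.
have : cabs (u1 * w2 - u2 * w1) * V ^+ 2 <=
   cabs (u1 * v2 - u2 * v1) * (W * V) + cabs (v1 * w2 - v2 * w1) * (U * V).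
  have -> : V ^+ 2 = cabs (V ^+ 2)%:C by rewrite cabs_real ger0_norm ?sqr_ge0.
  rewrite -cabsM key; apply: le_trans (cabsD _ _) _; rewrite !cabsM.
  by apply: lerD; apply: ler_wpM2l; rewrite ?cabs_ge0.
move=> H.
rewrite ler_pdivrMr ?mulr_gt0 // -(ler_pM2r (exprn_gt0 2 hv)).
apply: le_trans H _; rewrite le_eqVlt; apply/orP; left; apply/eqP.
by field; rewrite !gt_eqF.
Qed.

Lemma chord_fin_lt z w : half_chord (finpt z) (finpt w) <= cabs (z - w).
Proof.
rewrite !pt_fin half_chord_pt ?hnorm_gt0 ?oner_eq0 ?orbT // mulr1 mul1r.
have g1 (c : R[i]) : 1 <= hnorm c 1 by rewrite -cabs1 hnorm_r.
have h1 : 1 <= hnorm z 1 * hnorm w 1 by rewrite -[1]mulr1 ler_pM.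
rewrite ler_pdivrMr ?(lt_le_trans _ h1) // -[leLHS]mulr1.
by rewrite ler_wpM2l ?cabs_ge0.
Qed.

End Modulus.

(** * The topology of the sphere is that of the chordal metric *)

Section Topology.
Variable R : realType.
Implicit Types (x y : sphere R).

Lemma nbhs_cabsP (z : (R[i])^o) (V : set (R[i])^o) :
  nbhs z V <-> exists2 e : R, 0 < e & forall w, cabs (z - w) < e -> V w.
Proof.
split=> [[e /= e0 He]|[e e0 He]].
  have eE : e = (Re e)%:C by rewrite RRe_real // gtr0_real.
  exists (Re e); first by rewrite -ltcR -eE.
  move=> w zw; apply: He; rewrite /ball /= /ball_ /= normr_cabs eE.
  by rewrite ltcR.
exists e%:C; rewrite /= ?ltcR // => w; rewrite /ball /= /ball_ /= normr_cabs.
by rewrite ltcR; exact: He.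
Qed.

Lemma cabs_continuous : continuous (fun z : (R[i])^o => cabs z).
Proof.
move=> z V /nbhs_ballP[e /= e0 He].
apply/nbhs_cabsP; exists e => // w zw; apply: He; apply: le_lt_trans zw.
rewrite ler_norml; apply/andP; split.
  rewrite lerNl opprB lerBlDl [leRHS]addrC addrC cabsB; exact: cabs_sub_le.
by rewrite lerBlDl; exact: cabs_sub_le.
Qed.

Definition of_pair (t : R * R) : (R[i])^o := t.1 +i* t.2.

Lemma of_pair_continuous : continuous of_pair.
Proof.
move=> [a b] V /nbhs_cabsP[e e00 He].
have e2 : 0 < e / 2 by rewrite divr_gt0.
exists (ball a (e / 2), ball b (e / 2)).
  by split; apply: nbhsx_ballx.
case=> c d [/= h1 h2]; apply: He; rewrite /of_pair /fst /snd.
have -> : (a +i* b) - (c +i* d) = (a - c)%:C + (0 +i* (b - d)) :> R[i].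
  by apply: complexP; rewrite ?Re_add ?Im_add /=; ring.
apply: le_lt_trans (cabsD _ _) _; rewrite cabs_real.
have -> : cabs (0 +i* (b - d)) = `|b - d|.
  by rewrite /cabs /= expr0n add0r sqrtr_sqr.
move: h1 h2; rewrite /ball /= => h1 h2.
by rewrite (splitr e) ltrD.
Qed.

(** Compactness in the plane is imported from a product of real intervals, with squares in the role
    of discs. *)
Lemma square_compact (r : R) :
  compact (of_pair @` (`[- r, r] `*` `[- r, r])).
Proof.
apply: continuous_compact.
  by apply: continuous_subspaceT => t; exact: of_pair_continuous.
by apply: compact_setX; exact: segment_compact.
Qed.

Lemma finpt_nbhsP (z : R[i]) (V : set (sphere R)) : nbhs (finpt z) V <->
  exists2 e : R, 0 < e & forall w, cabs (z - w) < e -> V (finpt w).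
Proof.
have -> : nbhs (finpt z) V = nbhs (z : (R[i])^o) (fun w => V (finpt w)) by [].
exact: nbhs_cabsP.
Qed.

Lemma inv_sqrt_lt (r e : R) : 0 < e -> e^-1 <= r ->
  (Num.sqrt (1 + r ^+ 2))^-1 < e.
Proof.
move=> e0 er; have r0 : 0 < r by apply: lt_le_trans er; rewrite invr_gt0.
have h : 0 < Num.sqrt (1 + r ^+ 2) by rewrite sqrtr_gt0 ltr_pwDl // sqr_ge0.
rewrite -[e]invrK ltf_pV2 ?posrE ?invr_gt0 //; apply: le_lt_trans er _.
rewrite -ltr_sqr ?nnegrE ?(ltW r0) ?(ltW h) // sqr_sqrtr.
  by rewrite ltrDr.
by rewrite addr_ge0 ?sqr_ge0.
Qed.

Lemma infty_nbhsP (V : set (sphere R)) : nbhs (infty : sphere R) V <->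
  exists2 r : R, 0 < r & V infty /\ forall w, r < cabs w -> V (finpt w).
Proof.
have -> : nbhs (infty : sphere R) V =
  filter_from (@compact (R[i])^o `&` closed)
    (fun U => (Some @` (~`U)) `|` [set None]) V by [].
split=> [[K [cK _] KV]|[r r0 [Vi Vr]]].
  have : compact ((fun z : (R[i])^o => cabs z) @` K).
    apply: continuous_compact => //; apply: continuous_subspaceT => z.
    exact: cabs_continuous.
  move=> /compact_bounded [M [_ HM]].
  exists (`|M| + 1); first by rewrite ltr_wpDl.
  split; first by apply: KV; right.
  move=> w hw; apply: KV; left; exists w => // Kw.
  have := HM (`|M| + 1); rewrite ltr_pwDr ?ler_norm // => /(_ isT).
  move=> /(_ (cabs w)) /=; have : exists2 x, K x & cabs x = cabs w by exists w.
  move=> h /(_ h); rewrite ger0_norm ?cabs_ge0 // leNgt.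
  by rewrite hw.
exists (of_pair @` (`[- r, r] `*` `[- r, r])).
  split; first exact: square_compact.
  apply: compact_closed; last exact: square_compact.
  exact: norm_hausdorff.
move=> _ [[w nw <-]|->] //; apply: Vr; rewrite ltNge; apply/negP => wr.
apply: nw; exists (Re w, Im w); last by case: (w).
by split; rewrite /= in_itv /= -ler_norml; apply: le_trans wr;
  rewrite ?Re_le_cabs ?Im_le_cabs.
Qed.

(** The bridge from the one-point compactification to the chordal metric, through which openness of
    sets is handled afterwards. *)
Lemma sphere_nbhsP x (V : set (sphere R)) : nbhs x V <->
  exists2 e : R, 0 < e & forall y, half_chord x y < e -> V y.
Proof.
have s1 (z : R[i]) : 0 < 1 + cabs z ^+ 2 :> R by rewrite ltr_wpDr ?sqr_ge0.
case: x => [z|].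
- rewrite -/(finpt z) finpt_nbhsP; split=> [[e e0 He]|[e e0 He]]; last first.
    exists e => // w zw; apply: He; apply: le_lt_trans zw; exact: chord_fin_lt.
  set r := cabs z + e.
  have r0 : 0 < r by rewrite ltr_wpDl ?cabs_ge0.
  set A := Num.sqrt (1 + cabs z ^+ 2); set B := Num.sqrt (1 + r ^+ 2).
  have A0 : 0 < A by rewrite sqrtr_gt0.
  have B0 : 0 < B by rewrite sqrtr_gt0 ltr_wpDr ?sqr_ge0.
  have h3 : 0 < r + 1 + cabs z by rewrite ltr_wpDr ?cabs_ge0 // addr_gt0.
  (* The first bound treats |w| <= r, where the factor of w in the denominator is at most B. The
     second is the chord from z to infinity. The third treats |w| > r, where |z - w| is at least |w|
     - |z| and the factor of w at most 1 + |w|. *)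
  have e20 : 0 < Num.min (e / (A * B)) (Num.min A^-1 (A^-1 * (e / (r + 1 + cabs z)))).
    by rewrite !lt_min invr_gt0 A0 divr_gt0 ?mulr_gt0 //= ?invr_gt0 // divr_gt0.
  exists (Num.min (e / (A * B)) (Num.min A^-1 (A^-1 * (e / (r + 1 + cabs z))))) => //.
  case=> [w|]; rewrite !lt_min => /and3P[h1 h2 h4]; last first.
    by move: h2; rewrite /= ltxx.
  apply: He; rewrite ltNge; apply/negP => zw.
  have [wr|rw] := leP (cabs w) r.
    move: h1; rewrite /= /half_chord_fin -/A; apply/negP; rewrite -leNgt.
    have C0 : 0 < Num.sqrt (1 + cabs w ^+ 2) by rewrite sqrtr_gt0.
    apply: ler_pM => //; rewrite ?(ltW e0) ?invr_ge0 ?mulr_ge0 ?(ltW A0) ?(ltW B0) //.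
    rewrite lef_pV2 ?posrE ?mulr_gt0 // ler_pM2l // ler_sqrt //.
      by rewrite lerD2l ler_sqr ?nnegrE ?cabs_ge0 ?(ltW r0).
    by rewrite addr_ge0 ?sqr_ge0.
  move: h4; rewrite /= /half_chord_fin -/A; apply/negP; rewrite -leNgt.
  set C := Num.sqrt _; have C0 : 0 < C by rewrite sqrtr_gt0.
  have Cw : C <= 1 + cabs w.
    rewrite -ler_sqr ?nnegrE ?(ltW C0) ?addr_ge0 ?cabs_ge0 //.
    rewrite sqr_sqrtr ?(ltW (s1 w)) // sqrrD expr1n mul1r -addrA lerD2l.
    by rewrite lerDr mulrn_wge0 ?cabs_ge0.
  have zw2 : cabs w <= cabs z + cabs (z - w) by rewrite cabsB cabs_sub_le.
  have cz := cabs_ge0 z.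
  have er : e <= r by rewrite lerDr.
  move: (cabs z) (cabs w) (cabs (z - w)) cz zw zw2 Cw h3 er e0 r0 A0 C0.
  move=> a b t a0 et bt Cb h3 er e0 r0 A0 C0.
  have -> : t / (A * C) = A^-1 * (t / C) by rewrite invfM mulrCA.
  rewrite ler_pM2l ?invr_gt0 // ler_pdivrMr // mulrAC ler_pdivlMr //.
  by nra.
- rewrite -[None]/(infty : sphere R) infty_nbhsP; split=> [[r r0 [Vi Vr]]|[e e0 He]]; last first.
    exists e^-1; first by rewrite invr_gt0.
    split; first by apply: He.
    by move=> w hw; apply: He; rewrite /= inv_sqrt_lt // ltW.
  exists (Num.sqrt (1 + r ^+ 2))^-1.
    by rewrite invr_gt0 sqrtr_gt0 ltr_wpDr ?sqr_ge0.
  case=> [w|] //= h; apply: Vr; rewrite ltNge; apply/negP => wr.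
  move: h; apply/negP; rewrite -leNgt lef_pV2 ?posrE ?sqrtr_gt0 //.
    rewrite ler_sqrt // ?lerD2l ?ler_sqr ?nnegrE ?cabs_ge0 ?(ltW r0) //.
    by rewrite addr_ge0 ?sqr_ge0.
  by rewrite ltr_wpDr ?sqr_ge0.
Qed.

Lemma sphere_open_chordP (W : set (sphere R)) : open W <->
  forall x, W x -> exists2 e : R, 0 < e & forall y, half_chord x y < e -> W y.
Proof.
rewrite openE; split=> H x Wx; first by apply/sphere_nbhsP; exact: (H x).
by apply/sphere_nbhsP; exact: H.
Qed.

Lemma chord_ball_open x (e : R) : open [set y | half_chord x y < e].
Proof.
apply/sphere_open_chordP => y /= xy; exists (e - half_chord x y).
  by rewrite subr_gt0.
move=> z yz; apply: le_lt_trans (half_chord_triangle y x z) _.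
by rewrite -ltrBrDl.
Qed.

Lemma chord_ball_closed_compact x (e : R) : compact [set y | half_chord x y <= e].
Proof.
apply: (@subclosed_compact _ _ [set: sphere R]) => //; last first.
  exact: one_point_compactification_compact.
rewrite -[X in closed X]setCK; apply: open_closedC.
apply/sphere_open_chordP => y /= /negP; rewrite -ltNge => xy.
exists (half_chord x y - e); first by rewrite subr_gt0.
move=> z yz; apply/negP; rewrite -ltNge.
have := half_chord_triangle z x y; rewrite (half_chordC z y); lra.
Qed.

Lemma sphere_compact : compact [set: sphere R].
Proof. exact: one_point_compactification_compact. Qed.

Lemma spherical_distE x y : spherical_dist x y = 2 * asin (half_chord x y).
Proof. by []. Qed.

Lemma asin_lt : {in `[(-1), 1] &, {mono (@asin R) : u v / u < v}}.
Proof.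
move=> u v; rewrite !in_itv /= => hu hv.
have hh (w : R) : -1 <= w <= 1 -> asin w \in `[(- (pi / 2)), (pi / 2)].
  by move=> hw; rewrite in_itv /= asin_geNpi2 // asin_lepi2.
by rewrite -[LHS](ltr_sin (hh u hu) (hh v hv)) !asinK ?in_itv.
Qed.

Lemma asin0 : asin 0 = 0 :> R.
Proof. by rewrite -[in LHS](@sin0 R) sinK // in_itv /= oppr_le0 divr_ge0 ?pi_ge0. Qed.

Lemma half_chord_itv x y : half_chord x y \in `[(-1), 1].
Proof.
by rewrite in_itv /= half_chord_le1 (le_trans _ (half_chord_ge0 x y)) ?lerN10.
Qed.

(** [normal_family] speaks of great-circle distance. This lemma and the next allow all later work to
    use chords; the cut-offs at 1 here and at pi / 2 there stay within the range where asin and sin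
    are increasing inverses of each other. *)
Lemma chord_lt_of_dist (d : R) : 0 < d -> exists2 e, 0 < e &
  forall x y, spherical_dist x y < e -> half_chord x y < d.
Proof.
move=> d0; set m := Num.min d 1.
have m0 : 0 < m by rewrite lt_min d0 ltr01.
have mi : m \in `[(-1), 1].
  by rewrite in_itv /= ge_min lexx orbT andbT (le_trans _ (ltW m0)) ?lerN10.
have zi : 0 \in `[(-1), 1 : R] by rewrite in_itv /= lerN10 ler01.
exists (2 * asin m); first by rewrite mulr_gt0 // -asin0 asin_lt.
move=> x y; rewrite spherical_distE ltr_pM2l // asin_lt ?half_chord_itv //.
by move=> h; apply: lt_le_trans h _; rewrite ge_min lexx.
Qed.

Lemma dist_lt_of_chord (e : R) : 0 < e -> exists2 d, 0 < d &
  forall x y, half_chord x y < d -> spherical_dist x y < e.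
Proof.
move=> e0; set v := Num.min (e / 2) (pi / 2).
have v0 : 0 < v by rewrite lt_min !divr_gt0 ?pi_gt0.
have vp : v <= pi / 2 by rewrite ge_min lexx orbT.
have vi : v \in `[(- (pi / 2)), (pi / 2)].
  by rewrite in_itv /= vp andbT (le_trans _ (ltW v0)) // oppr_le0 divr_ge0 ?pi_ge0.
have zi : 0 \in `[(- (pi / 2)), (pi / 2 : R)].
  by rewrite in_itv /= oppr_le0 divr_ge0 ?pi_ge0.
exists (sin v); first by rewrite -(@sin0 R) ltr_sin.
move=> x y h; rewrite spherical_distE mulrC -ltr_pdivlMr //.
apply: (@lt_le_trans _ _ v); last by rewrite ge_min lexx.
by rewrite -[v](sinK vi) asin_lt ?half_chord_itv // in_itv /= sin_geN1 sin_le1.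
Qed.

End Topology.

(** * Normality as local equicontinuity *)

Section Fatou.
Variable R : realType.
Implicit Types (x y : sphere R).

Definition chord_cont (f : sphere R -> sphere R) := forall x (e : R), 0 < e ->
  exists2 d : R, 0 < d &
    forall y, half_chord x y < d -> half_chord (f x) (f y) < e.

Definition equicont (u : nat -> sphere R -> sphere R) x := forall e : R, 0 < e ->
  exists2 d : R, 0 < d &
    forall n y, half_chord x y < d -> half_chord (u n x) (u n y) < e.

(* [fwd h n] is the (n+1)-st iterate, matching [iterates]. *)
Definition fwd (h : sphere R -> sphere R) (n : nat) := iter n.+1 h.

Lemma chord_cont_iter h n : chord_cont h -> chord_cont (iter n h).
Proof.
move=> ch; elim: n => [|n IH] x e e0 /=; first by exists e.
have [d d0 Hd] := ch (iter n h x) e e0.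
by have [d' d'0 Hd'] := IH x d d0; exists d' => // y /Hd' /Hd.
Qed.

Lemma strict_subsequence (P : nat -> nat -> Prop) :
  (forall j M, exists2 n, (M <= n)%N & P j n) ->
  exists2 k : nat -> nat, {homo k : m n / (m < n)%N} & forall j, P j (k j).
Proof.
move=> H.
have [c Hc] : exists c : nat -> nat -> nat, forall j M,
    (M <= c j M)%N /\ P j (c j M).
  have [c Hc] := choice (fun jM : nat * nat =>
    let: ex_intro2 n h1 h2 := H jM.1 jM.2 in
    ex_intro (fun n => (jM.2 <= n)%N /\ P jM.1 n) n (conj h1 h2)).
  by exists (fun j M => c (j, M)) => j M; exact: (Hc (j, M)).
pose k := fix k j := if j is j'.+1 then c j'.+1 (k j').+1 else c 0%N 0%N.
exists k; last by case=> [|j] /=; exact: (Hc _ _).2.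
apply: homo_ltn => [y x z|i]; first exact: ltn_trans.
exact: (Hc _ _).1.
Qed.

(* The limit is a cluster point for pointwise convergence (Tychonoff);
   equicontinuity makes the clustering uniform on [D], so no diagonal argument
   is needed. *)
Lemma ascoli_subsequence (u : nat -> sphere R -> sphere R) (D : set (sphere R)) :
  compact D -> (forall x, D x -> equicont u x) ->
  exists (k : nat -> nat) (l : sphere R -> sphere R),
    {homo k : m n / (m < n)%N} /\
    forall e : R, 0 < e -> \forall n \near \oo,
      forall x, D x -> half_chord (u (k n) x) (l x) < e.
Proof.
move=> cD eqD.
have cA : compact [set f : prod_topology (fun _ : sphere R => sphere R) |
    forall i, [set: sphere R] (f i)].
  exact: (@tychonoff (sphere R) (fun _ => sphere R) (fun _ => setT)
           (fun _ => @sphere_compact R)).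
pose F : set_system (prod_topology (fun _ : sphere R => sphere R)) :=
  (fun n => u n) @ \oo.
have FF : ProperFilter F by apply: fmap_proper_filter.
have [|l [_ clF]] := cA F FF; first by near=> n.
have projl x (e : R) : 0 < e -> nbhs l
    [set f : prod_topology (fun _ : sphere R => sphere R) |
      half_chord (l x) (f x) < e].
  move=> e0; have H : nbhs (l x) [set y | half_chord (l x) y < e].
    by apply/sphere_nbhsP; exists e.
  exact: (@proj_continuous _ (fun _ => sphere R) x l _ H).
have hit (N : set (prod_topology (fun _ : sphere R => sphere R))) M :
    nbhs l N -> exists2 n, (M <= n)%N & N (u n).
  move=> lN; have FM : F [set f | exists2 n, (M <= n)%N & f = u n].
    by exists M => // n /= Mn; exists n.
  by have [f [[n Mn ->] Nn]] := clF _ _ FM lN; exists n.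
have unif (e : R) : 0 < e -> exists2 N, nbhs l N &
    forall n, N (u n) -> forall x, D x -> half_chord (u n x) (l x) < e.
  (* Five errors: one for the equicontinuity of u n, one for its closeness to l at x, and three for
     the variation of l between x and y, which is compared with that of some u m close to l at both
     points. *)
  move=> e0; set t := e / 5.
  have t0 : 0 < t by rewrite divr_gt0.
  (* The near-covering form of compactness turns neighbourhoods of the pairs (x, l), x in D, into
     one neighbourhood of l valid for all of D. *)
  have ncD := (compact_near_coveringP D).1 cD.
  pose P (f : prod_topology (fun _ : sphere R => sphere R)) x :=
    forall n, f = u n -> half_chord (u n x) (l x) < e.
  have [N lN HN] : exists2 N, nbhs l N & forall f, N f -> D `<=` P f.
    exists [set f | D `<=` P f] => //.
    apply: (ncD _ (nbhs l) P (nbhs_filter l)) => x Dx.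
    - have [d d0 Hd] := eqD x Dx t t0.
      exists ([set y | half_chord x y < d], [set f | half_chord (l x) (f x) < t]).
        split; [by apply/sphere_nbhsP; exists d | exact: projl].
      case=> y f /= [xy fx] n fE; rewrite fE in fx.
      have llt : half_chord (l x) (l y) < 3 * t.
        have [m _ [m1 m2]] := hit _ 0%N (filterI (projl x t t0) (projl y t t0)).
        have h1 := half_chord_triangle (u m x) (l x) (l y).
        have h2 := half_chord_triangle (u m y) (u m x) (l y).
        have h3 := Hd m y xy.
        move: m1 m2; rewrite /= (half_chordC (l y)) => m1 m2; lra.
      have h1 := half_chord_triangle (u n x) (u n y) (l y).
      have h2 := half_chord_triangle (l x) (u n x) (l y).
      have h3 := Hd n y xy.
      have te : e = 5 * t by rewrite /t mulrCA divff ?mulr1.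
      move: h1 h2 h3 fx; rewrite (half_chordC (u n y) (u n x)).
      rewrite (half_chordC (u n x) (l x)) te; lra.
  exists N => // n Nn x Dx; exact: (HN _ Nn x Dx n).
have [k kh Hk] : exists2 k : nat -> nat, {homo k : m n / (m < n)%N} &
    forall j, forall x, D x -> half_chord (u (k j) x) (l x) < j.+1%:R^-1.
  apply: (@strict_subsequence (fun j n => forall x, D x ->
    half_chord (u n x) (l x) < j.+1%:R^-1)) => j M.
  have [|N lN HN] := unif j.+1%:R^-1; first by rewrite invr_gt0 ltr0n.
  by have [n Mn Nn] := hit N M lN; exists n => //; exact: HN.
exists k, l; split=> // e e0.
have := near_infty_natSinv_lt (PosNum e0).
apply: filterS => n /= hn x Dx; exact: lt_trans (Hk n x Dx) hn.
Unshelve. all: by end_near. Qed.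

(** The neighbourhood is shrunk to a chordal ball inside a compact subset D of W, so that the one
    subsequence extracted on D serves every compact subset of the ball. *)
Lemma normal_of_equicont h (x : sphere R) (W : set (sphere R)) : open_nbhs x W ->
  (forall y, W y -> equicont (fwd h) y) -> ~ julia h x.
Proof.
move=> [oW Wx] eqW nj; apply: nj.
have /sphere_nbhsP[e e0 He] : nbhs x W by apply: open_nbhs_nbhs.
have e2 : 0 < e / 2 by rewrite divr_gt0.
exists [set y | half_chord x y < e / 2].
  by split; [exact: chord_ball_open | rewrite /= half_chordxx].
move=> u uI.
have [D cD [DW sD]] : exists2 D : set (sphere R), compact D &
    D `<=` W /\ [set y | half_chord x y < e / 2] `<=` D.
  exists [set y | half_chord x y <= e / 2]; first exact: chord_ball_closed_compact.
  split=> y /=; last exact: ltW.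
  by move=> xy; apply: He; apply: le_lt_trans xy _; rewrite ltr_pdivrMr // ltr_pMr // ltr1n.
have [|k [l [kh Hk]]] := @ascoli_subsequence u D cD.
  move=> y /DW /eqW equ r r0; have [d d0 Hd] := equ r r0.
  exists d => // n z yz; have [m _ <-] := uI n; exact: Hd.
exists k, l; split=> // K _ KW r r0.
have [d d0 Hd] := dist_lt_of_chord r0.
apply: filterS (Hk d d0) => n /= Hn y Ky; apply: Hd; apply: Hn.
exact/sD/KW.
Qed.

(** A failure of equicontinuity provides points tending to x and iterates that separate them from x
    by at least e. A late term of the convergent subsequence is compared, through the limit l, with
    one fixed term, which is continuous at x: four approximations of l and one use of continuity,
    hence e / 5. *)
Lemma equicont_of_normal h (W : set (sphere R)) : chord_cont h ->
  open W -> normal_family W (iterates h) -> forall x, W x -> equicont (fwd h) x.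
Proof.
move=> ch oW nW x Wx e e0; apply: contrapT => neg.
have bad j : exists ny : nat * sphere R, half_chord x ny.2 < j.+1%:R^-1 /\
    e <= half_chord (fwd h ny.1 x) (fwd h ny.1 ny.2).
  apply: contrapT => nj; apply: neg; exists j.+1%:R^-1.
    by rewrite invr_gt0 ltr0n.
  move=> n y xy; rewrite ltNge; apply/negP => le; apply: nj.
  by exists (n, y).
have [w Hw] := choice bad.
have [k [l [kh Hk]]] := nW (fun j => fwd h (w j).1) (fun j => imageP _ I).
have /sphere_nbhsP[r r0 Hr] : nbhs x W by apply: open_nbhs_nbhs.
have r2 : 0 < r / 2 by rewrite divr_gt0.
set K := [set y | half_chord x y <= r / 2].
have KW : K `<=` W.
  by move=> y xy; apply: Hr; apply: le_lt_trans xy _; rewrite ltr_pdivrMr // ltr_pMr // ltr1n.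
set t := e / 5; have t0 : 0 < t by rewrite divr_gt0.
have te : e = 5 * t by rewrite /t mulrCA divff ?mulr1.
have [s s0 Hs] := chord_lt_of_dist t0.
have Hu : \forall n \near \oo, forall y, K y ->
    half_chord (fwd h (w (k n)).1 y) (l y) < t.
  have := Hk K (@chord_ball_closed_compact _ _ _) KW s s0.
  by apply: filterS => n Hn y Ky; apply: Hs; exact: Hn.
have [N _ HN] := Hu.
have HNN := HN N (leqnn N).
have Kx : K x by rewrite /K /= half_chordxx ltW.
have [d d0 Hd] := @chord_cont_iter h (w (k N)).1.+1 ch x t t0.
have kge n : (n <= k n)%N.
  by elim: n => // n IH; apply: leq_ltn_trans IH _; apply: kh.
have m0 : 0 < Num.min d (r / 2) by rewrite lt_min d0.
have [M _ HM] := near_infty_natSinv_lt (PosNum m0).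
set n := maxn N M.
have := HM (k n) (leq_trans (leq_maxr N M) (kge n)); rewrite /= lt_min.
move=> /andP[sd sr].
have [h1 h2] := Hw (k n).
have Ky : K (w (k n)).2 by rewrite /K /=; apply: ltW; exact: lt_trans h1 sr.
have yd := lt_trans h1 sd.
have a1 := HN n (leq_maxl _ _) x Kx.
have a2 := HN n (leq_maxl _ _) _ Ky.
have a3 := HNN x Kx.
have a4 := HNN _ Ky.
have a5 := Hd _ yd.
rewrite -/(fwd h _) in a5.
move: h2 a1 a2 a3 a4 a5.
set y := (w (k n)).2; set f := fwd h (w (k n)).1; set g := fwd h (w (k N)).1.
move=> h2 a1 a2 a3 a4 a5.
have b1 := half_chord_triangle (l x) (f x) (f y).
have b2 := half_chord_triangle (l y) (l x) (f y).
have b3 := half_chord_triangle (g x) (l x) (l y).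
have b4 := half_chord_triangle (g y) (g x) (l y).
rewrite (half_chordC (l y) (f y)) in b2.
rewrite (half_chordC (l x) (g x)) in b3.
lra.
Qed.

Lemma fatouP h x : chord_cont h -> ~ julia h x <->
  exists2 W, open_nbhs x W & forall y, W y -> equicont (fwd h) y.
Proof.
move=> ch; split=> [/contrapT[W oW nW]|[W oW eW]]; last first.
  exact: normal_of_equicont eW.
by exists W => //; apply: equicont_of_normal nW => //; case: oW.
Qed.

End Fatou.

(** * Rational maps as pairs of binary forms: composition and continuity *)

Section RationalMaps.
Variable R : realType.
Implicit Types (p q r s : {poly R[i]}) (a b c z w : R[i]) (x y : sphere R).

(** The homogenisation of degree n, that is b^n p(a / b) when b is nonzero and [size p <= n.+1];
    coefficients beyond n are dropped. *)
Definition hz p n a b : R[i] := \sum_(i < n.+1) p`_i * a ^+ i * b ^+ (n - i).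

(** The same form at a pair of polynomials: numerators and denominators of composites, and reversed
    polynomials when the pair is (1, X). *)
Definition hcomp p n r s : {poly R[i]} :=
  \sum_(i < n.+1) p`_i *: (r ^+ i * s ^+ (n - i)).

Lemma hz_fin p n z : (size p <= n.+1)%N -> hz p n z 1 = p.[z].
Proof.
move=> sp; rewrite (horner_coef_wide z sp).
by apply: eq_bigr => i _; rewrite expr1n mulr1.
Qed.

Lemma hz_scale p n c a b : hz p n (c * a) (c * b) = c ^+ n * hz p n a b.
Proof.
rewrite /hz mulr_sumr; apply: eq_bigr => i _.
have -> : c ^+ n = c ^+ i * c ^+ (n - i) by rewrite -exprD subnKC // -ltnS.
by rewrite !exprMn; ring.
Qed.

Lemma hz_a0 p n a : hz p n a 0 = p`_n * a ^+ n.
Proof.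
rewrite /hz big_ord_recr /= subnn expr0 mulr1 big1 ?add0r // => i _.
by rewrite expr0n subn_eq0 leqNgt ltn_ord mulr0.
Qed.

Lemma horner_hcomp p n r s z : (hcomp p n r s).[z] = hz p n r.[z] s.[z].
Proof.
rewrite /hcomp horner_sum; apply: eq_bigr => i _.
by rewrite hornerZ hornerM !horner_exp mulrA.
Qed.

Lemma size_ratdeg_l p q : (size p <= (ratdeg p q).+1)%N.
Proof. by rewrite /ratdeg (leq_trans _ (leqSpred _)) // leq_maxl. Qed.

Lemma size_ratdeg_r p q : (size q <= (ratdeg p q).+1)%N.
Proof. by rewrite /ratdeg (leq_trans _ (leqSpred _)) // leq_maxr. Qed.

Lemma coef_ratdeg p q : q != 0 ->
  (p`_(ratdeg p q) != 0) || (q`_(ratdeg p q) != 0).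
Proof.
move=> q0; rewrite /ratdeg; case: leqP => pq.
  by rewrite -[q`__]lead_coefE lead_coef_eq0 q0 orbT.
by rewrite -lead_coefE lead_coef_eq0 -size_poly_gt0 (leq_trans _ pq).
Qed.

Lemma ratdeg_eq p q n : (size p <= n.+1)%N -> (size q <= n.+1)%N ->
  (p`_n != 0) || (q`_n != 0) -> ratdeg p q = n.
Proof.
move=> sp sq pq; apply/eqP; rewrite /ratdeg eqn_leq -ltnS.
apply/andP; split.
  have : (maxn (size p) (size q) <= n.+1)%N by rewrite geq_max sp.
  by case: maxn.
case/orP: pq => h; rewrite -ltnS (leq_trans _ (leqSpred _)) // leq_max;
  apply/orP; [left|right]; rewrite ltnNge; apply: contra h => h;
  by rewrite nth_default.
Qed.

Lemma coprimep_horner p q z : coprimep p q -> (p.[z] != 0) || (q.[z] != 0).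
Proof.
move=> cpq; have [pz|//] := eqVneq p.[z] 0.
by rewrite (coprimep_root cpq) // /root pz.
Qed.

(** A common zero of the two forms is excluded by coprimality in the finite chart, and at b = 0
    because the degree is the exact maximum. *)
Lemma hz_nondegenerate p q a b : coprimep p q -> q != 0 -> 0 < hnorm a b ->
  0 < hnorm (hz p (ratdeg p q) a b) (hz q (ratdeg p q) a b).
Proof.
move=> cpq q0; rewrite !hnorm_gt0.
have [-> |b0 _] := eqVneq b 0.
  rewrite orbF => a0; rewrite !hz_a0 !mulf_eq0 !negb_or !expf_neq0 // !andbT.
  exact: coef_ratdeg.
rewrite -[b]mulr1 -[a](divfK b0) [_ / b * b]mulrC !hz_scale.
rewrite !mulf_eq0 !negb_or !expf_neq0 //= !hz_fin ?size_ratdeg_l ?size_ratdeg_r //.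
exact: coprimep_horner.
Qed.

Lemma ratmap_pt p q a b : coprimep p q -> q != 0 -> 0 < hnorm a b ->
  ratmap p q (pt a b) = pt (hz p (ratdeg p q) a b) (hz q (ratdeg p q) a b).
Proof.
move=> cpq q0; rewrite hnorm_gt0; have [->|b0] := eqVneq b 0.
  rewrite orbF => a0; rewrite !hz_a0 ![_ * a ^+ _]mulrC pt_scale ?expf_neq0 //.
  by rewrite {1}/pt eqxx.
move=> _; rewrite -[X in hz p _ a X]mulr1 -[X in hz q _ a X]mulr1.
rewrite -[X in hz p _ X](divfK b0) -[X in hz q _ X](divfK b0) [_ / b * b]mulrC.
rewrite !hz_scale pt_scale ?expf_neq0 // !hz_fin ?size_ratdeg_l ?size_ratdeg_r //.
by rewrite {1}/pt (negPf b0).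
Qed.

Lemma coefM_top r s m n : (size r <= m.+1)%N -> (size s <= n.+1)%N ->
  (size (r * s)%R <= (m + n).+1)%N /\ (r * s)`_(m + n) = r`_m * s`_n.
Proof.
move=> sr ss; split.
  have [->|r0] := eqVneq r 0; first by rewrite mul0r size_poly0.
  have [->|s0] := eqVneq s 0; first by rewrite mulr0 size_poly0.
  by rewrite size_mul // -ltnS prednK ?addn_gt0 ?size_poly_gt0 ?r0 //
    -addSn -addnS leq_add.
rewrite coefM.
have mi : (m < (m + n).+1)%N by rewrite ltnS leq_addr.
rewrite (bigD1 (Ordinal mi)) //= addKn big1 ?addr0 // => i im.
have [lt|gt|eq] := ltngtP i m; last by case/negP: im; apply/eqP/val_inj.
- rewrite [s`_ _]nth_default ?mulr0 // (leq_trans ss) //.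
  by rewrite ltn_subRL ltn_add2r.
- by rewrite nth_default ?mul0r // (leq_trans sr).
Qed.

Lemma coefX_top r m k : (size r <= m.+1)%N ->
  (size (r ^+ k)%R <= (k * m).+1)%N /\ (r ^+ k)`_(k * m) = r`_m ^+ k.
Proof.
move=> sr; elim: k => [|k [IH1 IH2]]; first by rewrite mul0n !expr0 size_poly1 coef1.
by have [h1 h2] := coefM_top sr IH1; rewrite mulSn !exprS h2 IH2.
Qed.

Lemma hcomp_top p n r s m : (size r <= m.+1)%N -> (size s <= m.+1)%N ->
  (size (hcomp p n r s) <= (n * m).+1)%N /\
  (hcomp p n r s)`_(n * m) = hz p n r`_m s`_m.
Proof.
move=> sr ss.
have H (i : 'I_n.+1) : (size (r ^+ i * s ^+ (n - i))%R <= (n * m).+1)%N /\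
    (r ^+ i * s ^+ (n - i))`_(n * m) = r`_m ^+ i * s`_m ^+ (n - i).
  have [a1 a2] := coefX_top i sr; have [b1 b2] := coefX_top (n - i) ss.
  have := coefM_top a1 b1; rewrite -mulnDl subnKC; last by rewrite -ltnS.
  by rewrite a2 b2.
split.
  apply: (leq_trans (size_sum _ _ _)); apply/bigmax_leqP => i _.
  by apply: leq_trans (size_scale_leq _ _) _; case: (H i).
rewrite /hcomp coef_sum; apply: eq_bigr => i _.
by rewrite coefZ (H i).2 mulrA.
Qed.

(** As neither pair of forms has a common zero, neither has the composed pair. At finite points this
    is coprimality, since the field is algebraically closed; at infinity it says that the degree is
    exactly n * m, the top coefficients being the outer forms at the top coefficients of the inner
    map. *)
Lemma rational_comp n m (f g : sphere R -> sphere R) : (0 < n)%N -> (0 < m)%N ->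
  rational_of_degree n f -> rational_of_degree m g ->
  rational_of_degree (n * m) (f \o g).
Proof.
move=> n0 m0 [p [q [cpq q0 dpq ->]]] [r [s [crs s0 drs ->]]].
have [sP cP] := hcomp_top p n (size_ratdeg_l r s) (size_ratdeg_r r s).
have [sQ cQ] := hcomp_top q n (size_ratdeg_l r s) (size_ratdeg_r r s).
rewrite drs in sP cP sQ cQ.
have nd := coef_ratdeg r s0; rewrite -hnorm_gt0 drs in nd.
have := hz_nondegenerate cpq q0 nd; rewrite dpq -cP -cQ hnorm_gt0 => top.
set P := hcomp p n r s in sP cP top *; set Q := hcomp q n r s in sQ cQ top *.
have dPQ : ratdeg P Q = (n * m)%N by apply: ratdeg_eq.
have cPQ : coprimep P Q.
  apply: Pdiv.ClosedField.root_coprimep => z; rewrite /root !horner_hcomp => /eqP Pz.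
  have h : 0 < hnorm r.[z] s.[z] by rewrite hnorm_gt0 coprimep_horner.
  by have := hz_nondegenerate cpq q0 h; rewrite hnorm_gt0 dpq Pz eqxx.
have Q0 : Q != 0.
  apply: contraTneq cPQ => Qz; rewrite Qz coprimep0 -size_poly_eq1.
  apply/eqP => P1; move: dPQ; rewrite /ratdeg Qz P1 size_poly0 /= => /esym/eqP.
  by rewrite muln_eq0 !gtn_eqF.
exists P, Q; split=> //; apply/funext => -[z|] /=.
- rewrite -[LHS]/(ratmap p q (ratmap r s (finpt z))) !ratmap_fin.
  by rewrite ratmap_pt ?hnorm_gt0 ?coprimep_horner // dpq -!horner_hcomp.
- rewrite -[LHS]/(ratmap p q (pt r`_(ratdeg r s) s`_(ratdeg r s))) drs.
  by rewrite ratmap_pt // dpq dPQ cP cQ.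
Qed.

Lemma rational_ge2_comp (f g : sphere R -> sphere R) :
  rational_ge2 f -> rational_ge2 g -> rational_ge2 (f \o g).
Proof.
move=> [n n2 rf] [m m2 rg]; exists (n * m)%N.
  by rewrite (leq_trans n2) // leq_pmulr // (leq_trans _ m2).
by apply: rational_comp; rewrite ?(leq_trans _ n2) ?(leq_trans _ m2).
Qed.

Lemma rational_ge2_fwd (f : sphere R -> sphere R) n :
  rational_ge2 f -> rational_ge2 (fwd f n).
Proof.
move=> rf; elim: n => // n IH.
have -> : fwd f n.+1 = f \o fwd f n by [].
exact: rational_ge2_comp.
Qed.

Lemma poly_bounded p (B : R) : exists2 M, 0 < M &
  forall z, cabs z <= B -> cabs p.[z] <= M.
Proof.
exists (1 + \sum_(i < size p) cabs p`_i * `|B| ^+ i).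
  rewrite ltr_pwDl // sumr_ge0 // => i _.
  by rewrite mulr_ge0 ?cabs_ge0 ?exprn_ge0.
move=> z zB; rewrite horner_coef ler_wpDl //.
apply: le_trans (cabs_sum _ _ _) _; apply: ler_sum => i _.
rewrite cabsM cabsX ler_wpM2l ?cabs_ge0 // lerXn2r ?nnegrE ?cabs_ge0 //.
by rewrite (le_trans zB) ?ler_norm.
Qed.

Lemma poly_cont p z (e : R) : 0 < e -> exists2 d : R, 0 < d &
  forall w, cabs (z - w) < d -> cabs (p.[z] - p.[w]) < e.
Proof.
move=> e0; have : root (p - p.[z]%:P) z by rewrite /root !hornerE subrr.
move=> /factor_theorem [r rE].
have [M M0 HM] := poly_bounded r (cabs z + 1).
exists (Num.min 1 (e / M)); first by rewrite lt_min ltr01 divr_gt0.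
move=> w; rewrite lt_min => /andP[w1 w2].
have -> : p.[z] - p.[w] = r.[w] * (z - w).
  have := congr1 (fun p => p.[w]) rE; rewrite !hornerE => E.
  by rewrite -[LHS]opprB E -mulrN opprB.
rewrite cabsM; apply: (@le_lt_trans _ _ (M * cabs (z - w))).
  apply: ler_wpM2r; rewrite ?cabs_ge0 //; apply: HM.
  apply: le_trans (cabs_sub_le w z) _; rewrite lerD2l cabsB; exact: ltW.
by rewrite mulrC -ltr_pdivlMr.
Qed.

Lemma hnorm_max a b : hnorm a b <= 2 * Num.max (cabs a) (cabs b).
Proof.
have m0 : 0 <= Num.max (cabs a) (cabs b) by rewrite le_max cabs_ge0.
rewrite -ler_sqr ?nnegrE ?hnorm_ge0 ?mulr_ge0 // hnorm_sqr exprMn.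
have ha : cabs a ^+ 2 <= Num.max (cabs a) (cabs b) ^+ 2.
  by rewrite ler_sqr ?nnegrE ?cabs_ge0 // le_max lexx.
have hb : cabs b ^+ 2 <= Num.max (cabs a) (cabs b) ^+ 2.
  by rewrite ler_sqr ?nnegrE ?cabs_ge0 // le_max lexx orbT.
have := sqr_ge0 (Num.max (cabs a) (cabs b)); lra.
Qed.

Lemma pt_cont a b (e : R) : 0 < hnorm a b -> 0 < e -> exists2 d : R, 0 < d &
  forall c (c' : R[i]), cabs (a - c) < d -> cabs (b - c') < d ->
    0 < hnorm c c' /\ half_chord (pt a b) (pt c c') < e.
Proof.
move=> ab0 e0; set N := hnorm a b in ab0 *.
(* One coordinate of (a, b) has modulus at least N / 2, so a perturbation by N / 4 leaves the norm
   at least N / 4. The determinant is at most 2 d N, hence the chord at most 8 d / N, which is below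
   e. *)
pose d := Num.min (N / 4) (e * N / 9).
have d0 : 0 < d by rewrite lt_min !divr_gt0 ?mulr_gt0.
have d1 : d <= N / 4 by rewrite ge_min lexx.
have d2 : d <= e * N / 9 by rewrite ge_min lexx orbT.
exists d => // c c' ha hb.
have hN : N / 4 <= hnorm c c'.
  have := hnorm_max a b; rewrite -/N; case: (leP (cabs b) (cabs a)) => _ hm.
    apply: le_trans (hnorm_l c c'); have := cabs_sub_le a c; lra.
  apply: le_trans (hnorm_r c c'); have := cabs_sub_le b c'; lra.
have N' : 0 < hnorm c c' by apply: lt_le_trans hN; rewrite divr_gt0.
split=> //; rewrite half_chord_pt // -/N ltr_pdivrMr ?mulr_gt0 //.
have -> : a * c' - b * c = (a - c) * b - (b - c') * a by ring.
have h1 : cabs ((a - c) * b - (b - c') * a) <= 2 * d * N.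
  apply: le_trans (cabsD _ _) _; rewrite cabsN !cabsM.
  have : cabs (a - c) * cabs b <= d * N.
    by rewrite ler_pM ?cabs_ge0 ?(ltW ha) ?hnorm_r.
  have : cabs (b - c') * cabs a <= d * N.
    by rewrite ler_pM ?cabs_ge0 ?(ltW hb) ?hnorm_l.
  lra.
apply: le_lt_trans h1 _.
have : e * (N * (N / 4)) <= e * (N * hnorm c c').
  by rewrite !ler_pM2l.
have : 2 * d * N <= 2 * (e * N / 9) * N by rewrite ler_pM2r // ler_pM2l.
have : 0 < e * N * N by rewrite !mulr_gt0.
lra.
Qed.

Lemma poly_pt_cont p q z (e : R) : 0 < hnorm p.[z] q.[z] -> 0 < e ->
  exists2 d : R, 0 < d & forall w, cabs (z - w) < d ->
    half_chord (pt p.[z] q.[z]) (pt p.[w] q.[w]) < e.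
Proof.
move=> h e0; have [d d0 Hd] := pt_cont h e0.
have [d1 d10 H1] := poly_cont p z d0; have [d2 d20 H2] := poly_cont q z d0.
exists (Num.min d1 d2); first by rewrite lt_min d10.
by move=> w; rewrite lt_min => /andP[/H1 w1 /H2 w2]; case: (Hd _ _ w1 w2).
Qed.

Lemma chord_nbhs_fin z (d : R) : 0 < d -> exists2 e : R, 0 < e &
  forall y, half_chord (finpt z) y < e -> exists2 w, y = finpt w & cabs (z - w) < d.
Proof.
move=> d0; apply/sphere_nbhsP/finpt_nbhsP; exists d => // w zw; by exists w.
Qed.

Lemma chord_nbhs_infty (d : R) : 0 < d -> exists2 e : R, 0 < e &
  forall y, half_chord infty y < e -> exists2 b, y = pt 1 b & cabs b < d.
Proof.
move=> d0; apply/sphere_nbhsP/infty_nbhsP; exists d^-1; first by rewrite invr_gt0.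
split; first by exists 0; rewrite ?cabs0 // -pt_inf.
move=> w dw; have w0 : 0 < cabs w by apply: lt_trans dw; rewrite invr_gt0.
exists w^-1; last by rewrite cabsV -[d]invrK ltf_pV2 ?posrE ?invr_gt0.
have w1 : w != 0 by rewrite -cabs_gt0.
by rewrite /pt invr_eq0 (negPf w1) invrK mul1r.
Qed.

Lemma ratmap_chord_cont p q : coprimep p q -> q != 0 -> chord_cont (ratmap p q).
Proof.
move=> cpq q0 [z|] e e0.
- have [|d d0 Hd] := @poly_pt_cont p q z e _ e0.
    by rewrite hnorm_gt0 coprimep_horner.
  have [r r0 Hr] := chord_nbhs_fin z d0; exists r => // y.
  by move=> /Hr[w -> zw]; exact: Hd.
- set n := ratdeg p q.
  (* In the chart b |-> [1 : b] at infinity the map is the quotient of the reversed polynomials. *)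
  have E b : ratmap p q (pt 1 b) = pt (hcomp p n 1 'X).[b] (hcomp q n 1 'X).[b].
    by rewrite ratmap_pt ?hnorm_gt0 ?oner_eq0 // !horner_hcomp !hornerE.
  have [|d d0 Hd] := @poly_pt_cont (hcomp p n 1 'X) (hcomp q n 1 'X) 0 e _ e0.
    rewrite !horner_hcomp !hornerE; apply: hz_nondegenerate => //.
    by rewrite hnorm_gt0 oner_eq0.
  have [r r0 Hr] := chord_nbhs_infty d0; exists r => // y.
  move=> /Hr[b -> bd]; rewrite -[None]/(infty : sphere R) pt_inf !E; apply: Hd.
  by rewrite sub0r cabsN.
Qed.

Lemma rational_chord_cont (f : sphere R -> sphere R) d :
  rational_of_degree d f -> chord_cont f.
Proof. by move=> [p [q [cpq q0 _ ->]]]; exact: ratmap_chord_cont. Qed.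

Lemma rational_ge2_chord_cont (f : sphere R -> sphere R) :
  rational_ge2 f -> chord_cont f.
Proof. by move=> [d _ /rational_chord_cont]. Qed.

End RationalMaps.

(** * Maps preserving both half planes, and their behaviour at a pole *)

Section HalfPlane.
Variable R : realType.
Implicit Types (p q r s : {poly R[i]}) (a b c z w : R[i]) (x y : sphere R).

(** The form in which oddness and f(U) = U enter the partial-fraction estimates: it passes to
    iterates and excludes poles off the real line. *)
Definition half_plane_map (h : sphere R -> sphere R) : Prop :=
  (forall z, 0 < Im z -> exists2 w, 0 < Im w & h (finpt z) = finpt w) /\
  (forall z, Im z < 0 -> exists2 w, Im w < 0 & h (finpt z) = finpt w).

Lemma ratmap_finE p q z w : ratmap p q (finpt z) = finpt w ->
  q.[z] != 0 /\ p.[z] / q.[z] = w.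
Proof. by rewrite ratmap_fin /pt; case: ifP => // _ [->]. Qed.

(** If the value at t were not real, continuity would carry points of the opposite half plane close
    to t to the wrong side. The sign [sg] treats both sides at once. *)
Lemma half_plane_real h (t : R) : chord_cont h -> half_plane_map h ->
  h (finpt t%:C) = infty \/ exists s : R, h (finpt t%:C) = finpt s%:C.
Proof.
move=> ch [hU hL]; case E : (h (finpt t%:C)) => [w|]; last by left.
have key (sg : R) : 0 < sg * Im w ->
    exists2 d : R, 0 < d & forall z, cabs (t%:C - z) < d ->
      exists2 w', h (finpt z) = finpt w' & 0 < sg * Im w'.
  move=> sw.
  have : nbhs (finpt w) [set y | exists2 w', y = finpt w' & 0 < sg * Im w'].
    have s0 : 0 < `|sg| by rewrite normr_gt0; apply: contraTneq sw => ->; rewrite mul0r ltxx.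
    apply/finpt_nbhsP; exists (sg * Im w / `|sg|); first by rewrite divr_gt0.
    move=> w'; rewrite ltr_pdivlMr // => ww; exists w' => //.
    have : `|sg * Im (w - w')| <= `|sg| * cabs (w - w').
      by rewrite normrM ler_wpM2l // Im_le_cabs.
    rewrite ler_norml => /andP[_]; rewrite Im_add Im_opp mulrDr mulrN [`|_| * _]mulrC; lra.
  move=> /sphere_nbhsP[e e0 He].
  have [d d0 Hd] := ch (finpt t%:C) e e0; exists d => // z tz.
  have [|w' -> sw'] := He (h (finpt z)); last by exists w'.
  by rewrite -[Some w]/(finpt w) in E; rewrite -E; apply: Hd; apply: le_lt_trans tz; exact: chord_fin_lt.
have [w0|w0|w0] := ltgtP (Im w) 0; last first.
- by right; exists (Re w); rewrite (real_of_Im0 w0).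
- have [d d0 Hd] := key 1 ltac:(by rewrite mul1r).
  pose z := t%:C - (0 +i* (d / 2)).
  have [|w' hz] := Hd z.
    rewrite /z opprB addrC subrK /cabs /= expr0n add0r sqrtr_sqr ger0_norm.
      by rewrite ltr_pdivrMr // ltr_pMr // ltr1n.
    by rewrite divr_ge0 ?(ltW d0).
  have [|w'' w''0] := hL z; first by rewrite /z Im_add Im_opp /= sub0r oppr_lt0 divr_gt0.
  by rewrite hz => -[->]; rewrite mul1r ltNge (ltW w''0).
- have [d d0 Hd] := key (-1) ltac:(by rewrite mulN1r oppr_gt0).
  pose z := t%:C - (0 -i* (d / 2)).
  have [|w' hz] := Hd z.
    rewrite /z opprB addrC subrK /cabs /= expr0n add0r sqrrN sqrtr_sqr ger0_norm.
      by rewrite ltr_pdivrMr // ltr_pMr // ltr1n.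
    by rewrite divr_ge0 ?(ltW d0).
  have [|w'' w''0] := hU z; first by rewrite /z Im_add Im_opp /= sub0r opprK divr_gt0.
  by rewrite hz => -[->]; rewrite mulN1r oppr_gt0 ltNge (ltW w''0).
Qed.

Lemma prod_conj_cont a b (e : R) : 0 < e -> exists2 d : R, 0 < d &
  forall c (c' : R[i]), cabs (a - c) < d -> cabs (b - c') < d ->
    cabs (a * conjc b - c * conjc c') < e.
Proof.
move=> e0; set S := cabs a + cabs b + 1.
have S0 : 0 < S by rewrite ltr_wpDl // addr_ge0 ?cabs_ge0.
exists (Num.min 1 (e / S)); first by rewrite lt_min ltr01 divr_gt0.
move=> c c'; rewrite !lt_min => /andP[h1 h2] /andP[h3 h4].
have -> : a * conjc b - c * conjc c' = (a - c) * conjc c' + a * conjc (b - c').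
  by rewrite rmorphB /=; ring.
apply: le_lt_trans (cabsD _ _) _; rewrite !cabsM !cabs_conj.
rewrite ltr_pdivlMr // in h2; rewrite ltr_pdivlMr // in h4.
have hc : cabs c' <= cabs b + 1.
  by apply: le_trans (cabs_sub_le c' b) _; rewrite lerD2l cabsB ltW.
have g1 : cabs (a - c) * cabs c' <= cabs (a - c) * (cabs b + 1).
  by rewrite ler_wpM2l ?cabs_ge0.
have ha := cabs_ge0 a; have hb := cabs_ge0 b.
have [A0|A0] := eqVneq (cabs a) 0.
  rewrite A0 mul0r addr0; apply: le_lt_trans g1 _; apply: le_lt_trans h2.
  by rewrite ler_wpM2l ?cabs_ge0 // /S A0 add0r.
have A1 : 0 < cabs a by rewrite lt_def A0.
have [m|m] := leP (cabs (a - c)) (cabs (b - c')).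
  have g2 : cabs (a - c) * (cabs b + 1) <= cabs (b - c') * (cabs b + 1).
    by rewrite ler_wpM2r // addr_ge0.
  apply: le_lt_trans h4; rewrite /S; lra.
have g2 : cabs a * cabs (b - c') <= cabs a * cabs (a - c).
  by rewrite ler_pM2l // ltW.
apply: le_lt_trans h2; rewrite /S; lra.
Qed.

Lemma Im_div_sign a b : b != 0 -> Im (a / b) = Im (a * conjc b) / cabs b ^+ 2.
Proof.
move=> b0; have B0 : cabs b ^+ 2 != 0 by rewrite expf_neq0 // cabs_eq0.
rewrite Im_mul Re_inv Im_inv Im_mul; move: (cabs b ^+ 2) B0 => B B0.
by case: b {b0} => b1 b2 /=; field.
Qed.

(* The roots of [X^m - y] are non-real and, as [m > 1], sum to zero. *)
Lemma roots_both_sides (m : nat) (y : R[i]) : (1 < m)%N -> Im y != 0 ->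
  (exists2 z, 0 < Im z & z ^+ m = y) /\ (exists2 z, Im z < 0 & z ^+ m = y).
Proof.
move=> m1 y0; have m0 : (0 < m)%N by apply: ltn_trans m1.
have [rs rsE] := closed_field_poly_normal ('X^m - y%:P).
have lc : lead_coef ('X^m - y%:P) = 1 by rewrite lead_coefXnsubC.
rewrite lc scale1r in rsE.
have sz : size rs = m.
  by apply: succn_inj; rewrite -(size_prod_XsubC rs id) -rsE size_XnsubC.
have rt z : z \in rs -> z ^+ m = y.
  rewrite -root_prod_XsubC -rsE /root !hornerE subr_eq0.
  by move/eqP.
have nr z : z \in rs -> Im z != 0.
  move=> /rt zm; apply: contraNneq y0 => z0.
  by rewrite -zm (real_of_Im0 z0) -rmorphXn.
have sum0 : \sum_(z <- rs) z = 0.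
  have := coefPn_prod_XsubC (ps := rs); rewrite sz -lt0n => /(_ m0).
  rewrite -rsE coefB coefXn coefC; case: (m) m1 => // -[//|k] _ /=.
  by rewrite ltn_eqF // subr0 => /esym/eqP; rewrite oppr_eq0 => /eqP.
have sumIm : \sum_(z <- rs) Im z = 0.
  have -> : \sum_(z <- rs) Im z = Im (\sum_(z <- rs) z).
    by elim: (rs) => [|z l IH]; rewrite ?big_nil // !big_cons Im_add IH.
  by rewrite sum0.
have rs0 : exists z0, z0 \in rs.
  by case: (rs) sz m0 => [<-//|z0 l] _ _; exists z0; rewrite mem_head.
have [z0 z0rs] := rs0.
split; apply: contrapT => H.
- have neg z : z \in rs -> Im z < 0.
    move=> zrs; rewrite lt_neqAle nr //= leNgt; apply/negP => z1.
    by apply: H; exists z => //; exact: rt.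
  have : \sum_(z <- rs) Im z < 0.
    rewrite (big_rem z0) //= -[ltRHS]addr0 ltr_leD ?neg //.
    rewrite -oppr_ge0 -sumrN big_seq sumr_ge0 // => z /mem_rem /neg /ltW.
    by rewrite oppr_ge0.
  by rewrite sumIm ltxx.
- have pos z : z \in rs -> 0 < Im z.
    move=> zrs; rewrite lt_neqAle eq_sym nr //= leNgt; apply/negP => z1.
    by apply: H; exists z => //; exact: rt.
  have : 0 < \sum_(z <- rs) Im z.
    rewrite (big_rem z0) //= -[ltLHS]addr0 ltr_leD ?pos //.
    by rewrite big_seq sumr_ge0 // => z /mem_rem /pos /ltW.
  by rewrite sumIm ltxx.
Qed.

(** Along the ray t z with t -> 0+, the value is asymptotic to t^(-m) times P(0) / (Q(0) z^m), and
    the positive factor does not affect the sign of the imaginary part. *)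
Lemma pole_direction (P Q : {poly R[i]}) (m : nat) (sg : R) z :
  P.[0] != 0 -> Q.[0] != 0 -> 0 < sg * Im z ->
  (forall w, 0 < sg * Im w -> 0 < sg * Im (P.[w] / (Q.[w] * w ^+ m))) ->
  0 <= sg * Im (P.[0] / Q.[0] / z ^+ m).
Proof.
move=> P0 Q0 sz H; rewrite leNgt; apply/negP => neg.
have z0 : z != 0 by apply: contraTneq sz => ->; rewrite mulr0 ltxx.
have s0 : sg != 0 by apply: contraTneq sz => ->; rewrite mul0r ltxx.
pose a := P.[0]; pose b := Q.[0] * z ^+ m.
have b0 : b != 0 by rewrite mulf_neq0 ?expf_neq0.
have B0 : 0 < cabs b ^+ 2 by rewrite exprn_gt0 // cabs_gt0.
have nab : sg * Im (a * conjc b) < 0.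
  move: neg; rewrite -mulrA -invfM -/a -/b Im_div_sign // mulrA.
  by rewrite pmulr_llt0 ?invr_gt0.
have S0 : 0 < `|sg| by rewrite normr_gt0.
have e0 : 0 < - (sg * Im (a * conjc b)) / `|sg| by rewrite divr_gt0 ?oppr_gt0.
have [d d0 Hd] := prod_conj_cont a b e0.
have Z0 : 0 < cabs z ^+ m by rewrite exprn_gt0 // cabs_gt0.
have [d1 d10 H1] := poly_cont P 0 d0.
have d'0 : 0 < d / cabs z ^+ m by rewrite divr_gt0.
have [d2 d20 H2] := poly_cont Q 0 d'0.
have z1 : 0 < cabs z by rewrite cabs_gt0.
pose t := Num.min d1 d2 / cabs z / 2.
have t0 : 0 < t by rewrite !divr_gt0 // lt_min d10.
have tz : cabs (0 - t%:C * z) < Num.min d1 d2.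
  rewrite sub0r cabsN cabsM cabs_real gtr0_norm // /t.
  have -> : Num.min d1 d2 / cabs z / 2 * cabs z = Num.min d1 d2 / 2.
    by field; rewrite gt_eqF.
  have m0 : 0 < Num.min d1 d2 by rewrite lt_min d10.
  by rewrite ltr_pdivrMr // ltr_pMr // ltr1n.
move: (tz); rewrite lt_min => /andP[/H1 t1 /H2 t2].
have t3 : cabs (b - Q.[t%:C * z] * z ^+ m) < d.
  by rewrite -mulrBl cabsM cabsX -ltr_pdivlMr.
have := Hd _ _ t1 t3.
set c := P.[t%:C * z]; set c' := Q.[t%:C * z] * z ^+ m => h.
have := H (t%:C * z).
have -> : sg * Im (t%:C * z) = t * (sg * Im z) by rewrite Im_mul /=; ring.
rewrite mulr_gt0 // => /(_ isT).
rewrite exprMn mulrCA -/c -/c' -rmorphXn /=.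
have T0 : 0 < t ^+ m by rewrite exprn_gt0.
have [->|c'0] := eqVneq c' 0; first by rewrite mulr0 invr0 mulr0 mulr0 ltxx.
have C0 : 0 < cabs c' ^+ 2 by rewrite exprn_gt0 // cabs_gt0.
have -> : c / ((t ^+ m)%:C * c') = ((t ^+ m)^-1)%:C * (c / c').
  by rewrite invfM mulrCA -fmorphV.
have -> : sg * Im (((t ^+ m)^-1)%:C * (c / c')) = (t ^+ m)^-1 * (sg * Im (c / c')).
  by rewrite Im_mul /=; ring.
rewrite pmulr_rgt0 ?invr_gt0 // Im_div_sign // mulrA pmulr_lgt0 ?invr_gt0 //.
move=> pos.
have hh : `|sg * Im (a * conjc b - c * conjc c')| < - (sg * Im (a * conjc b)).
  rewrite normrM mulrC -ltr_pdivlMr //; apply: le_lt_trans h.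
  exact: Im_le_cabs.
move: hh; rewrite ltr_norml Im_add Im_opp mulrDr mulrN => /andP[h1 h2]; lra.
Qed.

(** If m > 1, every non-real y is an m-th power from each half plane, so Im (v / y) has both signs
    and vanishes, which forces v = 0. If m = 1, testing z = K + i for all real K gives K Im v - Re v
    >= 0, hence Im v = 0 and Re v <= 0. *)
Lemma pole_simple_negative (P Q : {poly R[i]}) (m : nat) : (0 < m)%N ->
  P.[0] != 0 -> Q.[0] != 0 ->
  (forall w, 0 < Im w -> 0 < Im (P.[w] / (Q.[w] * w ^+ m))) ->
  (forall w, Im w < 0 -> Im (P.[w] / (Q.[w] * w ^+ m)) < 0) ->
  m = 1%N /\ exists2 v : R, 0 < v & P.[0] / Q.[0] = - v%:C.
Proof.
move=> m0 P0 Q0 HU HL.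
set v := P.[0] / Q.[0]; have v0 : v != 0 by rewrite mulf_neq0 ?invr_eq0.
have dU z : 0 < Im z -> 0 <= Im (v / z ^+ m).
  move=> z0; have := @pole_direction P Q m 1 z P0 Q0.
  by rewrite !mul1r; apply=> // w; rewrite !mul1r; exact: HU.
have dL z : Im z < 0 -> Im (v / z ^+ m) <= 0.
  move=> z0; have := @pole_direction P Q m (-1) z P0 Q0.
  rewrite !mulN1r oppr_gt0 oppr_ge0; apply=> // w.
  by rewrite !mulN1r !oppr_gt0; exact: HL.
have m1 : m = 1%N.
  apply/eqP; rewrite eqn_leq m0 andbT leqNgt; apply/negP => m1.
  have key (y : R[i]) : Im y != 0 -> Im (v / y) = 0.
    move=> y0; have [[z z0 zE] [z' z'0 z'E]] := roots_both_sides m1 y0.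
    by apply/eqP; rewrite eq_le -{1}z'E dL //= -zE dU.
  have i0 : ('i : R[i]) != 0 by rewrite eq_complex /= oner_eq0 andbF.
  have i1 : (1 + 'i : R[i]) != 0 by rewrite eq_complex /= addr0 oner_eq0.
  (* For y = i v and y = (1 + i) v the quotient v / y is a visibly non-real constant, so neither y
     can be non-real; two such real multiples give v = 0. *)
  have [h1|h1] := eqVneq (Im ('i * v)) 0; last first.
    have := key _ h1; rewrite invfM mulrCA divff // mulr1 Im_inv => /eqP.
    by rewrite mulf_eq0 invr_eq0 sqrf_eq0 cabs_eq0 (negPf i0) orbF /= oppr_eq0 oner_eq0.
  have [h2|h2] := eqVneq (Im ((1 + 'i) * v)) 0; last first.
    have := key _ h2; rewrite invfM mulrCA divff // mulr1 Im_inv => /eqP.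
    by rewrite mulf_eq0 invr_eq0 sqrf_eq0 cabs_eq0 (negPf i1) orbF /= add0r oppr_eq0 oner_eq0.
  move: h1 h2; case: (v) v0 => v1 v2 + /=; rewrite eq_complex /=.
  rewrite !mul0r !mul1r !add0r !addr0 !mul1r => + v10; rewrite v10 addr0 => + v20.
  by rewrite v20 eqxx.
split=> //; rewrite m1 in dU.
have h K : 0 <= Im v * K - Re v.
  have z0 : (K +i* 1) != 0 by rewrite eq_complex /= oner_eq0 andbF.
  have := dU (K +i* 1); rewrite expr1 ltr01 => /(_ isT).
  rewrite Im_div_sign // pmulr_lge0 ?invr_gt0 ?exprn_gt0 ?cabs_gt0 //.
  by rewrite Im_mul /=; move: (Re v) (Im v) => v1 v2; lra.
have v2 : Im v = 0.
  apply/eqP; apply: contraT => v2.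
  have := h (- (`|Re v| + 1) / Im v).
  have -> : Im v * (- (`|Re v| + 1) / Im v) = - (`|Re v| + 1) by field.
  have := ler_norm (- Re v); rewrite normrN; lra.
exists (- Re v); last by rewrite rmorphN opprK {1}(real_of_Im0 v2).
have := h 0; rewrite mulr0 sub0r le_eqVlt => /orP[/eqP v1|//].
move: v0; rewrite (real_of_Im0 v2).
by move/eqP: v1; rewrite eq_sym oppr_eq0 => /eqP ->; rewrite eqxx.
Qed.

End HalfPlane.

(** * Partial fractions of a half-plane map *)

Section Nevanlinna.
Variable R : realType.
Implicit Types (p q r s : {poly R[i]}) (c z w : R[i]).

Lemma half_plane_upper p q z : half_plane_map (ratmap p q) -> 0 < Im z ->
  q.[z] != 0 /\ 0 < Im (p.[z] / q.[z]).
Proof. by move=> [HU _] /HU[w w0] /ratmap_finE[q0 ->]. Qed.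

Lemma half_plane_lower p q z : half_plane_map (ratmap p q) -> Im z < 0 ->
  q.[z] != 0 /\ Im (p.[z] / q.[z]) < 0.
Proof. by move=> [_ HL] /HL[w w0] /ratmap_finE[q0 ->]. Qed.

Lemma half_plane_pole_real p q z : half_plane_map (ratmap p q) ->
  q.[z] = 0 -> z = (Re z)%:C.
Proof.
move=> hp qz; apply: real_of_Im0; have [z0|z0|//] := ltgtP (Im z) 0.
  by have [] := half_plane_lower hp z0; rewrite qz eqxx.
by have [] := half_plane_upper hp z0; rewrite qz eqxx.
Qed.

Lemma half_plane_pole p q (q1 : {poly R[i]}) (t : R) m :
  half_plane_map (ratmap p q) -> (0 < m)%N -> p.[t%:C] != 0 ->
  q1.[t%:C] != 0 -> q = q1 * ('X - (t%:C)%:P) ^+ m ->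
  m = 1%N /\ exists2 v : R, 0 < v & p.[t%:C] / q1.[t%:C] = - v%:C.
Proof.
move=> hp m0 p0 q10 qE.
have sh (s : {poly R[i]}) w : (s \Po ('X + (t%:C)%:P)).[w] = s.[w + t%:C].
  by rewrite horner_comp !hornerE.
have qs w : q.[w + t%:C] = q1.[w + t%:C] * w ^+ m.
  by rewrite qE hornerM horner_exp !hornerE addrK.
have It w : Im (w + t%:C) = Im w by rewrite Im_add /= addr0.
have := @pole_simple_negative R (p \Po ('X + (t%:C)%:P))
  (q1 \Po ('X + (t%:C)%:P)) m m0.
rewrite !sh !add0r; apply=> // w w0; rewrite !sh -qs.
  by apply: (half_plane_upper hp _).2; rewrite It.
by apply: (half_plane_lower hp _).2; rewrite It.
Qed.

(** The substitution z = -1/w preserves both half planes and moves a pole at infinity to 0, where it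
    is simple with negative coefficient. The reversed polynomials bring in powers of -1 that differ
    by one factor, so the ratio of leading coefficients comes out positive. *)
Lemma half_plane_degree p q : coprimep p q -> q != 0 ->
  half_plane_map (ratmap p q) -> (size q < size p)%N ->
  size p = (size q).+1 /\ exists2 v : R, 0 < v & lead_coef p / lead_coef q = v%:C.
Proof.
move=> cpq q0 hp qp.
have p0 : p != 0 by rewrite -size_poly_gt0 (leq_ltn_trans _ qp).
pose dp := (size p).-1; pose dq := (size q).-1.
have sp : size p = dp.+1 by rewrite prednK // size_poly_gt0.
have sq : size q = dq.+1 by rewrite prednK // size_poly_gt0.
have dqp : (dq < dp)%N by rewrite -ltnS -sp -sq.
pose P := hcomp p dp (-1) 'X; pose Q := hcomp q dq (-1) 'X.
have PE w : w != 0 -> P.[w] = w ^+ dp * p.[- w^-1].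
  move=> w0; rewrite horner_hcomp !hornerE -(hz_fin (n := dp)) ?sp // -hz_scale.
  by rewrite mulr1 mulrN divff.
have QE w : w != 0 -> Q.[w] = w ^+ dq * q.[- w^-1].
  move=> w0; rewrite horner_hcomp !hornerE -(hz_fin (n := dq)) ?sq // -hz_scale.
  by rewrite mulr1 mulrN divff.
have P0 : P.[0] = lead_coef p * (-1) ^+ dp.
  by rewrite horner_hcomp !hornerE hz_a0 lead_coefE.
have Q0 : Q.[0] = lead_coef q * (-1) ^+ dq.
  by rewrite horner_hcomp !hornerE hz_a0 lead_coefE.
have hE w : w != 0 -> P.[w] / (Q.[w] * w ^+ (dp - dq)) = p.[- w^-1] / q.[- w^-1].
  move=> w0; rewrite PE // QE //.
  have -> : w ^+ dq * q.[- w^-1] * w ^+ (dp - dq) = w ^+ dp * q.[- w^-1].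
    by rewrite mulrAC -exprD subnKC // ltnW.
  by rewrite -mulf_div divff ?expf_neq0 // mul1r.
have Iw w : Im (- w^-1) = Im w / cabs w ^+ 2.
  by rewrite Im_opp Im_inv mulNr opprK.
have m0 : (0 < dp - dq)%N by rewrite subn_gt0.
have := @pole_simple_negative R P Q (dp - dq) m0.
rewrite P0 Q0 !mulf_eq0 !negb_or !lead_coef_eq0 p0 q0 !expf_neq0 ?oppr_eq0 ?oner_eq0 //.
move=> /(_ isT isT); case.
- move=> w w0; have wn : w != 0 by apply: contraTneq w0 => ->; rewrite ltxx.
  rewrite hE //; apply: (half_plane_upper hp _).2.
  by rewrite Iw divr_gt0 // exprn_gt0 // cabs_gt0.
- move=> w w0; have wn : w != 0 by apply: contraTneq w0 => ->; rewrite ltxx.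
  rewrite hE //; apply: (half_plane_lower hp _).2.
  by rewrite Iw pmulr_llt0 // invr_gt0 exprn_gt0 // cabs_gt0.
move=> m1 [v v0 vE]; have dE : dp = dq.+1 by rewrite -(subnK (ltnW dqp)) m1.
split; first by rewrite sp sq dE.
exists v => //; move: vE; rewrite dE exprS mulN1r mulrN mulNr => /eqP.
rewrite eqr_opp -mulf_div divff ?mulr1; first by move/eqP.
by rewrite expf_neq0 // oppr_eq0 oner_eq0.
Qed.

(** Lagrange interpolation at the simple roots gives the remainder of p modulo the product, and P is
    the quotient. The size clauses are what later identifies P as affine, together with its leading
    coefficient. *)
Lemma partial_fractions p (rs : seq R[i]) : uniq rs ->
  exists P : {poly R[i]}, [/\ (size P <= size p - size rs)%N,
   (size (p - P * \prod_(x <- rs) ('X - x%:P))%R <= size rs)%N &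
   p = P * \prod_(x <- rs) ('X - x%:P) + \sum_(x <- rs)
     (p.[x] / (\prod_(y <- rem x rs) ('X - y%:P)).[x]) *:
        \prod_(y <- rem x rs) ('X - y%:P)].
Proof.
move=> urs; set S := \sum_(x <- rs) _.
have sS : (size S <= size rs)%N.
  rewrite /S big_seq; apply: (leq_trans (size_sum _ _ _)).
  apply/bigmax_leqP_seq => x _ xrs; apply: leq_trans (size_scale_leq _ _) _.
  rewrite size_prod_XsubC size_rem // prednK //.
  by case: (rs) xrs.
have rt : all (root (p - S)) rs.
  apply/allP => x xrs; rewrite /root hornerD hornerN /S (big_rem x) //=.
  rewrite hornerD hornerZ divfK; last first.
    by rewrite -/(root _ x) root_prod_XsubC mem_rem_uniq // inE eqxx.
  rewrite horner_sum big_seq big1 ?addr0 ?subrr // => y.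
  rewrite mem_rem_uniq // inE => /andP[yx yrs].
  have /rootP h : root (\prod_(y0 <- rem y rs) ('X - y0%:P)) x.
    by rewrite root_prod_XsubC mem_rem_uniq // inE eq_sym yx.
  by rewrite hornerZ h mulr0.
have [P DP] : exists P, p - S = P * \prod_(x <- rs) ('X - x%:P).
  by apply/dvdpP; apply: uniq_roots_dvdp rt _; rewrite uniq_rootsE.
exists P; split; first 1 last.
- by rewrite -DP opprB addrC subrK.
- by rewrite -DP subrK.
have [->|P0] := eqVneq P 0; first by rewrite size_poly0.
have : size (p - S) = (size P + size rs)%N.
  rewrite DP size_Mmonic ?monic_prod_XsubC //.
  by rewrite size_prod_XsubC addnS.
move=> E; rewrite -(addnK (size rs) (size P)) leq_sub2r // -E.
have := size_polyD p (- S); rewrite size_polyN leq_max => /orP[//|h].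
have := leq_trans h sS; rewrite E -{2}[size rs]add0n leq_add2r leqn0.
by rewrite size_poly_eq0 (negPf P0).
Qed.

(** A rational Nevanlinna (Pick) function. With the minus sign and c > 0, each -c / (z - x)
    preserves the half planes. *)
Definition nev (a b : R) (ps : seq R) (c : R -> R) z : R[i] :=
  a%:C * z + b%:C - \sum_(x <- ps) (c x)%:C / (z - x%:C).

(** Poles are real and simple with negative residue, and infinity is at most a simple pole, so the
    polynomial part is affine with a >= 0. The clauses on sizes let the number of poles and the
    vanishing of a be compared with the degree of the map. *)
Lemma nevanlinna p q : coprimep p q -> q != 0 -> half_plane_map (ratmap p q) ->
  exists (a b : R) (ps : seq R) (c : R -> R),
   [/\ 0 <= a, uniq ps, {in ps, forall t, 0 < c t},
       forall z, (q.[z] == 0) = (z \in [seq t%:C | t <- ps]) &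
       forall z, q.[z] != 0 -> p.[z] / q.[z] = nev a b ps c z] /\
   [/\ size q = (size ps).+1, (size p <= (size ps).+2)%N &
       a = 0 -> (size p <= (size ps).+1)%N].
Proof.
move=> cpq q0 hp.
have [rs rsE] := closed_field_poly_normal q.
set k := lead_coef q in rsE; have k0 : k != 0 by rewrite lead_coef_eq0.
have qz z : (q.[z] == 0) = (z \in rs).
  by rewrite rsE hornerZ mulf_eq0 (negPf k0) /= -root_prod_XsubC.
have pn z : z \in rs -> p.[z] != 0.
  rewrite -qz => /eqP qz0; have := coprimep_horner z cpq.
  by rewrite qz0 eqxx orbF.
have qrem z : z \in rs -> q = k *: \prod_(y <- rem z rs) ('X - y%:P) * ('X - z%:P).
  move=> zrs; rewrite {1}rsE (perm_big _ (perm_to_rem zrs)) big_cons /=.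
  by rewrite mulrC scalerAl.
have real z : z \in rs -> z = (Re z)%:C.
  by rewrite -qz => /eqP /(half_plane_pole_real hp).
(* A root has multiplicity one by [half_plane_pole]; the cofactor q1 is then the product over the
   remaining roots, so a repetition in the list would make q1 vanish at the root. *)
have urs : uniq rs.
  apply: count_mem_uniq => z; have [zrs|/count_memPn //] := boolP (z \in rs).
  have [m [q1 q1z qE]] := multiplicity_XsubC q z; rewrite q0 /= in q1z.
  have m0 : (0 < m)%N.
    rewrite lt0n; apply: contraNneq q1z => m0.
    by move: qE; rewrite m0 expr0 mulr1 => <-; rewrite /root qz.
  have zE := real z zrs; rewrite zE in q1z qE zrs *.
  have [m1 _] := half_plane_pole hp m0 (pn _ zrs) q1z qE.
  have : q1 = k *: \prod_(y <- rem (Re z)%:C rs) ('X - y%:P).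
    apply: (mulIf (negbT (polyXsubC_eq0 (Re z)%:C))).
    by rewrite -qrem // qE m1 expr1.
  move=> q1E; have : (Re z)%:C \notin rem (Re z)%:C rs.
    apply: contra q1z => zr; rewrite q1E /root hornerZ mulf_eq0.
    by apply/orP; right; rewrite -/(root _ _) root_prod_XsubC.
  move/count_memPn; rewrite count_rem zrs /= eqxx => /eqP.
  rewrite subn_eq0 => le1; apply/eqP; rewrite eqn_leq le1 /=.
  by rewrite -has_count has_pred1.
have sq : size q = (size rs).+1 by rewrite rsE size_scale // size_prod_XsubC.
have sp : (size p <= (size rs).+2)%N.
  have [|h] := leqP (size p) (size q); first by rewrite sq => /leq_trans; apply.
  by have [-> _] := half_plane_degree cpq q0 hp h; rewrite sq.
have [P [sP sS pE]] := partial_fractions p urs.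
have resid z : z \in rs -> exists2 v : R, 0 < v &
    p.[z] / (k *: \prod_(y <- rem z rs) ('X - y%:P)).[z] = - v%:C.
  move=> zrs; have zE := real z zrs; rewrite zE in zrs *.
  have [] := @half_plane_pole p q (k *: \prod_(y <- rem (Re z)%:C rs) ('X - y%:P))
    (Re z) 1 hp isT (pn _ zrs) _ _ => //.
  - rewrite hornerZ mulf_neq0 // -/(root _ _) root_prod_XsubC.
    by rewrite mem_rem_uniq // inE eqxx.
  - by rewrite expr1 -qrem.
pose c (x : R) := - Re (p.[x%:C] / (k *: \prod_(y <- rem x%:C rs) ('X - y%:P)).[x%:C]).
pose ps := [seq Re z | z <- rs].
have rps : [seq x%:C | x <- ps] = rs.
  rewrite -map_comp -[RHS]map_id; apply/eq_in_map => z zrs /=.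
  by rewrite -real.
have pfrac z : q.[z] != 0 -> p.[z] / q.[z] =
    P.[z] / k - \sum_(x <- ps) (c x)%:C / (z - x%:C).
  move=> qz0; have qE : q.[z] = k * (\prod_(x <- rs) ('X - x%:P)).[z].
    by rewrite {1}rsE hornerZ.
  have nz : (\prod_(x <- rs) ('X - x%:P)).[z] != 0.
    by apply: contraNneq qz0 => h; rewrite qE h mulr0.
  rewrite {1}pE hornerD hornerM mulrDl qE invfM mulrACA divff // mulr1.
  congr (_ + _); rewrite -sumrN /ps big_map horner_sum mulr_suml.
  rewrite [LHS]big_seq [RHS]big_seq; apply: eq_bigr => x xrs.
  have [v v0 vE] := resid x xrs; have xE := real x xrs.
  have cE : (c (Re x))%:C = - (p.[x] / (k *: \prod_(y <- rem x rs) ('X - y%:P)).[x]).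
    by rewrite /c -xE vE Re_opp opprK /= opprK.
  have zx : z - x != 0.
    by rewrite subr_eq0; apply: contraNneq qz0 => ->; rewrite qz.
  have pz : (\prod_(x <- rs) ('X - x%:P)).[z] =
      (\prod_(y <- rem x rs) ('X - y%:P)).[z] * (z - x).
    by rewrite (perm_big _ (perm_to_rem xrs)) big_cons /= hornerM !hornerE mulrC.
  rewrite cE -xE pz !hornerZ; move: nz; rewrite pz mulf_eq0 negb_or => /andP[rz _].
  have rx : (\prod_(y <- rem x rs) ('X - y%:P)).[x] != 0.
    by rewrite -/(root _ x) root_prod_XsubC mem_rem_uniq // inE eqxx.
  by field; rewrite k0 rz rx zx.
have sum_real (t : R) : exists w : R, \sum_(x <- ps) (c x)%:C / (t%:C - x%:C) = w%:C.
  exists (\sum_(x <- ps) c x / (t - x)).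
  by rewrite rmorph_sum; apply: eq_bigr => x _; rewrite rmorphM fmorphV rmorphB.
have [a [b [a0 Ea Pk]]] : exists a b : R, [/\ 0 <= a,
    (a = 0 -> (size p <= (size rs).+1)%N) &
    forall z, P.[z] / k = a%:C * z + b%:C].
  have [a [b [a0 Ea Pk]]] : exists (a : R) (b : R[i]), [/\ 0 <= a,
    (a = 0 -> (size p <= (size rs).+1)%N) &
    forall z, P.[z] / k = a%:C * z + b].
    have [le|lt] := leqP (size p) (size q).
      exists 0, (P`_0 / k); split=> //; first by rewrite -sq.
      move=> z; rewrite mul0r add0r {1}[P]size1_polyC ?hornerC //.
      by rewrite (leq_trans sP) // leq_subLR addn1 -sq.
    have [sp1 [v v0 vE]] := half_plane_degree cpq q0 hp lt.
    have sP2 : (size P <= 2)%N.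
      by rewrite (leq_trans sP) // sp1 sq -addn2 addnC addnK.
    exists v, (P`_0 / k); split; first exact: ltW.
      by move=> v00; rewrite v00 ltxx in v0.
    move=> z; rewrite (horner_coef_wide z sP2) !big_ord_recl big_ord0 /= addr0.
    rewrite expr0 mulr1 expr1 mulrDl addrC; congr (_ + _); rewrite mulrAC.
    congr (_ * _); rewrite -vE -/k; congr (_ / _).
    have sQ : size (\prod_(x <- rs) ('X - x%:P)) = (size rs).+1.
      by rewrite size_prod_XsubC.
    have sQ' : (size (\prod_(x <- rs) ('X - x%:P))%R <= (size rs).+1)%N by rewrite sQ.
    have [_] := coefM_top (m := 1) sP2 sQ'.
    have -> : (\prod_(x <- rs) ('X - x%:P))`_(size rs) = 1.
      have /monicP := monic_prod_XsubC rs xpredT id.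
      by rewrite lead_coefE sQ.
    rewrite mulr1 => <-; rewrite lead_coefE sp1 sq /= add1n.
    have : (p - P * \prod_(x <- rs) ('X - x%:P))`_(size rs).+1 = 0.
      by apply: nth_default; rewrite (leq_trans sS).
    by rewrite coefB => /eqP; rewrite subr_eq0 => /eqP ->.
  exists a, (Re b); split=> // z; rewrite Pk; congr (_ + _).
  (* A real point to the right of all poles: the value there and the sum over the poles are real,
     hence so is the constant term. *)
  apply: real_of_Im0; pose t := 1 + \sum_(x <- ps) `|x|.
  have tn : q.[t%:C] != 0.
    rewrite qz -rps; apply/mapP => -[x xps [tx]].
    have : x <= \sum_(x <- ps) `|x|.
      apply: le_trans (ler_norm x) _; rewrite (big_rem x) //= lerDl.
      by rewrite sumr_ge0.
    by rewrite -tx /t; lra.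
  have [w wE] := sum_real t.
  have := half_plane_real t (ratmap_chord_cont cpq q0) hp.
  rewrite ratmap_fin /pt (negPf tn) => -[//|[s [sE]]].
  have := pfrac _ tn; rewrite sE wE Pk => /(congr1 (@complex.Im R)).
  by rewrite !Im_add Im_opp Im_mul /= mulr0 mul0r !addr0 subr0 add0r => <-.
have sps : size ps = size rs by rewrite size_map.
exists a, b, ps, c; split; split=> //; rewrite ?sps //.
- rewrite /ps map_inj_in_uniq // => z w zrs wrs zw.
  by rewrite (real z zrs) (real w wrs) zw.
- move=> t tps; have tr : t%:C \in rs by rewrite -rps map_f.
  by have [v v0 vE] := resid _ tr; rewrite /c vE Re_opp opprK.
- by move=> z; rewrite rps.
- by move=> z qz0; rewrite pfrac // Pk.
Qed.

End Nevanlinna.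

(** * The strict Schwarz-Pick inequality *)

Section Estimates.
Variable R : realType.
Implicit Types (p q : {poly R[i]}) (z w : R[i]) (a b t : R).
Implicit Types (ps : seq R) (c : R -> R).

(** The divided difference of [nev]. *)
Definition nev_kernel a ps c z w : R[i] :=
  a%:C + \sum_(x <- ps) (c x)%:C / ((z - x%:C) * (w - x%:C)).

(** The ratio of Im (nev z) to Im z; on the real line, the derivative. *)
Definition nev_deriv a ps c z : R := a + \sum_(x <- ps) c x / cabs (z - x%:C) ^+ 2.

Lemma nev_diff a b ps c z w : {in ps, forall t, z - t%:C != 0} ->
  {in ps, forall t, w - t%:C != 0} ->
  nev a b ps c z - nev a b ps c w = (z - w) * nev_kernel a ps c z w.
Proof.
move=> hz hw; rewrite /nev /nev_kernel mulrDr mulr_sumr.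
have -> : forall A B C D E : R[i], A + B - C - (D + B - E) = (A - D) + (E - C).
  by move=> A B C D E; ring.
congr (_ + _); first by rewrite -mulrBr mulrC.
rewrite -sumrB [LHS]big_seq [RHS]big_seq; apply: eq_bigr => t tps.
by field; rewrite hz ?hw.
Qed.

Lemma Im_nev a b ps c z : Im (nev a b ps c z) = Im z * nev_deriv a ps c z.
Proof.
rewrite /nev /nev_deriv Im_add Im_opp Im_add Im_mul /= mul0r addr0 addr0 mulrDr.
rewrite [a * _]mulrC; congr (_ + _); rewrite mulr_sumr.
elim: ps => [|x ps IH]; first by rewrite !big_nil oppr0.
rewrite !big_cons Im_add opprD IH; congr (_ + _).
rewrite Im_mul Im_inv Im_add Im_opp /= oppr0 addr0 mul0r addr0.
by rewrite mulNr mulrN opprK mulrCA.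
Qed.

Lemma Re_scale (t : R) (z : R[i]) : Re (t%:C * z) = t * Re z.
Proof. by case: z => a b /=; rewrite mul0r subr0. Qed.

Lemma cabs_add_sqr (z w : R[i]) :
  cabs (z + w) ^+ 2 = cabs z ^+ 2 + cabs w ^+ 2 + 2 * Re (z * conjc w).
Proof.
rewrite !cabs_sqr; case: z => a b; case: w => c d /=; ring.
Qed.

(** The left side is the weighted square norm of l u + v, where u has the entries 1 and 1 / (z - x),
    and v the entries 1 and 1 / (conj w - x). Its nonnegativity for every l is the Cauchy-Schwarz
    inequality between the kernel and the two values of [nev_deriv]. *)
Lemma nev_quadratic (a : R) ps c (z w l : R[i]) :
  a * cabs (l + 1) ^+ 2 +
    \sum_(x <- ps) c x * cabs (l / (z - x%:C) + (conjc w - x%:C)^-1) ^+ 2 =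
  cabs l ^+ 2 * nev_deriv a ps c z + nev_deriv a ps c w +
    2 * Re (l * nev_kernel a ps c z w).
Proof.
rewrite /nev_deriv /nev_kernel.
elim: ps => [|x ps IH].
  rewrite !big_nil !addr0 cabs_add_sqr cabs1 expr1n rmorph1 mulr1.
  by rewrite Re_mul /= mulr0 subr0; ring.
rewrite !big_cons addrCA IH [cabs (l / _ + _) ^+ 2]cabs_add_sqr.
have cE : conjc (conjc w - x%:C) = w - x%:C.
  by apply: complexP; case: (w) => w1 w2 /=; ring.
have -> : conjc (conjc w - x%:C)^-1 = (w - x%:C)^-1 by rewrite conjc_inv cE.
have -> : cabs (conjc w - x%:C)^-1 ^+ 2 = (cabs (w - x%:C) ^+ 2)^-1.
  rewrite cabsV exprVn; congr (_ ^-1); congr (_ ^+ 2).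
  by rewrite -cabs_conj cE.
rewrite cabsM cabsV exprMn exprVn.
have -> : forall S : R[i], Re (l * (a%:C + ((c x)%:C / ((z - x%:C) * (w - x%:C)) + S)))
   = c x * Re (l / (z - x%:C) / (w - x%:C)) + Re (l * (a%:C + S)).
  move=> S; have -> : l * (a%:C + ((c x)%:C / ((z - x%:C) * (w - x%:C)) + S)) =
     (c x)%:C * (l / (z - x%:C) / (w - x%:C)) + l * (a%:C + S).
    by rewrite invfM; ring.
  by rewrite Re_add Re_scale.
ring.
Qed.

Lemma nev_deriv_gt0 a ps c z : 0 <= a -> {in ps, forall t, 0 < c t} ->
  {in ps, forall t, z - t%:C != 0} -> (0 < size ps)%N -> 0 < nev_deriv a ps c z.
Proof.
move=> a0 c0 hz; case: ps c0 hz => // x ps c0 hz _; rewrite /nev_deriv big_cons.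
rewrite ltr_wpDl // ltr_pwDl //.
  by rewrite divr_gt0 ?c0 ?mem_head // exprn_gt0 // cabs_gt0 hz ?mem_head.
rewrite big_seq sumr_ge0 // => y yps.
by rewrite divr_ge0 ?sqr_ge0 // ltW // c0 // inE yps orbT.
Qed.

Lemma nonreal_sub (z : R[i]) (t : R) : 0 < Im z -> z - t%:C != 0.
Proof.
move=> z0; rewrite subr_eq0; apply: contraTneq z0 => -> /=; by rewrite ltxx.
Qed.

(** The l below minimises the quadratic form. If the minimum were 0, every square would vanish; two
    of them force l = -1, and then any pole gives conj w = z, impossible for points of the same half
    plane. *)
Lemma schwarz_pick_strict (a : R) ps c (z w : R[i]) : 0 <= a -> uniq ps ->
  {in ps, forall t, 0 < c t} -> 0 < Im z -> 0 < Im w ->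
  (1 < size ps)%N || (a != 0) && (0 < size ps)%N ->
  cabs (nev_kernel a ps c z w) ^+ 2 < nev_deriv a ps c z * nev_deriv a ps c w.
Proof.
move=> a0 ups c0 z0 w0 deg.
have ps0 : (0 < size ps)%N by case/orP: deg => [|/andP[]//]; apply: ltn_trans.
have nz t : z - t%:C != 0 by apply: nonreal_sub.
have nw t : conjc w - t%:C != 0.
  rewrite subr_eq0; apply: contraTneq w0 => h.
  by rewrite -[w]cjK h /= oppr0 ltxx.
have K0 : 0 < nev_deriv a ps c z by apply: nev_deriv_gt0.
set K := nev_kernel a ps c z w.
set l := - (conjc K) / (nev_deriv a ps c z)%:C.
have zw : conjc w <> z.
  by move=> h; move: z0; rewrite -h; case: (w) w0 => /= w1 w2; rewrite oppr_gt0 => /ltW; rewrite leNgt => /negP.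
have solve t : l / (z - t%:C) + (conjc w - t%:C)^-1 = 0 ->
    l * (conjc w - t%:C) = - (z - t%:C).
  move=> /(congr1 (fun u => u * ((z - t%:C) * (conjc w - t%:C)))).
  rewrite mul0r => h; apply/eqP; rewrite -subr_eq0 opprK -h; apply/eqP.
  by field; rewrite nz nw.
have pos : 0 < a * cabs (l + 1) ^+ 2 +
    \sum_(x <- ps) c x * cabs (l / (z - x%:C) + (conjc w - x%:C)^-1) ^+ 2.
  have t0 x : x \in ps -> 0 <= c x * cabs (l / (z - x%:C) + (conjc w - x%:C)^-1) ^+ 2.
    by move=> xps; rewrite mulr_ge0 ?sqr_ge0 // ltW // c0.
  have s0 : 0 <= \sum_(x <- ps) c x * cabs (l / (z - x%:C) + (conjc w - x%:C)^-1) ^+ 2.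
    by rewrite big_seq sumr_ge0.
  have A00 : 0 <= a * cabs (l + 1) ^+ 2 by rewrite mulr_ge0 ?sqr_ge0.
  rewrite lt_neqAle addr_ge0 // eq_sym andbT.
  apply/negP; rewrite paddr_eq0 // => /andP[A0].
  rewrite big_seq psumr_eq0 // => /allP S0.
  have sl x : x \in ps -> l * (conjc w - x%:C) = - (z - x%:C).
    move=> xps; apply: solve; apply/eqP; rewrite -cabs_eq0 -sqrf_eq0.
    by have := S0 x xps; rewrite xps /= mulf_eq0 gt_eqF //= c0.
  have lN1 : l = -1.
    case/orP: deg => [|/andP[an _]].
      case: (ps) ups sl => [//|x [//|y s]] /= /andP[]; rewrite inE negb_or => /andP[xy _] _ sl _.
      have h1 := sl x (mem_head _ _); have h2 := sl y ltac:(by rewrite !inE eqxx orbT).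
      have xyn : y%:C - x%:C != 0 :> R[i].
        by rewrite subr_eq0 eq_sym; apply: contraNneq xy => /complexI ->.
      apply: (mulIf xyn); rewrite mulN1r.
      have -> : y%:C - x%:C = (conjc w - x%:C) - (conjc w - y%:C) :> R[i] by ring.
      by rewrite mulrBr h1 h2; ring.
    move: A0; rewrite mulf_eq0 (negPf an) /= sqrf_eq0 cabs_eq0 addr_eq0.
    by move/eqP.
  case: (ps) ps0 sl => [//|x s] _ /(_ x (mem_head _ _)).
  rewrite lN1 mulN1r => /oppr_inj /addIr; exact: zw.
rewrite nev_quadratic -/K in pos.
have lK : Re (l * K) = - (cabs K ^+ 2 / nev_deriv a ps c z).
  rewrite /l -fmorphV mulrAC mulNr [conjc K * K]mulrC mul_conj_cabs.
  by rewrite mulNr -rmorphM Re_opp.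
have l2 : cabs l ^+ 2 = cabs K ^+ 2 / nev_deriv a ps c z ^+ 2.
  by rewrite /l cabsM cabsN cabs_conj cabsV cabs_real gtr0_norm // exprMn exprVn.
rewrite lK l2 in pos.
rewrite mulrC -ltr_pdivrMr //.
set X := cabs K ^+ 2 in pos *; set k := nev_deriv a ps c z in K0 pos *.
have E : X / k ^+ 2 * k = X / k by field; rewrite gt_eqF.
move: pos; rewrite E; lra.
Qed.

(** The kernel inequality in terms of |z - w|^2 / (Im z Im w), an increasing function of the
    hyperbolic distance. Degree at least two provides two poles, or one pole and a nonzero a. *)
Lemma half_plane_contracts p q (z w : R[i]) : coprimep p q -> q != 0 ->
  half_plane_map (ratmap p q) -> (2 <= ratdeg p q)%N ->
  0 < Im z -> 0 < Im w -> z != w ->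
  cabs (p.[z] / q.[z] - p.[w] / q.[w]) ^+ 2 * (Im z * Im w) <
  cabs (z - w) ^+ 2 * (Im (p.[z] / q.[z]) * Im (p.[w] / q.[w])).
Proof.
move=> cpq q0 hp deg z0 w0 zw.
have [a [b [ps [c [[a0 ups c0 qz pq] [sq sp spa]]]]]] := nevanlinna cpq q0 hp.
rewrite !pq ?(half_plane_upper hp _).1 // !Im_nev nev_diff; try by move=> t _; apply: nonreal_sub.
have sp_lt : cabs (nev_kernel a ps c z w) ^+ 2 < nev_deriv a ps c z * nev_deriv a ps c w.
  apply: schwarz_pick_strict => //.
  move: deg; rewrite /ratdeg sq.
  case: (ps) sp spa => [|x [|y s]] //= sp spa.
  - have : (maxn (size p) 1 <= 2)%N by rewrite geq_max sp.
    by case: (maxn _ _) => [|[|[|]]].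
  - move=> h; rewrite andbT; apply/eqP => /spa sp2; move: h.
    have : (maxn (size p) 2 <= 2)%N by rewrite geq_max sp2.
    by case: (maxn _ _) => [|[|[|]]].
have zw0 : 0 < cabs (z - w) ^+ 2 * (Im z * Im w).
  by rewrite mulr_gt0 ?exprn_gt0 ?cabs_gt0 ?subr_eq0 // mulr_gt0.
rewrite -(ltr_pM2l zw0) in sp_lt.
apply: le_lt_trans (lt_le_trans sp_lt _); rewrite le_eqVlt; apply/orP; left; apply/eqP.
  by rewrite cabsM; ring.
by ring.
Qed.

End Estimates.

(** * Distortion of a half-plane map that omits two values *)

Section Distortion.
Variable R : realType.
Implicit Types (p q : {poly R[i]}) (ps : seq R) (c : R -> R).

Definition rnev (a b : R) ps c (t : R) : R := a * t + b - \sum_(x <- ps) c x / (t - x).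

Lemma nev_real (a b : R) ps c (t : R) : nev a b ps c t%:C = (rnev a b ps c t)%:C.
Proof.
rewrite /nev /rnev rmorphB rmorphD rmorphM; congr (_ - _).
by rewrite rmorph_sum; apply: eq_bigr => x _; rewrite rmorphM fmorphV rmorphB.
Qed.

Lemma rnev_diff (a b : R) ps c (t s : R) : {in ps, forall x, t - x != 0} ->
  {in ps, forall x, s - x != 0} -> rnev a b ps c t - rnev a b ps c s =
  (t - s) * (a + \sum_(x <- ps) c x / ((t - x) * (s - x))).
Proof.
move=> ht hs; rewrite /rnev mulrDr mulr_sumr.
have -> : forall A B C D E : R, A + B - C - (D + B - E) = (A - D) + (E - C).
  by move=> A B C D E; ring.
congr (_ + _); first by rewrite -mulrBr mulrC.
rewrite -sumrB [LHS]big_seq [RHS]big_seq; apply: eq_bigr => x xps.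
by field; rewrite ht ?hs.
Qed.

Lemma rnev_cont (a b : R) ps c (t : R) : {in ps, forall x, t - x != 0} ->
  {for t, continuous (rnev a b ps c)}.
Proof.
move=> h; rewrite /rnev; apply: cvgB.
  by apply: cvgD; [apply: cvgMr | exact: cvg_cst].
elim: ps h => [|x ps IH] h.
  have -> : (fun s : R => \sum_(x <- [::]) c x / (s - x)) = cst 0.
    by apply/funext => s; rewrite big_nil.
  by rewrite big_nil; exact: cvg_cst.
have -> : (fun s : R => \sum_(y <- x :: ps) c y / (s - y)) =
    (fun s => c x / (s - x) + \sum_(y <- ps) c y / (s - y)).
  by apply/funext => s; rewrite big_cons.
rewrite big_cons; apply: cvgD; last first.
  by apply: IH => y yps; apply: h; rewrite inE yps orbT.
apply: cvgMr; apply: cvgV; first by apply: h; rewrite mem_head.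
by apply: cvgB; [exact: cvg_id | exact: cvg_cst].
Qed.

(** A move by half the distance bound to the poles crosses no pole and multiplies u - x by at most
    3/2, so the divided difference is at least 2/3 of the derivative at u. *)
Lemma rnev_step (a b : R) ps c (u d r : R) : 0 <= a -> {in ps, forall x, 0 < c x} ->
  0 < r -> {in ps, forall x, r <= `|u - x|} -> `|d| = r / 2 ->
  r / 3 * nev_deriv a ps c u%:C <= `|rnev a b ps c (u + d) - rnev a b ps c u|.
Proof.
move=> a0 c0 r0 far dr.
have h0 x : x \in ps -> 0 < (u + d - x) * (u - x) /\
    (u + d - x) * (u - x) <= 3 / 2 * (u - x) ^+ 2.
  move=> xps; have := far x xps; have -> : u + d - x = (u - x) + d by ring.
  move: (u - x) => v vr.
  have v0 : 0 < `|v| by apply: lt_le_trans vr.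
  have dv : `|d * v| <= `|v| ^+ 2 / 2.
    rewrite normrM dr expr2 mulrAC ler_pM2r ?invr_gt0 // ler_pM2r //.
  rewrite real_normK ?num_real // in dv.
  have v2 : 0 < v ^+ 2 by rewrite -real_normK ?num_real // exprn_gt0.
  move: dv; rewrite ler_norml => /andP[d1 d2].
  have -> : (v + d) * v = v ^+ 2 + d * v by ring.
  by split; lra.
have nu x : x \in ps -> u - x != 0.
  by move=> xps; rewrite -normr_gt0 (lt_le_trans r0) // far.
have nd x : x \in ps -> u + d - x != 0.
  by move=> xps; have [h _] := h0 x xps; apply: contraTneq h => ->; rewrite mul0r ltxx.
rewrite rnev_diff // addrAC subrr add0r normrM dr.
rewrite ger0_norm; last first.
  rewrite addr_ge0 // big_seq sumr_ge0 // => x xps.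
  by rewrite divr_ge0 // ltW // ?c0 // (h0 x xps).1.
have -> : r / 3 * nev_deriv a ps c u%:C = r / 2 * (2 / 3 * nev_deriv a ps c u%:C).
  by field.
rewrite ler_pM2l ?divr_gt0 // /nev_deriv mulrDr; apply: lerD; first by lra.
rewrite mulr_sumr big_seq [leRHS]big_seq; apply: ler_sum => x xps.
have [h1 h2] := h0 x xps; rewrite -rmorphB cabs_real real_normK ?num_real //.
have -> : 2 / 3 * (c x / (u - x) ^+ 2) = c x / (3 / 2 * (u - x) ^+ 2).
  by field; exact: nu.
rewrite ler_pM2l ?c0 // lef_pV2 ?posrE //.
by apply: lt_le_trans h2.
Qed.

(** A bound 3 / r for the logarithmic derivative. The function increases from u to u + r/2 (or from
    u - r/2 to u, if positive at u) and by the intermediate value theorem keeps its sign there, so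
    the increment given by [rnev_step] is at most |f u|. *)
Lemma rnev_omit (a b : R) ps c (u r : R) : 0 <= a -> {in ps, forall x, 0 < c x} ->
  0 < r -> {in ps, forall x, r <= `|u - x|} ->
  (forall t, `|t - u| <= r / 2 -> rnev a b ps c t != 0) ->
  r / 3 * nev_deriv a ps c u%:C <= `|rnev a b ps c u|.
Proof.
move=> a0 c0 r0 far nz; set f := rnev a b ps c.
have r2 : 0 < r / 2 by rewrite divr_gt0.
have cont t : `|t - u| <= r / 2 -> {for t, continuous f}.
  move=> tu; apply: rnev_cont => x xps; apply/negP => /eqP/subr0_eq tx.
  have := far x xps; rewrite -tx distrC; lra.
have mid (s t v : R) : `|s - u| <= r / 2 -> `|t - u| <= r / 2 -> s <= v <= t ->
    `|v - u| <= r / 2.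
  by rewrite !ler_norml => /andP[? ?] /andP[? ?] /andP[? ?]; apply/andP; split; lra.
have uu : `|u - u| <= r / 2 by rewrite subrr normr0 ltW.
have ivt (s t : R) : s <= t -> `|s - u| <= r / 2 -> `|t - u| <= r / 2 ->
    ~ (Num.min (f s) (f t) <= 0 <= Num.max (f s) (f t)).
  move=> st hs ht m; have [|v] := IVT st _ m.
    by apply: continuous_in_subspaceT => v; rewrite inE /= in_itv /= => /(mid _ _ _ hs ht) /cont.
  by rewrite in_itv /= => /(mid _ _ _ hs ht) /nz /eqP.
have nu := nz u uu; rewrite -/f in nu.
have [neg|pos|/eqP] := ltgtP (f u) 0; last by rewrite (negPf nu).
- have du : `|u + r / 2 - u| <= r / 2 by rewrite addrAC subrr add0r gtr0_norm.
  have fu : f (u + r / 2) < 0.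
    rewrite ltNge; apply/negP => h; apply: (ivt u (u + r / 2) _ uu du).
      by rewrite lerDl ltW.
    by rewrite ge_min le_max (ltW neg) h orbT.
  have := @rnev_step a b ps c u (r / 2) r a0 c0 r0 far.
  rewrite gtr0_norm // => /(_ erefl) /le_trans; apply.
  have fm : f u <= f (u + r / 2).
    have D0 : 0 <= f (u + r / 2) - f u.
      rewrite /f rnev_diff; [|move=> x xps..].
      - rewrite addrAC subrr add0r mulr_ge0 ?(ltW r2) // addr_ge0 //.
        rewrite big_seq sumr_ge0 // => x xps; rewrite divr_ge0 ?(ltW (c0 _ xps)) //.
        have := far x xps; have -> : u + r / 2 - x = (u - x) + r / 2 by ring.
        move: (u - x) => v; rewrite ler_normr => /orP[h|h]; nra.
      - have := far x xps; apply: contraTneq => E; rewrite -ltNge.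
        have -> : u - x = - (r / 2) by lra.
        by rewrite normrN gtr0_norm // ltr_pdivrMr // ltr_pMr // ltr1n.
      - by rewrite -normr_gt0 (lt_le_trans r0) // far.
    lra.
  rewrite -/f ger0_norm ?ltr0_norm //; first by rewrite lerBlDr addNr ltW.
  by rewrite subr_ge0.
- have du : `|u - r / 2 - u| <= r / 2 by rewrite addrAC subrr add0r normrN gtr0_norm.
  have fu : 0 < f (u - r / 2).
    rewrite ltNge; apply/negP => h; apply: (ivt (u - r / 2) u _ du uu).
      by rewrite gerBl ltW.
    by rewrite ge_min le_max (ltW pos) h orbT.
  have := @rnev_step a b ps c u (- (r / 2)) r a0 c0 r0 far.
  rewrite normrN gtr0_norm // => /(_ erefl) /le_trans; apply.
  have fm : f (u - r / 2) <= f u.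
    have D0 : 0 <= f u - f (u - r / 2).
      rewrite /f rnev_diff; [|move=> x xps..].
      - rewrite opprB addrCA subrr addr0 mulr_ge0 ?(ltW r2) // addr_ge0 //.
        rewrite big_seq sumr_ge0 // => x xps; rewrite divr_ge0 ?(ltW (c0 _ xps)) //.
        have := far x xps; have -> : u - r / 2 - x = (u - x) - r / 2 by ring.
        move: (u - x) => v; rewrite ler_normr => /orP[h|h]; nra.
      - by rewrite -normr_gt0 (lt_le_trans r0) // far.
      - have := far x xps; apply: contraTneq => E; rewrite -ltNge.
        have -> : u - x = r / 2 by lra.
        by rewrite gtr0_norm // ltr_pdivrMr // ltr_pMr // ltr1n.
    lra.
  rewrite -/f distrC ger0_norm ?gtr0_norm ?subr_ge0 // gerBl ltW //.
Qed.

(** Within r / 2 of u the distance to a pole x is at least |u - x| / 2; two such factors in the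
    kernel give the 4. *)
Lemma nev_lipschitz (a b : R) ps c (u r : R) (z w : R[i]) : 0 <= a ->
  {in ps, forall x, 0 < c x} -> 0 < r -> {in ps, forall x, r <= `|u - x|} ->
  cabs (z - u%:C) <= r / 2 -> cabs (w - u%:C) <= r / 2 ->
  cabs (nev a b ps c z - nev a b ps c w) <=
    cabs (z - w) * (4 * nev_deriv a ps c u%:C).
Proof.
move=> a0 c0 r0 far zu wu.
have half (v : R[i]) x : x \in ps -> cabs (v - u%:C) <= r / 2 ->
    `|u - x| / 2 <= cabs (v - x%:C).
  move=> xps vu; have h := far x xps.
  have := cabs_sub_le (u%:C - x%:C) (v - x%:C).
  have -> : u%:C - x%:C - (v - x%:C) = - (v - u%:C) by ring.
  rewrite cabsN -rmorphB cabs_real; lra.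
have nv (v : R[i]) x : x \in ps -> cabs (v - u%:C) <= r / 2 -> v - x%:C != 0.
  move=> xps vu; rewrite -cabs_gt0; apply: lt_le_trans (half v x xps vu).
  by rewrite divr_gt0 // (lt_le_trans r0) // far.
rewrite nev_diff => [|x xps|x xps]; try exact: nv.
rewrite cabsM ler_wpM2l ?cabs_ge0 //.
apply: le_trans (cabsD _ _) _; rewrite cabs_real ger0_norm // /nev_deriv mulrDr.
apply: lerD; first by lra.
apply: le_trans (cabs_sum _ _ _) _; rewrite mulr_sumr.
rewrite big_seq [leRHS]big_seq; apply: ler_sum => x xps.
rewrite cabsM cabsV cabsM cabs_real (gtr0_norm (c0 _ xps)) -rmorphB cabs_real.
have h1 := half z x xps zu; have h2 := half w x xps wu.
have ux : 0 < `|u - x| by rewrite (lt_le_trans r0) // far.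
have -> : 4 * (c x / `|u - x| ^+ 2) = c x / (`|u - x| / 2 * (`|u - x| / 2)).
  by field; rewrite gt_eqF.
have x2 : 0 < `|u - x| / 2 by rewrite divr_gt0.
rewrite ler_pM2l ?c0 // lef_pV2 ?posrE ?mulr_gt0 //.
- by rewrite ler_pM // ltW.
- exact: lt_le_trans h1.
- exact: lt_le_trans h2.
Qed.

(** Let k be the modulus of the value at u. By [rnev_omit] the Lipschitz constant 4 f'(u) is at most
    12 k / r, so within r / 24 of u the modulus stays above k / 2. Dividing by it in the chord
    cancels k and leaves 24 / r, which does not depend on the map. *)
Lemma half_plane_lipschitz p q (u r : R) : coprimep p q -> q != 0 ->
  half_plane_map (ratmap p q) -> 0 < r ->
  (forall t : R, `|t - u| < r -> p.[t%:C] != 0 /\ q.[t%:C] != 0) ->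
  forall z w : R[i], cabs (z - u%:C) <= r / 24 -> cabs (w - u%:C) <= r / 24 ->
    half_chord (pt p.[z] q.[z]) (pt p.[w] q.[w]) <= 24 / r * cabs (z - w).
Proof.
move=> cpq q0 hp r0 om z w zu wu.
have [a [b [ps [c [[a0 ups c0 qz pq] _]]]]] := nevanlinna cpq q0 hp.
have far : {in ps, forall x, r <= `|u - x|}.
  move=> x xps; rewrite leNgt distrC; apply/negP => /om[_]; rewrite qz.
  by rewrite map_f.
have uu : `|u - u| < r by rewrite subrr normr0.
have qr t : `|t - u| < r -> q.[t%:C] != 0 by move=> /om[].
have k0 : rnev a b ps c u != 0.
  have [h1 h2] := om u uu; have := pq _ h2; rewrite nev_real => E.
  apply: contraNneq h1 => k0; move/eqP: E; rewrite k0 mulf_eq0 invr_eq0 (negPf h2).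
  by rewrite orbF.
have omit : r / 3 * nev_deriv a ps c u%:C <= `|rnev a b ps c u|.
  apply: (@rnev_omit a b) => // t tu.
  have tr : `|t - u| < r by apply: le_lt_trans tu _; rewrite ltr_pdivrMr // ltr_pMr // ltr1n.
  have [h1 h2] := om t tr; have := pq _ h2; rewrite nev_real => E.
  apply: contraNneq h1 => k1; move/eqP: E; rewrite k1 mulf_eq0 invr_eq0 (negPf h2).
  by rewrite orbF.
set k := `|rnev a b ps c u| in omit.
have kp : 0 < k by rewrite normr_gt0.
have qn (v : R[i]) : cabs (v - u%:C) <= r / 24 -> q.[v] != 0.
  move=> vu; rewrite qz; apply/mapP => -[x xps vx]; have := far x xps.
  move: vu; rewrite vx -rmorphB cabs_real distrC; lra.
have lip (v v' : R[i]) : cabs (v - u%:C) <= r / 24 -> cabs (v' - u%:C) <= r / 24 ->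
    cabs (p.[v] / q.[v] - p.[v'] / q.[v']) <= cabs (v - v') * (12 / r * k).
  move=> vu v'u; rewrite !pq ?qn //.
  have r24 : r / 24 <= r / 2 by lra.
  apply: le_trans (nev_lipschitz b a0 c0 r0 far (le_trans vu r24) (le_trans v'u r24)) _.
  rewrite ler_wpM2l ?cabs_ge0 //.
  have h : 12 / r * (r / 3 * nev_deriv a ps c u%:C) <= 12 / r * k.
    by rewrite ler_pM2l ?divr_gt0.
  apply: le_trans h; rewrite le_eqVlt; apply/orP; left; apply/eqP.
  by field; rewrite gt_eqF.
have uc : cabs (u%:C - u%:C) <= r / 24 by rewrite subrr cabs0 divr_ge0 // ltW.
have big : k / 2 <= cabs (p.[z] / q.[z]).
  have := lip u%:C z uc zu; rewrite cabsB.
  rewrite [X in cabs (X - _)]pq ?qr // nev_real.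
  have := cabs_sub_le (rnev a b ps c u)%:C (p.[z] / q.[z]); rewrite cabs_real -/k.
  have : cabs (u%:C - z) * (12 / r * k) <= r / 24 * (12 / r * k).
    apply: ler_wpM2r; last by rewrite cabsB; exact: zu.
    by apply: mulr_ge0; [apply: divr_ge0 => //; exact: ltW | exact: ltW].
  have -> : r / 24 * (12 / r * k) = k / 2 by field; rewrite gt_eqF.
  rewrite [cabs (_ - p.[z] / _)]cabsB cabsB; lra.
rewrite /pt (negPf (qn z zu)) (negPf (qn w wu)) /= /half_chord_fin.
set Z := p.[z] / q.[z] in big *; set W := p.[w] / q.[w].
have Z1 : k / 2 <= Num.sqrt (1 + cabs Z ^+ 2).
  apply: le_trans big _; rewrite -[leLHS]ger0_norm ?cabs_ge0 // -sqrtr_sqr.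
  by apply: ler_wsqrtr; rewrite lerDr.
have W1 : 1 <= Num.sqrt (1 + cabs W ^+ 2).
  by rewrite -[leLHS]sqrtr1; apply: ler_wsqrtr; rewrite lerDl sqr_ge0.
have k2 : 0 < k / 2 by rewrite divr_gt0.
rewrite ler_pdivrMr; last first.
  by apply: mulr_gt0; [exact: lt_le_trans Z1 | exact: lt_le_trans W1].
have h1 : k / 2 * 1 <= Num.sqrt (1 + cabs Z ^+ 2) * Num.sqrt (1 + cabs W ^+ 2).
  by rewrite ler_pM // ltW.
have c24 : 0 <= 24 / r * cabs (z - w) by rewrite mulr_ge0 ?cabs_ge0 ?divr_ge0 // ltW.
apply: le_trans (lip z w zu wu) _; apply: le_trans (ler_wpM2l c24 h1).
rewrite le_eqVlt; apply/orP; left; apply/eqP; by field; rewrite gt_eqF.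
Qed.

Definition real_comb (m n : R) p q : {poly R[i]} := m%:C *: p + n%:C *: q.

Lemma horner_real_comb m n p q z :
  (real_comb m n p q).[z] = m%:C * p.[z] + n%:C * q.[z].
Proof. by rewrite /real_comb hornerD !hornerZ. Qed.

Lemma Im_mobius (m n k l : R) (w : R[i]) : 0 < m * l - n * k -> Im w != 0 ->
  k%:C * w + l%:C != 0 /\
  Im ((m%:C * w + n%:C) / (k%:C * w + l%:C)) =
    (m * l - n * k) * Im w / cabs (k%:C * w + l%:C) ^+ 2.
Proof.
move=> d0 w0.
have h : k%:C * w + l%:C != 0.
  apply/negP => /eqP E; have := congr1 (@complex.Im R) E; have := congr1 (@complex.Re R) E.
  case: w w0 {E} => a b /= b0; rewrite !mul0r subr0 !addr0 => kl /eqP.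
  rewrite mulf_eq0 (negPf b0) orbF => /eqP k0; move: d0 kl.
  by rewrite k0 mulr0 mul0r add0r subr0 => d0 l0; rewrite l0 mulr0 ltxx in d0.
split=> //; rewrite Im_div_sign //; congr (_ / _).
case: w {w0 h} => a b /=; ring.
Qed.

(* Post-composition with the real Moebius map w |-> (m w + n) / (k w + l). *)
Lemma half_plane_mobius_lipschitz (m n k l u r : R) : 0 < m * l - n * k -> 0 < r ->
  exists2 C : R, 0 < C & forall p q, coprimep p q -> q != 0 ->
    half_plane_map (ratmap p q) ->
    (forall t : R, `|t - u| < r -> (real_comb m n p q).[t%:C] != 0 /\
                                   (real_comb k l p q).[t%:C] != 0) ->
  forall z w : R[i], cabs (z - u%:C) <= r / 24 -> cabs (w - u%:C) <= r / 24 ->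
    half_chord (ratmap p q (finpt z)) (ratmap p q (finpt w)) <= C * cabs (z - w).
Proof.
move=> det0 r0; set d := m * l - n * k in det0.
set N := m ^+ 2 + n ^+ 2 + k ^+ 2 + l ^+ 2.
have dE : d%:C = m%:C * l%:C - n%:C * k%:C :> R[i] by rewrite rmorphB !rmorphM.
have d0 : d%:C != 0 :> R[i] by rewrite -cabs_gt0 cabs_real gtr0_norm.
have N0 : 0 < N.
  rewrite lt_def !addr_ge0 ?sqr_ge0 // andbT; apply: contraTneq det0 => N0.
  have : m ^+ 2 = 0 /\ n ^+ 2 = 0.
    have := sqr_ge0 m; have := sqr_ge0 n; have := sqr_ge0 k; have := sqr_ge0 l.
    by move: N0; rewrite /N; split; lra.
  by rewrite /d => -[/eqP + /eqP]; rewrite !sqrf_eq0 => /eqP -> /eqP ->; rewrite !mul0r subrr ltxx.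
(* Composing with the matrix multiplies determinants by d and norms by at most the square root of N,
   so undoing it costs a factor N / d on chords. *)
exists (24 / r * N / d).
  by apply: divr_gt0 => //; apply: mulr_gt0 => //; apply: divr_gt0.
move=> p q cpq q0 hp om z w zu wu.
set p' := real_comb m n p q; set q' := real_comb k l p q.
have pE v : d%:C * p.[v] = l%:C * p'.[v] - n%:C * q'.[v].
  by rewrite !horner_real_comb dE; ring.
have qE v : d%:C * q.[v] = m%:C * q'.[v] - k%:C * p'.[v].
  by rewrite !horner_real_comb dE; ring.
have cpq' : coprimep p' q'.
  apply: Pdiv.ClosedField.root_coprimep => v /eqP pv; apply/negP => /eqP qv.
  have := coprimep_horner v cpq.
  by rewrite -(mulrI_eq0 p.[v] (mulfI d0)) -(mulrI_eq0 q.[v] (mulfI d0)) pE qE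
    pv qv !mulr0 subrr eqxx.
have q'0 : q' != 0.
  have [_] := om u ltac:(by rewrite subrr normr0).
  by apply: contraNneq; rewrite -/q' => ->; rewrite horner0.
have mob v : q.[v] != 0 -> p'.[v] / q'.[v] =
    (m%:C * (p.[v] / q.[v]) + n%:C) / (k%:C * (p.[v] / q.[v]) + l%:C).
  move=> qv; rewrite !horner_real_comb.
  have -> : m%:C * (p.[v] / q.[v]) + n%:C = (m%:C * p.[v] + n%:C * q.[v]) / q.[v].
    by field.
  have -> : k%:C * (p.[v] / q.[v]) + l%:C = (k%:C * p.[v] + l%:C * q.[v]) / q.[v].
    by field.
  by rewrite -mulf_div divff ?mulr1 ?invr_eq0 // .
have q'E v : q.[v] != 0 -> q'.[v] = q.[v] * (k%:C * (p.[v] / q.[v]) + l%:C).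
  by move=> qv; rewrite horner_real_comb; field.
have hp' : half_plane_map (ratmap p' q').
  split=> v v0.
    have [qv w0] := half_plane_upper hp v0; rewrite ratmap_fin /pt.
    have [h1 h2] := Im_mobius det0 (lt0r_neq0 w0).
    rewrite q'E // mulf_eq0 (negPf qv) (negPf h1) /= -q'E //.
    exists (p'.[v] / q'.[v]) => //; rewrite mob // h2.
    apply: divr_gt0; first exact: mulr_gt0.
    by apply: exprn_gt0; rewrite cabs_gt0.
  have [qv w0] := half_plane_lower hp v0; rewrite ratmap_fin /pt.
  have [h1 h2] := Im_mobius det0 (ltr0_neq0 w0).
  rewrite q'E // mulf_eq0 (negPf qv) (negPf h1) /= -q'E //.
  exists (p'.[v] / q'.[v]) => //; rewrite mob // h2.
  by rewrite pmulr_llt0 ?invr_gt0 ?exprn_gt0 ?cabs_gt0 // pmulr_rlt0.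
have := half_plane_lipschitz cpq' q'0 hp' r0 om zu wu.
have hn v : 0 < hnorm p.[v] q.[v] by rewrite hnorm_gt0 coprimep_horner.
have hn' v : 0 < hnorm p'.[v] q'.[v] by rewrite hnorm_gt0 coprimep_horner.
rewrite !ratmap_fin !half_chord_pt //.
have comb (a b : R) v : cabs (a%:C * p.[v] + b%:C * q.[v]) ^+ 2 <=
    (a ^+ 2 + b ^+ 2) * hnorm p.[v] q.[v] ^+ 2.
  have := cauchy_schwarz2 p.[v] q.[v] (a%:C) (b%:C).
  rewrite !conjc_real [_ * a%:C]mulrC [_ * b%:C]mulrC => h.
  have -> : a ^+ 2 + b ^+ 2 = hnorm a%:C b%:C ^+ 2.
    by rewrite hnorm_sqr !cabs_real !real_normK ?num_real.
  rewrite [leRHS]mulrC -exprMn ler_sqr ?nnegrE ?cabs_ge0 //.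
  by apply: mulr_ge0; exact: hnorm_ge0.
have bound v : hnorm p'.[v] q'.[v] <= Num.sqrt N * hnorm p.[v] q.[v].
  rewrite -ler_sqr ?nnegrE ?mulr_ge0 ?hnorm_ge0 ?sqrtr_ge0 //.
  rewrite hnorm_sqr exprMn sqr_sqrtr ?(ltW N0) // !horner_real_comb.
  have := comb m n v; have := comb k l v; rewrite /N; lra.
have -> : p'.[z] * q'.[w] - q'.[z] * p'.[w] = d%:C * (p.[z] * q.[w] - q.[z] * p.[w]).
  by rewrite !horner_real_comb dE; ring.
rewrite cabsM cabs_real gtr0_norm //.
set X := cabs _; set A := hnorm p'.[z] _; set B := hnorm p'.[w] _.
set A1 := hnorm p.[z] _; set B1 := hnorm p.[w] _; set Y := cabs (z - w) => H.
have AB : A * B <= N * (A1 * B1).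
  have -> : N * (A1 * B1) = (Num.sqrt N * A1) * (Num.sqrt N * B1).
    by rewrite -{1}[N]sqr_sqrtr ?(ltW N0) //; ring.
  by rewrite ler_pM ?hnorm_ge0 ?bound.
have A0 : 0 < A by apply: hn'.
have B0 : 0 < B by apply: hn'.
have A10 : 0 < A1 by apply: hn.
have B10 : 0 < B1 by apply: hn.
have X0 : 0 <= X by apply: cabs_ge0.
have -> : X / (A1 * B1) = d * X / (N * (A1 * B1)) * (N / d).
  by field; rewrite !gt_eqF.
have -> : 24 / r * N / d * Y = 24 / r * Y * (N / d) by ring.
apply: ler_wpM2r; first by rewrite divr_ge0 // ltW.
apply: le_trans H; apply: ler_wpM2l; first by rewrite mulr_ge0 // ltW.
by rewrite lef_pV2 ?posrE ?mulr_gt0.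
Qed.

End Distortion.

(** * Maps given by quadratic or linear forms, and the two-fold covering phi *)

Section Phi.
Variable R : realType.
Implicit Types (x y : sphere R) (a b c d z w : R[i]).

Definition quad (c2 c1 c0 : R[i]) : {poly R[i]} :=
  c2%:P * 'X^2 + c1%:P * 'X + c0%:P.

Lemma coef_quad (c2 c1 c0 : R[i]) :
  [/\ (quad c2 c1 c0)`_0 = c0, (quad c2 c1 c0)`_1 = c1 &
      (quad c2 c1 c0)`_2 = c2].
Proof.
by rewrite /quad !coefD !coefCM !coefXn !coefX !coefC /= !(mulr0, mulr1, addr0, add0r).
Qed.

Lemma size_quad (c2 c1 c0 : R[i]) : (size (quad c2 c1 c0) <= 3)%N.
Proof.
apply/leq_sizeP => j; rewrite /quad !coefD !coefCM !coefXn !coefX !coefC.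
by case: j => [|[|[|j]]] // _; rewrite !mulr0 !addr0.
Qed.

Lemma hz_quad (c2 c1 c0 a b : R[i]) :
  hz (quad c2 c1 c0) 2 a b = c2 * a ^+ 2 + c1 * a * b + c0 * b ^+ 2.
Proof.
have [h0 h1 h2] := coef_quad c2 c1 c0.
rewrite /hz !big_ord_recr big_ord0 /= h0 h1 h2 subn0 subnn subSS subn0; ring.
Qed.

(** Absence of a common projective zero replaces a gcd computation: the points [z : 1] give
    coprimality and [1 : 0] gives the degree. *)
Lemma hz_nz_coprime p q n : (forall a b, hz p n a b = 0 -> hz q n a b = 0 ->
    a = 0 /\ b = 0) -> (size p <= n.+1)%N -> (size q <= n.+1)%N ->
  coprimep p q /\ ratdeg p q = n.
Proof.
move=> nd sp sq; split.
  apply: Pdiv.ClosedField.root_coprimep => z /eqP pz; apply/negP => /eqP qz.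
  have [||_ /eqP] := nd z 1; rewrite ?hz_fin //.
  by rewrite oner_eq0.
apply: ratdeg_eq => //; rewrite -negb_and; apply/negP => /andP[/eqP pn /eqP qn].
have [||/eqP] := nd 1 0; rewrite ?hz_a0 ?pn ?qn ?mul0r //.
by rewrite oner_eq0.
Qed.

Lemma quad_ratmap (u2 u1 u0 v2 v1 v0 : R[i]) :
  (forall a b, u2 * a ^+ 2 + u1 * a * b + u0 * b ^+ 2 = 0 ->
     v2 * a ^+ 2 + v1 * a * b + v0 * b ^+ 2 = 0 -> a = 0 /\ b = 0) ->
  quad v2 v1 v0 != 0 ->
  rational_of_degree 2 (ratmap (quad u2 u1 u0) (quad v2 v1 v0)) /\
  forall a b, 0 < hnorm a b ->
    ratmap (quad u2 u1 u0) (quad v2 v1 v0) (pt a b) =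
      pt (u2 * a ^+ 2 + u1 * a * b + u0 * b ^+ 2)
         (v2 * a ^+ 2 + v1 * a * b + v0 * b ^+ 2).
Proof.
move=> nd v0'; have [] := @hz_nz_coprime (quad u2 u1 u0) (quad v2 v1 v0) 2.
- by move=> a b; rewrite !hz_quad; exact: nd.
- exact: size_quad.
- exact: size_quad.
move=> cop deg; split; first by exists (quad u2 u1 u0), (quad v2 v1 v0).
by move=> a b ab; rewrite ratmap_pt // deg !hz_quad.
Qed.

Lemma quad_neq0 (v2 v1 v0 : R[i]) : (v2 != 0) || (v1 != 0) || (v0 != 0) ->
  quad v2 v1 v0 != 0.
Proof.
have [h0 h1 h2] := coef_quad v2 v1 v0.
move=> h; apply: contraTneq h => E; rewrite E in h0 h1 h2.
by rewrite -h0 -h1 -h2 !coef0 !eqxx.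
Qed.

Lemma lin_ratmap (u1 u0 v1 v0 : R[i]) : u1 * v0 - u0 * v1 != 0 ->
  rational_of_degree 1 (ratmap (u1%:P * 'X + u0%:P) (v1%:P * 'X + v0%:P)) /\
  forall a b, 0 < hnorm a b ->
    ratmap (u1%:P * 'X + u0%:P) (v1%:P * 'X + v0%:P) (pt a b) =
      pt (u1 * a + u0 * b) (v1 * a + v0 * b).
Proof.
move=> det0.
have H (c1 c0 : R[i]) : (size (c1%:P * 'X + c0%:P)%R <= 2)%N /\
    forall a b, hz (c1%:P * 'X + c0%:P) 1 a b = c1 * a + c0 * b.
  split.
    apply/leq_sizeP => j; rewrite !coefD !coefCM !coefX !coefC.
    by case: j => [|[|j]] // _; rewrite !mulr0 !addr0.
  move=> a b; rewrite /hz !big_ord_recl big_ord0 /= !coefD !coefCM !coefX !coefC.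
  by rewrite /bump /= !(expr0, expr1, mulr0, mulr1, addr0, add0r); rewrite addrC.
have [] := @hz_nz_coprime (u1%:P * 'X + u0%:P) (v1%:P * 'X + v0%:P) 1.
- move=> a b; rewrite (H _ _).2 (H _ _).2 => e1 e2.
  have ha : (u1 * v0 - u0 * v1) * a = v0 * (u1 * a + u0 * b) - u0 * (v1 * a + v0 * b) by ring.
  have hb : (u1 * v0 - u0 * v1) * b = u1 * (v1 * a + v0 * b) - v1 * (u1 * a + u0 * b) by ring.
  by split; apply: (mulfI det0); rewrite ?ha ?hb e1 e2 !mulr0 subrr.
- exact: (H _ _).1.
- exact: (H _ _).1.
move=> cop deg.
have q0 : v1%:P * 'X + v0%:P != 0 :> {poly R[i]}.
  apply: contraNneq det0 => E.
  have := congr1 (horner^~ 1) E; have := congr1 (horner^~ 0) E.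
  rewrite /= !hornerE => ->; rewrite addr0 => ->.
  by rewrite !mulr0 subrr.
split; first by exists (u1%:P * 'X + u0%:P), (v1%:P * 'X + v0%:P).
by move=> a b ab; rewrite ratmap_pt // deg (H _ _).2 (H _ _).2.
Qed.

Lemma phi_spec : rational_of_degree 2 (@phi R) /\
  forall a b, 0 < hnorm a b -> phi (pt a b) = pt (a ^+ 2 - b ^+ 2) (a ^+ 2 + b ^+ 2).
Proof.
have E1 : 'X^2 - 1 = quad 1 0 (-1) by rewrite /quad polyC0 polyCN polyC1; ring.
have E2 : 'X^2 + 1 = quad 1 0 1 by rewrite /quad polyC0 polyC1; ring.
rewrite /phi E1 E2; have [||h1 h2] := @quad_ratmap 1 0 (-1) 1 0 1.
- move=> a b e1 e2; have a2 : 2 * a ^+ 2 = 0.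
    have -> : 2 * a ^+ 2 = (1 * a ^+ 2 + 0 * a * b + 1 * b ^+ 2)
      + (1 * a ^+ 2 + 0 * a * b + -1 * b ^+ 2) by ring.
    by rewrite e1 e2 addr0.
  have b2 : 2 * b ^+ 2 = 0.
    have -> : 2 * b ^+ 2 = (1 * a ^+ 2 + 0 * a * b + 1 * b ^+ 2)
      - (1 * a ^+ 2 + 0 * a * b + -1 * b ^+ 2) by ring.
    by rewrite e1 e2 subrr.
  by split; apply/eqP; [move/eqP: a2|move/eqP: b2];
    rewrite mulf_eq0 pnatr_eq0 /= sqrf_eq0.
- by apply: quad_neq0; rewrite oner_eq0.
by split=> // a b ab; rewrite h2 //; congr pt; ring.
Qed.

Lemma sopp_pt a b : sopp (pt a b) = pt (- a) b.
Proof. by rewrite /pt; case: ifP => //= _; rewrite mulNr. Qed.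

Lemma soppK x : sopp (sopp x) = x.
Proof. by case: x => //= z; rewrite opprK. Qed.

Lemma hnorm_opp a b : hnorm (- a) b = hnorm a b.
Proof. by rewrite /hnorm cabsN. Qed.

Lemma half_chord_sopp x y : half_chord (sopp x) (sopp y) = half_chord x y.
Proof.
have [a [b [h ->]]] := ptP x; have [c [d [k ->]]] := ptP y.
rewrite !sopp_pt !half_chord_pt ?hnorm_opp //; congr (_ / _).
by rewrite -cabsN; congr cabs; ring.
Qed.

Lemma phi_sopp x : phi (sopp x) = phi x.
Proof.
have [a [b [h ->]]] := ptP x; rewrite sopp_pt !phi_spec.2 ?hnorm_opp //.
by rewrite sqrrN.
Qed.

(* [phi] is [x |-> x^2] followed by an isometry of the sphere. *)
Lemma phi_chord x y :
  half_chord x y * half_chord x (sopp y) <= half_chord (phi x) (phi y) /\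
  half_chord (phi x) (phi y) <= 2 * (half_chord x y * half_chord x (sopp y)).
Proof.
have nz a b : 0 < hnorm a b -> 0 < hnorm (a ^+ 2 - b ^+ 2) (a ^+ 2 + b ^+ 2) /\
    (hnorm a b ^+ 2 <= hnorm (a ^+ 2 - b ^+ 2) (a ^+ 2 + b ^+ 2) /\
    hnorm (a ^+ 2 - b ^+ 2) (a ^+ 2 + b ^+ 2) ^+ 2 <= 2 * (hnorm a b ^+ 2) ^+ 2).
  move=> ab; set H := hnorm (_ - _) _.
  (* Parallelogram law. Hence H lies between the squared norm of (a, b) and the square root of 2
     times it; together with the factor 2 of the determinant this gives the constants 1 and 2. *)
  have E : H ^+ 2 = 2 * ((cabs a ^+ 2) ^+ 2 + (cabs b ^+ 2) ^+ 2).
    rewrite hnorm_sqr !cabs_sqr; case: (a) => a1 a2; case: (b) => b1 b2 /=; ring.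
  have ha := sqr_ge0 (cabs a); have hb := sqr_ge0 (cabs b).
  have H0 : 0 <= H by apply: hnorm_ge0.
  have ab2 : 0 < hnorm a b ^+ 2 by rewrite exprn_gt0.
  have le1 : hnorm a b ^+ 2 <= H.
    rewrite -ler_sqr ?nnegrE ?(ltW ab2) // E hnorm_sqr.
    move: (cabs a ^+ 2) (cabs b ^+ 2) ha hb => u v u0 v0.
    have := sqr_ge0 (u - v); rewrite -subr_ge0.
    have -> : 2 * (u ^+ 2 + v ^+ 2) - (u + v) ^+ 2 = (u - v) ^+ 2 by ring.
    by [].
  split; first exact: lt_le_trans le1.
  split=> //; rewrite E hnorm_sqr.
  move: (cabs a ^+ 2) (cabs b ^+ 2) ha hb => u v u0 v0.
  have := mulr_ge0 u0 v0; rewrite -[2 * _ <= _]subr_ge0.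
  have -> : 2 * (u + v) ^+ 2 - 2 * (u ^+ 2 + v ^+ 2) = 4 * (u * v) by ring.
  by move=> uv; rewrite mulr_ge0.
have [a [b [h ->]]] := ptP x; have [c [d [k ->]]] := ptP y.
rewrite sopp_pt !phi_spec.2 //.
have [h1 [h2 h3]] := nz a b h; have [k1 [k2 k3]] := nz c d k.
rewrite !half_chord_pt ?hnorm_opp //.
have -> : (a ^+ 2 - b ^+ 2) * (c ^+ 2 + d ^+ 2) - (a ^+ 2 + b ^+ 2) * (c ^+ 2 - d ^+ 2)
  = 2%:C * ((a * d - b * c) * (a * d - b * - c)) by rewrite rmorph_nat; ring.
rewrite !cabsM cabs_real ger0_norm //.
have -> : forall X Y U V : R, X / (U * V) * (Y / (U * V)) = X * Y / (U ^+ 2 * V ^+ 2).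
  by move=> X Y U V; rewrite mulf_div; congr (_ / _); ring.
have := mulr_ge0 (cabs_ge0 (a * d - b * c)) (cabs_ge0 (a * d - b * - c)).
have u0 : 0 < hnorm a b ^+ 2 by rewrite exprn_gt0.
have v0 : 0 < hnorm c d ^+ 2 by rewrite exprn_gt0.
move: (cabs _ * _) (hnorm a b ^+ 2) (hnorm c d ^+ 2) (hnorm (_ - _) _) (hnorm (c ^+ 2 - _) _) h1 h2 h3 k1 k2 k3 u0 v0.
move=> X u v H K H0 uH Hu K0 vK Kv u0 v0 X0.
have uv : u * v <= H * K by rewrite ler_pM // ltW.
have HK : H * K <= 2 * (u * v).
  have h1 : 0 <= H * K by rewrite mulr_ge0 // ltW.
  have h2 : 0 <= 2 * (u * v) by rewrite !mulr_ge0 // ltW.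
  rewrite -ler_sqr ?nnegrE //.
  have -> : (2 * (u * v)) ^+ 2 = (2 * u ^+ 2) * (2 * v ^+ 2) by ring.
  by rewrite exprMn ler_pM ?sqr_ge0.
have HK0 : 0 < H * K by rewrite mulr_gt0.
have uv0 : 0 < u * v by rewrite mulr_gt0.
split.
  rewrite ler_pdivrMr // mulrAC ler_pdivlMr // [2 * X]mulrC -mulrA.
  by rewrite ler_wpM2l // .
rewrite -mulrA ler_pM2l // ler_wpM2l // lef_pV2 ?posrE //.
Qed.

Lemma phi_lip x y : half_chord (phi x) (phi y) <= 2 * half_chord x y.
Proof.
have [_ h] := phi_chord x y; apply: le_trans h _.
by rewrite ler_pM2l // -[leRHS]mulr1 ler_wpM2l ?half_chord_ge0 // half_chord_le1.
Qed.

Lemma phi_close x y (e : R) : 0 < e -> half_chord (phi x) (phi y) < e ^+ 2 ->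
  half_chord x y < e \/ half_chord x (sopp y) < e.
Proof.
move=> e0 h; have [h1 _] := phi_chord x y.
have [|h2] := ltP (half_chord x y) e; first by left.
right; rewrite ltNge; apply/negP => h3.
have : e * e <= half_chord x y * half_chord x (sopp y) by rewrite ler_pM // ltW.
by move=> /le_trans /(_ h1); rewrite leNgt -expr2 h.
Qed.

Lemma phi_surj y : exists x, y = phi x.
Proof.
have [a [b [h ->]]] := ptP y.
(* Solves u^2 - v^2 = 2 a and u^2 + v^2 = 2 b. *)
pose u := sqrtc (a + b); pose v := sqrtc (b - a).
have uE : u ^+ 2 = a + b by rewrite sqr_sqrtc.
have vE : v ^+ 2 = b - a by rewrite sqr_sqrtc.
have uv : 0 < hnorm u v.
  rewrite hnorm_gt0 -negb_and; apply/negP => /andP[/eqP u0 /eqP v0].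
  move: uE vE; rewrite u0 v0 expr0n /= => /esym e1 /esym e2.
  have b0 : 2 * b = 0.
    have -> : 2 * b = (a + b) + (b - a) by ring.
    by rewrite e1 e2 addr0.
  move/eqP: b0; rewrite mulf_eq0 pnatr_eq0 /= => /eqP b0.
  by move: h; rewrite hnorm_gt0 b0 eqxx orbF; move: e1; rewrite b0 addr0 => ->; rewrite eqxx.
exists (pt u v); rewrite phi_spec.2 // uE vE.
have -> : a + b - (b - a) = 2 * a by ring.
have -> : a + b + (b - a) = 2 * b by ring.
by rewrite pt_scale // pnatr_eq0.
Qed.

Lemma phi_open (W : set (sphere R)) : open W -> open (phi @` W).
Proof.
move=> /sphere_open_chordP oW; apply/sphere_open_chordP => _ [x Wx <-].
have [e e0 He] := oW x Wx; exists (e ^+ 2); first by rewrite exprn_gt0.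
move=> y; have [x' ->] := phi_surj y => /(phi_close e0)[h|h].
  by exists x' => //; exact: He.
by exists (sopp x'); [exact: He | rewrite phi_sopp].
Qed.

Lemma phi_preimage_open (W : set (sphere R)) : open W -> open (phi @^-1` W).
Proof.
move=> /sphere_open_chordP oW; apply/sphere_open_chordP => x /= Wx.
have [e e0 He] := oW _ Wx; exists (e / 2); first by rewrite divr_gt0.
move=> y xy /=; apply: He; apply: le_lt_trans (phi_lip x y) _.
by rewrite mulrC -ltr_pdivlMr.
Qed.

Lemma fwd_semiconj (f ft : sphere R -> sphere R) n x : phi \o f = ft \o phi ->
  phi (fwd f n x) = fwd ft n (phi x).
Proof.
move=> E; have E1 y : phi (f y) = ft (phi y) by move: (congr1 (@^~ y) E).
by rewrite /fwd; elim: n => [|n IH] /=; rewrite E1 //; congr ft; exact: IH.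
Qed.

(** A point close to phi x has a preimage close to x, the two preimages being opposite to each
    other. *)
Lemma equicont_phi (f ft : sphere R -> sphere R) x : phi \o f = ft \o phi ->
  equicont (fwd f) x -> equicont (fwd ft) (phi x).
Proof.
move=> E eq e e0; have e2 : 0 < e / 2 by rewrite divr_gt0.
have [d d0 Hd] := eq _ e2; exists (d ^+ 2); first by rewrite exprn_gt0.
move=> n y; have [x' ->] := phi_surj y.
have main x'' : half_chord x x'' < d -> half_chord (fwd ft n (phi x)) (fwd ft n (phi x'')) < e.
  move=> /(Hd n) h; rewrite -!(fwd_semiconj _ _ E).
  by apply: le_lt_trans (phi_lip _ _) _; rewrite mulrC -ltr_pdivlMr.
move=> /(phi_close d0)[]; first exact: main.
by move=> /main; rewrite phi_sopp.
Qed.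

Definition curve_cont (g : R -> sphere R) := forall t (e : R), 0 < e ->
  exists2 d : R, 0 < d & forall s, `|t - s| < d -> half_chord (g t) (g s) < e.

(** Straight segments, in z near a finite point and in 1/z near infinity. They provide the
    connectedness needed to lift equicontinuity through phi. *)
Lemma short_curve x (d : R) : 0 < d -> exists2 d' : R, 0 < d' &
  forall y, half_chord x y < d' -> exists g : R -> sphere R,
    [/\ curve_cont g, g 0 = x, g 1 = y &
        forall t, 0 <= t <= 1 -> half_chord x (g t) < d].
Proof.
have lip (g : R -> sphere R) (C : R) : (forall t s, half_chord (g t) (g s) <= `|t - s| * C) ->
    curve_cont g.
  move=> H t e e0; exists (e / (`|C| + 1)); first by rewrite divr_gt0 // ltr_wpDl.
  move=> s ts; apply: le_lt_trans (H t s) _.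
  apply: (@le_lt_trans _ _ (`|t - s| * (`|C| + 1))).
    by rewrite ler_wpM2l // ler_wpDr // ler_norm.
  by rewrite -ltr_pdivlMr // ltr_wpDl.
move=> d0; case: x => [z|].
- have [d' d'0 Hd'] := chord_nbhs_fin z d0; exists d' => // y /Hd'[w -> zw].
  exists (fun t => finpt (z + t%:C * (w - z))); split.
  + apply: (lip _ (cabs (w - z))) => t s; apply: le_trans (chord_fin_lt _ _) _.
    have -> : z + t%:C * (w - z) - (z + s%:C * (w - z)) = (t - s)%:C * (w - z).
      by rewrite rmorphB; ring.
    by rewrite cabsM cabs_real.
  + by rewrite mul0r addr0.
  + by rewrite mul1r addrC subrK.
  + move=> t /andP[t0 t1]; apply: le_lt_trans (chord_fin_lt _ _) _.
    have -> : z - (z + t%:C * (w - z)) = t%:C * (z - w) by ring.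
    rewrite cabsM cabs_real ger0_norm //; apply: le_lt_trans zw.
    by rewrite -[leRHS]mul1r ler_wpM2r ?cabs_ge0.
- have h1 (b : R[i]) : 1 <= hnorm 1 b by rewrite -cabs1 hnorm_l.
  have hb (b c : R[i]) : half_chord (pt 1 b) (pt 1 c) <= cabs (c - b).
    rewrite half_chord_pt ?(lt_le_trans ltr01) // mul1r mulr1.
    rewrite ler_pdivrMr ?mulr_gt0 ?(lt_le_trans ltr01) //.
    rewrite -[leLHS]mulr1 ler_wpM2l ?cabs_ge0 // -[1]mulr1 ler_pM //.
  have [d' d'0 Hd'] := chord_nbhs_infty d0; exists d' => // y /Hd'[b -> bd].
  exists (fun t => pt 1 (t%:C * b)); split.
  + apply: (lip _ (cabs b)) => t s; apply: le_trans (hb _ _) _.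
    by rewrite -mulrBl -rmorphB cabsM cabs_real distrC.
  + by rewrite mul0r -pt_inf.
  + by rewrite mul1r.
  + move=> t /andP[t0 t1]; rewrite -[None]/(infty : sphere R) pt_inf.
    apply: le_lt_trans (hb _ _) _; rewrite subr0 cabsM cabs_real ger0_norm //.
    by apply: le_lt_trans bd; rewrite -[leRHS]mul1r ler_wpM2r ?cabs_ge0.
Qed.

(* Along a short curve from [x], the image under [f^n] stays close to [f^n x]
   or to its opposite; by connectedness it cannot jump from one to the other. *)
Lemma equicont_of_phi (f ft : sphere R -> sphere R) x : chord_cont f ->
  phi \o f = ft \o phi -> equicont (fwd ft) (phi x) -> equicont (fwd f) x.
Proof.
move=> cf E eq e e0; set s := e / 3; have s0 : 0 < s by rewrite divr_gt0.
have es : e = 3 * s by rewrite /s mulrCA divff ?mulr1.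
have [d d0 Hd] := eq _ (exprn_gt0 2 s0).
have d2 : 0 < d / 2 by rewrite divr_gt0.
have [d' d'0 Hd'] := short_curve x d2; exists d' => // n y.
move=> /Hd'[g [cg g0 g1 gd]]; set b := fwd f n x.
have alt t : 0 <= t <= 1 ->
    half_chord b (fwd f n (g t)) < s \/ half_chord b (sopp (fwd f n (g t))) < s.
  move=> t01; apply: phi_close => //; rewrite !(fwd_semiconj _ _ E); apply: Hd.
  by apply: le_lt_trans (phi_lip _ _) _; rewrite mulrC -ltr_pdivlMr //; exact: gd.
have oo1 : 0 <= (1 : R) <= 1 by rewrite ler01 lexx.
rewrite -g1 es.
(* If b and its opposite are less than 2 s apart, either alternative already gives 3 s. Otherwise
   the distance from b along the curve, starting at 0, cannot pass through s: the second alternative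
   would hold there and bring b within 2 s of its opposite. *)
have [far|close] := leP (2 * s) (half_chord b (sopp b)); last first.
  have [h|h] := alt 1 oo1; first by apply: lt_trans h _; lra.
  have := half_chord_triangle (sopp b) b (fwd f n (g 1)).
  rewrite -[half_chord (sopp b) _]half_chord_sopp soppK; lra.
suff : half_chord b (fwd f n (g 1)) < s by lra.
rewrite ltNge; apply/negP => big.
pose F t := half_chord b (fwd f n (g t)).
have cF : continuous F.
  move=> t; apply/cvgrPdist_lt => r r0.
  have [d1 d10 H1] := @chord_cont_iter R f n.+1 cf (g t) r r0.
  have [d3 d30 H3] := cg t d1 d10.
  exists d3 => //= v tv; apply: le_lt_trans (H1 _ (H3 _ tv)).
  rewrite /F /fwd ler_norml; apply/andP; split.
    have := half_chord_triangle (iter n.+1 f (g t)) b (iter n.+1 f (g v)); lra.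
  have := half_chord_triangle (iter n.+1 f (g v)) b (iter n.+1 f (g t)).
  rewrite (half_chordC (iter n.+1 f (g v)) (iter n.+1 f (g t))); lra.
have [| |t] := @IVT R F 0 1 s ler01.
- exact: continuous_subspaceT.
- by rewrite ge_min le_max /F g0 -/b half_chordxx (ltW s0) big orbT.
rewrite in_itv /= => t01 Ft; have [|h] := alt t t01; first by rewrite -/(F t) Ft ltxx.
have := half_chord_triangle (sopp (fwd f n (g t))) b (sopp b).
rewrite half_chord_sopp half_chordC in far *; rewrite (half_chordC (fwd f n (g t))).
rewrite -/(F t) Ft; move: far; rewrite (half_chordC (sopp b)); lra.
Qed.

Lemma julia_phi (f ft : sphere R -> sphere R) x : chord_cont f -> chord_cont ft ->
  phi \o f = ft \o phi -> julia f x <-> julia ft (phi x).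
Proof.
move=> cf cft E; rewrite -[julia f x]notK -[julia ft _]notK; apply: not_iff_compat.
split.
  move=> /(fatouP x cf)[W [oW Wx] HW]; apply/(fatouP _ cft).
  exists (phi @` W); first by split; [exact: phi_open | exists x].
  by move=> _ [y Wy <-]; apply: equicont_phi E _; exact: HW.
move=> /(fatouP (phi x) cft)[W [oW Wx] HW]; apply/(fatouP _ cf).
exists (phi @^-1` W); first by split=> //; exact: phi_preimage_open.
by move=> y Wy; apply: equicont_of_phi E _ => //; exact: HW.
Qed.

End Phi.

(** * The extended real line lies in every symmetric invariant closed set *)

Section Minimality.
Variable R : realType.
Implicit Types (x y : sphere R) (z w : R[i]) (f g : sphere R -> sphere R).
Implicit Types (S : set (sphere R)).

Lemma upper_half_planeP x :
  upper_half_plane x <-> exists2 z, 0 < Im z & x = finpt z.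
Proof.
split=> [[z /= z0 <-]|[z z0 ->]].
  by exists z => //; rewrite -complexIm ltcR in z0.
by exists z => //=; rewrite -complexIm ltcR.
Qed.

Lemma extended_realsP x :
  extended_reals x <-> x = infty \/ exists t : R, x = finpt t%:C.
Proof.
split=> [[[t _ <-]|->]|[->|[t ->]]]; [right; by exists t|by left|by right|].
by left; exists t.
Qed.

Lemma extended_reals_fin z : extended_reals (finpt z) <-> Im z = 0.
Proof.
rewrite extended_realsP; split=> [[//|[t [->]]]|z0] //.
by right; exists (Re z); rewrite -(real_of_Im0 z0).
Qed.

Lemma odd_half_plane f : odd_map f -> f @` upper_half_plane = upper_half_plane ->
  half_plane_map f.
Proof.
move=> of_ fU.
have HU z : 0 < Im z -> exists2 w, 0 < Im w & f (finpt z) = finpt w.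
  move=> z0; apply/upper_half_planeP; rewrite -fU; exists (finpt z) => //.
  by apply/upper_half_planeP; exists z.
split=> // z z0; have [|w w0 fw] := HU (- z); first by rewrite Im_opp oppr_gt0.
exists (- w); first by rewrite Im_opp oppr_lt0.
by rewrite -[finpt z]soppK of_ /= fw.
Qed.

Lemma half_plane_extended_reals f x : chord_cont f -> odd_map f ->
  half_plane_map f -> extended_reals x <-> extended_reals (f x).
Proof.
move=> cf of_ hf; split=> [/extended_realsP[->|[t ->]]|].
(* Oddness makes the value at infinity its own opposite, hence 0 or infinity. *)
- have := of_ infty; rewrite /=; case: (f infty) => [w|] /=; last first.
    by move=> _; apply/extended_realsP; left.
  move=> [/eqP]; rewrite -addr_eq0 -mulr2n mulrn_eq0 /= => /eqP ->.
  exact/extended_reals_fin.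
- by apply/extended_realsP; exact: half_plane_real.
- case: x => [z|] fx; last by apply/extended_realsP; left.
  apply/extended_reals_fin; have [z0|z0|//] := ltgtP (Im z) 0.
    have [w w0 fw] := hf.2 z z0; move: fx; rewrite fw => /extended_reals_fin.
    by move=> w1; rewrite w1 ltxx in w0.
  have [w w0 fw] := hf.1 z z0; move: fx; rewrite fw => /extended_reals_fin.
  by move=> w1; rewrite w1 ltxx in w0.
Qed.

Lemma half_plane_fwd g n : half_plane_map g -> half_plane_map (fwd g n).
Proof.
move=> [gU gL]; elim: n => [|n [IU IL]]; first by split.
split=> z z0.
  by have [w w0 E] := IU z z0; have [w' w'0 E'] := gU w w0; exists w' => //;
    rewrite /fwd iterS -/(fwd g n _) E.
by have [w w0 E] := IL z z0; have [w' w'0 E'] := gL w w0; exists w' => //;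
  rewrite /fwd iterS -/(fwd g n _) E.
Qed.

Lemma fwd_invariant g S n x : (forall y, S y <-> S (g y)) -> S x <-> S (fwd g n x).
Proof.
move=> inv; elim: n => [|n IH]; first exact: inv.
by rewrite IH /fwd [iter n.+2 _ _]iterS; exact: inv.
Qed.

(** If the missing point is infinity, a large real number replaces it, so that the estimates always
    have a finite centre. *)
Lemma real_disc_outside S x : closed S -> extended_reals x -> ~ S x ->
  exists (u r : R), 0 < r /\ forall w, cabs (u%:C - w) < r -> ~ S (finpt w).
Proof.
move=> cS /extended_realsP xR nSx.
have : nbhs x (~` S) by apply: open_nbhs_nbhs; split => //; exact: closed_openC.
case: xR => [->|[t ->]].
  move=> /infty_nbhsP[r r0 [_ H]]; exists (r + 1), 1; split=> // w wr; apply: H.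
  have := cabs_sub_le (r + 1)%:C w; rewrite cabs_real ger0_norm; last first.
    by rewrite addr_ge0 // ltW.
  lra.
by move=> /finpt_nbhsP[e e0 He]; exists t, e.
Qed.

(* The images of a real interval under all iterates avoid the two real points
   sent to 0 and infinity by w |-> (m w + n) / (k w + l). *)
Lemma fatou_of_omitted_values g (m n k l u r : R) : rational_ge2 g ->
  half_plane_map g -> 0 < m * l - n * k -> 0 < r ->
  (forall j (t a b : R), `|t - u| < r ->
     fwd g j (finpt t%:C) = pt a%:C b%:C -> (a != 0) || (b != 0) ->
     m * a + n * b != 0 /\ k * a + l * b != 0) ->
  ~ julia g (finpt u%:C).
Proof.
move=> rg hg det0 r0 om.
(* C is chosen before the map, so one constant serves all iterates. *)
have [C C0 HC] := half_plane_mobius_lipschitz u det0 r0.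
have r24 : 0 < r / 24 by rewrite divr_gt0.
have lip j z w : cabs (z - u%:C) <= r / 24 -> cabs (w - u%:C) <= r / 24 ->
    half_chord (fwd g j (finpt z)) (fwd g j (finpt w)) <= C * cabs (z - w).
  have [d d2 [p [q [cpq q0 dpq gE]]]] := rational_ge2_fwd j rg.
  have hp := half_plane_fwd j hg; rewrite gE in hp *.
  move=> zu wu; apply: HC => // t tu.
  have cc := ratmap_chord_cont cpq q0.
  rewrite !horner_real_comb.
  have nd := coprimep_horner t%:C cpq.
  (* The value at a real point is real or infinite, so its homogeneous coordinates are a real pair
     times one complex factor, which then drops out of the real combinations. *)
  have real_case : exists (a b : R) (c : R[i]), [/\ c != 0, p.[t%:C] = c * a%:C,
      q.[t%:C] = c * b%:C & (a != 0) || (b != 0)].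
    have := half_plane_real t cc hp; rewrite ratmap_fin /pt.
    case: ifP => [/eqP qt _|/negbT qt [//|[s [sE]]]].
      exists 1, 0, p.[t%:C]; rewrite oner_eq0 mulr1 mulr0; split=> //.
      by move: nd; rewrite qt eqxx orbF.
    exists s, 1, q.[t%:C]; rewrite oner_eq0 orbT mulr1; split=> //.
    by rewrite -sE mulrC divfK.
  have [a [b [c [c0 pE qE ab]]]] := real_case.
  have [h1 h2] : m * a + n * b != 0 /\ k * a + l * b != 0.
    apply: (om j t a b tu _ ab); rewrite gE ratmap_fin pE qE; exact: pt_scale.
  rewrite pE qE.
  have E (s s' : R) : s%:C * (c * a%:C) + s'%:C * (c * b%:C) = c * (s * a + s' * b)%:C.
    by rewrite rmorphD !rmorphM; ring.
  rewrite !E !mulf_eq0 !negb_or c0 /=.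
  have nz (s : R) : s != 0 -> s%:C != 0 :> R[i].
    by rewrite -cabs_eq0 cabs_real normr_eq0.
  by rewrite !nz.
pose W := [set x | exists2 z, x = finpt z & cabs (z - u%:C) < r / 24].
apply: (@normal_of_equicont _ _ _ W).
  split; last by exists u%:C => //; rewrite subrr cabs0.
  apply/sphere_open_chordP => x [z -> zu].
  have [e e0 He] := @chord_nbhs_fin _ z (r / 24 - cabs (z - u%:C)) ltac:(by rewrite subr_gt0).
  exists e => // y /He[w -> zw]; exists w => //.
  have := cabsD (w - z) (z - u%:C).
  have -> : w - z + (z - u%:C) = w - u%:C by ring.
  rewrite (cabsB w z); lra.
move=> x [z -> zu] e e0.
have m0 : 0 < Num.min (r / 24 - cabs (z - u%:C)) (e / C).
  by rewrite lt_min subr_gt0 zu divr_gt0.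
have [d d0 Hd] := chord_nbhs_fin z m0.
exists d => // j y /Hd[w ->]; rewrite lt_min => /andP[zw1 zw2].
have wu : cabs (w - u%:C) <= r / 24.
  have := cabsD (w - z) (z - u%:C).
  have -> : w - z + (z - u%:C) = w - u%:C by ring.
  rewrite (cabsB w z); lra.
apply: le_lt_trans (lip j z w (ltW zu) wu) _.
by rewrite mulrC -ltr_pdivlMr.
Qed.

(** Infinity is at most a simple pole, so a map of degree at least two also has a finite pole, which
    is real. *)
Lemma preimage_infty_not_single g : rational_ge2 g -> half_plane_map g ->
  exists t : R, g (finpt t%:C) = infty.
Proof.
move=> [d d2 [p [q [cpq q0 dpq gE]]]] hg; rewrite gE in hg *.
have [a [b [ps [c [[_ _ _ qz _] [sq sp _]]]]]] := nevanlinna cpq q0 hg.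
case: ps sq sp qz => [|t ps] sq sp qz.
  move: d2; rewrite -dpq /ratdeg sq.
  have : (maxn (size p) 1 <= 2)%N by rewrite geq_max sp.
  by case: (maxn _ _) => [|[|[|]]].
by exists t; rewrite ratmap_fin /pt qz /= mem_head.
Qed.

(** The map -1/g preserves the half planes too, and its poles are the zeros of g, hence real and
    simple. If none of them is nonzero, the numerator of g has degree at most one; the denominator
    then has degree two, and g vanishes at infinity. *)
Lemma preimage_zero_not_single g : rational_ge2 g -> half_plane_map g ->
  g infty = finpt 0 \/ exists2 t : R, t != 0 & g (finpt t%:C) = finpt 0.
Proof.
move=> [d d2 [p [q [cpq q0 dpq gE]]]] hg; rewrite gE in hg *.
have p0 : p != 0.
  apply: contraTneq d2 => p0; move: cpq; rewrite -dpq p0 coprime0p -size_poly_eq1.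
  by rewrite /ratdeg size_poly0 => /eqP ->.
have cqp : coprimep (- q) p by rewrite -scaleN1r coprimepZl ?oppr_eq0 ?oner_eq0 // coprimep_sym.
have hq : half_plane_map (ratmap (- q) p).
  split=> z z0.
    have [qz wz] := half_plane_upper hg z0.
    have pz : p.[z] != 0 by apply: contraTneq wz => ->; rewrite mul0r ltxx.
    exists (- q.[z] / p.[z]); last by rewrite ratmap_fin /pt (negPf pz) hornerN.
    have -> : - q.[z] / p.[z] = - (p.[z] / q.[z])^-1 by rewrite invf_div mulNr.
    rewrite Im_opp Im_inv mulNr opprK divr_gt0 // exprn_gt0 // cabs_gt0.
    by rewrite mulf_neq0 ?invr_eq0.
  have [qz wz] := half_plane_lower hg z0.
  have pz : p.[z] != 0 by apply: contraTneq wz => ->; rewrite mul0r ltxx.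
  exists (- q.[z] / p.[z]); last by rewrite ratmap_fin /pt (negPf pz) hornerN.
  have -> : - q.[z] / p.[z] = - (p.[z] / q.[z])^-1 by rewrite invf_div mulNr.
  rewrite Im_opp Im_inv mulNr opprK pmulr_llt0 // invr_gt0 exprn_gt0 // cabs_gt0.
  by rewrite mulf_neq0 ?invr_eq0.
have [a [b [ps [c [[_ ups _ pz _] [sp sq _]]]]]] := nevanlinna cqp p0 hq.
rewrite size_polyN in sq.
have root0 t : t \in ps -> ratmap p q (finpt t%:C) = finpt 0.
  move=> tps; have pt0 : p.[t%:C] = 0 by apply/eqP; rewrite pz map_f.
  have := coprimep_horner t%:C cpq; rewrite pt0 eqxx /= => qt.
  by rewrite /= (negPf qt) pt0 mul0r.
have [[t tps t0]|none] := pselect (exists2 t, t \in ps & t != 0).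
  by right; exists t => //; exact: root0.
left.
have sps : (size ps <= 1)%N.
  case: (ps) ups none => [//|t [//|s l]] /= /andP[]; rewrite inE negb_or => /andP[ts _] _ none.
  have t0 : t = 0 by apply/eqP/negPn/negP => h; apply: none; exists t; rewrite ?mem_head.
  have s0 : s = 0.
    by apply/eqP/negPn/negP => h; apply: none; exists s; rewrite ?inE ?eqxx ?orbT.
  by move: ts; rewrite t0 s0 eqxx.
have sp2 : (size p <= 2)%N by rewrite sp.
have sq3 : (size q <= 3)%N by rewrite (leq_trans sq).
have szq : size q = 3.
  apply/eqP; rewrite eqn_leq sq3 /=; move: d2; rewrite -dpq /ratdeg => d2.
  rewrite ltnNge; apply/negP => sq2; move: d2.
  have : (maxn (size p) (size q) <= 2)%N by rewrite geq_max sp2.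
  by case: (maxn _ _) => [|[|[|]]].
have dn : ratdeg p q = 2%N.
  by rewrite /ratdeg szq; have /maxn_idPr -> : (size p <= 3)%N by rewrite (leq_trans sp2).
rewrite /= dn.
have -> : p`_2 = 0 by rewrite nth_default.
have q2 : q`_2 != 0.
  by have := lead_coef_eq0 q; rewrite lead_coefE szq /= (negPf q0) => ->.
by rewrite (negPf q2) mul0r.
Qed.

Lemma Im_continuous : continuous (fun z : (R[i])^o => Im z).
Proof.
move=> z V /nbhs_ballP[e /= e0 He].
apply/nbhs_cabsP; exists e => // w zw; apply: He; apply: le_lt_trans zw.
by rewrite /ball_ /= -Im_opp -Im_add; exact: Im_le_cabs.
Qed.

Lemma upper_part_compact S : closed S -> (forall x, S x -> ~ extended_reals x) ->
  compact [set z : (R[i])^o | S (finpt z) /\ 0 < Im z].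
Proof.
move=> cS nR.
have noo : ~ S infty by move=> /nR; apply; apply/extended_realsP; left.
have : nbhs (infty : sphere R) (~` S).
  by apply: open_nbhs_nbhs; split => //; exact: closed_openC.
move=> /infty_nbhsP[r r0 [_ Hr]].
apply: (subclosed_compact _ (@square_compact R r)).
  (* As S has no real point, the strict inequality may be replaced by the weak one, which is a
     closed condition. *)
  have -> : [set z : (R[i])^o | S (finpt z) /\ 0 < Im z] =
     ((Some : (R[i])^o -> sphere R) @^-1` S) `&`
       ((fun z : (R[i])^o => Im z) @^-1` [set t | 0 <= t]).
    apply/seteqP; split=> z [Sz z0]; split=> //=; first exact: ltW.
    rewrite lt_neqAle z0 andbT eq_sym; apply/negP => /eqP z1.
    by apply: (nR _ Sz); exact/extended_reals_fin.
  apply: closedI.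
    apply: preimage_closed => // z _; exact: one_point_compactification_some_continuous.
  by apply: preimage_closed; [move=> z _; exact: Im_continuous | exact: closed_ge].
move=> z [Sz _]; exists (Re z, Im z); last by case: (z).
have zr : cabs z <= r by rewrite leNgt; apply/negP => /Hr.
by split; rewrite /= in_itv /= -ler_norml; apply: le_trans zr;
  rewrite ?Re_le_cabs ?Im_le_cabs.
Qed.

(* By Schwarz-Pick a pair of points of [A] at maximal hyperbolic distance would
   be the image of a pair at larger distance. *)
Lemma no_compact_invariant g (A : set (R[i])^o) : rational_ge2 g ->
  half_plane_map g -> compact A -> (forall z, A z -> 0 < Im z) ->
  (forall z, A z -> exists2 w, A w & g (finpt w) = finpt z) ->
  forall z w, A z -> A w -> z = w.
Proof.
move=> [d d2 [p [q [cpq q0 dpq gE]]]] hg cA A0 pre; rewrite gE in hg pre.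
rewrite -dpq in d2.
(* Four times the squared sinh of half the hyperbolic distance. *)
pose F (t : (R[i])^o * (R[i])^o) : R :=
  cabs (t.1 - t.2) ^+ 2 / (Im t.1 * Im t.2).
have cF t : (A `*` A) t -> {for t, continuous F}.
  case: t => z w [/= /A0 z0 /A0 w0].
  apply: cvgM.
    have cc : (fun t : (R[i])^o * (R[i])^o => cabs (t.1 - t.2)) @ (z, w) --> cabs (z - w).
      have sub : (fun t : (R[i])^o * (R[i])^o => t.1 - t.2 : (R[i])^o) @ (z, w) -->
          (z - w : (R[i])^o).
        by apply: cvgB; [exact: cvg_fst | exact: cvg_snd].
      exact: (cvg_comp _ _ sub (@cabs_continuous R (z - w))).
    by rewrite /=; apply: cvgM.
  apply: cvgV; first by rewrite /= mulf_neq0 // gt_eqF.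
  apply: cvgM.
    exact: (cvg_comp _ _ (@cvg_fst _ _ (nbhs (z : (R[i])^o)) (nbhs (w : (R[i])^o)) _) (@Im_continuous z)).
  exact: (cvg_comp _ _ (@cvg_snd _ _ (nbhs (z : (R[i])^o)) (nbhs (w : (R[i])^o)) _) (@Im_continuous w)).
move=> z1 z2 A1 A2; apply: contrapT => z12.
have [| | |[z w]] := @compact_EVT_max _ R F (A `*` A).
- by exists (z1, z2).
- exact: compact_setX.
- by apply: continuous_in_subspaceT => t; rewrite inE; exact: cF.
rewrite inE => -[/= Az Aw] maxF.
have F12 : 0 < F (z1, z2).
  rewrite /F /=; apply: divr_gt0; last by apply: mulr_gt0; exact: A0.
  by rewrite exprn_gt0 // cabs_gt0 subr_eq0; apply/eqP.
have [z' Az' zE] := pre z Az; have [w' Aw' wE] := pre w Aw.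
have := maxF (z', w'); rewrite inE => /(_ (conj Az' Aw')); apply/negP; rewrite -ltNge.
(* Equal preimages would give z = w and a maximum 0, against F (z1, z2) > 0. *)
have [zw'|zw'] := eqVneq z' w'.
  have zw : z = w by move: zE wE; rewrite zw' => -> [].
  have := maxF (z1, z2); rewrite inE => /(_ (conj A1 A2)).
  by rewrite {2}/F /= zw subrr cabs0 expr0n mul0r leNgt F12.
have := half_plane_contracts cpq q0 hg d2 (A0 _ Az') (A0 _ Aw') zw'.
rewrite (ratmap_finE zE).2 (ratmap_finE wE).2 => H.
rewrite /F /= ltr_pdivrMr; last by apply: mulr_gt0; exact: A0.
rewrite mulrAC ltr_pdivlMr //; apply: mulr_gt0; exact: A0.
Qed.

Lemma julia_minimal g S : odd_map g -> rational_ge2 g ->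
  g @` upper_half_plane = upper_half_plane -> julia g = extended_reals ->
  closed S -> (forall x, S x -> S (sopp x)) -> (forall x, S x <-> S (g x)) ->
  (exists x y, [/\ S x, S y & phi x <> phi y]) -> extended_reals `<=` S.
Proof.
move=> og rg gU jg cS symS inv [x1 [x2 [S1 S2 x12]]] x xR.
apply: contrapT => nSx.
have hg := odd_half_plane og gU.
have cg := rational_ge2_chord_cont rg.
have [u [r [r0 out]]] := real_disc_outside cS xR nSx.
have Ju : julia g (finpt u%:C).
  by rewrite jg; apply/extended_reals_fin.
have outj j (t : R) : `|t - u| < r -> ~ S (fwd g j (finpt t%:C)).
  move=> tu /(fwd_invariant j (finpt t%:C) inv); apply: out.
  by rewrite -rmorphB cabs_real distrC.
have no0oo : ~ (S (finpt 0) /\ S infty).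
  move=> [S0 Soo].
  apply: (@fatou_of_omitted_values g 1 0 0 1 u r rg hg) Ju => //.
  move=> j t a b tu E ab; rewrite !mul1r !mul0r addr0 add0r.
  have := outj j t tu; rewrite E; split.
    apply/negP => /eqP a0; apply: H; move: ab; rewrite a0 eqxx /= => b0.
    rewrite /pt; case: ifP => [/eqP /complexI b1|_]; first by rewrite b1 eqxx in b0.
    by rewrite mul0r.
  by apply/negP => /eqP b0; apply: H; rewrite b0 /pt eqxx.
(* Symmetry puts both s and -s in S; they are sent to infinity and 0 by w |-> (w + s) / (s - w),
   whose determinant 2 s is positive once s is. *)
have noreal (s : R) : s != 0 -> ~ S (finpt s%:C).
  wlog s0 : s / 0 < s => [wl|_ Ss].
    move=> s0; have [sp|sn|s1] := ltgtP 0 s; first exact: wl.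
      move=> /symS /=; rewrite -rmorphN; apply: (wl (- s)); rewrite ?oppr_eq0 ?oppr_gt0 //.
    by rewrite -s1 eqxx in s0.
  apply: (@fatou_of_omitted_values g 1 s (-1) s u r rg hg) Ju => //.
    by rewrite mul1r mulrN1 opprK addr_gt0.
  move=> j t a b tu E ab; have := outj j t tu; rewrite E => nS; split.
    apply/negP => /eqP h; apply: nS.
    have ae : a = - s * b by move: h; lra.
    have b0 : b != 0.
      by apply: contraTneq ab => b0; rewrite ae b0 mulr0 eqxx.
    rewrite /pt; case: ifP => [/eqP /complexI b1|_]; first by rewrite b1 eqxx in b0.
    rewrite ae -fmorphV -rmorphM mulfK // rmorphN.
    by have := symS _ Ss.
  apply/negP => /eqP h; apply: nS.
  have ae : a = s * b by move: h; lra.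
  have b0 : b != 0.
    by apply: contraTneq ab => b0; rewrite ae b0 mulr0 eqxx.
  rewrite /pt; case: ifP => [/eqP /complexI b1|_]; first by rewrite b1 eqxx in b0.
  by rewrite ae -fmorphV -rmorphM mulfK.
have noo : ~ S infty.
  move=> Soo; have [t gt] := preimage_infty_not_single rg hg.
  have St : S (finpt t%:C) by apply/inv; rewrite gt.
  have [t0|t0] := eqVneq t 0; last exact: noreal St.
  by apply: no0oo; split=> //; rewrite t0 in St.
have no0 : ~ S (finpt 0).
  move=> S0; have [gt|[t t0 gt]] := preimage_zero_not_single rg hg.
    by apply: noo; apply/inv; rewrite gt.
  by apply: (noreal t t0); apply/inv; rewrite gt.
have nR y : S y -> ~ extended_reals y.
  move=> Sy /extended_realsP[yE|[t yE]]; rewrite yE in Sy; first exact: noo.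
  have [t0|t0] := eqVneq t 0; last exact: noreal Sy.
  by rewrite t0 in Sy.
(* Replacing a point by its opposite keeps its image under phi, so the two given points remain
   distinct when moved to the upper half plane. *)
have up y : S y -> exists z, [/\ S (finpt z), 0 < Im z & phi (finpt z) = phi y].
  case: y => [z|] Sz; last by case: noo.
  have [z0|z0|z0] := ltgtP (Im z) 0.
  - exists (- z); split; [exact: (symS _ Sz)|by rewrite Im_opp oppr_gt0|].
    exact: (phi_sopp (finpt z)).
  - by exists z.
  - by case: (nR _ Sz); apply/extended_reals_fin.
have [z1 [Sz1 z10 E1]] := up _ S1; have [z2 [Sz2 z20 E2]] := up _ S2.
have cA := upper_part_compact cS nR.
apply: x12; rewrite -E1 -E2.
suff -> : z1 = z2 by [].
apply: (no_compact_invariant rg hg cA _ _ (conj Sz1 z10) (conj Sz2 z20)).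
  by move=> z [].
move=> z [Sz z0].
have : upper_half_plane (finpt z) by apply/upper_half_planeP; exists z.
rewrite -gU => -[y /upper_half_planeP[w w0 ->] gw].
by exists w => //; split=> //; apply/inv; rewrite gw.
Qed.

End Minimality.

(** * Descent of odd maps through phi, and the invariant set of the semigroup *)

Section Descent.
Variable R : realType.
Implicit Types (x y : sphere R) (a b c d z w : R[i]) (p q : {poly R[i]}).
Implicit Types (f g : sphere R -> sphere R).

Lemma pt_cross a b c d : 0 < hnorm a b -> 0 < hnorm c d ->
  pt a b = pt c d <-> a * d = b * c.
Proof.
move=> h k; split=> E.
  have := half_chordxx (pt a b); rewrite {2}E half_chord_pt // => /eqP.
  rewrite mulf_eq0 invr_eq0 mulf_eq0 !(gt_eqF h) !(gt_eqF k) !orbF cabs_eq0.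
  by rewrite subr_eq0 => /eqP.
by apply: half_chord_eq0; rewrite half_chord_pt // E subrr cabs0 mul0r.
Qed.

(** p(z) p(-z) is even; its polynomial in z^2 is built from the squares of the roots, since (z -
    r)(-z - r) = -(z^2 - r^2). The last clause holds for every n from the degree on and serves to
    compute values at infinity. *)
Lemma even_product p : exists N : {poly R[i]},
  [/\ size N = size p, forall z, N.[z ^+ 2] = p.[z] * p.[- z] &
      forall n, (size p <= n.+1)%N -> N`_n = (-1) ^+ n * p`_n ^+ 2].
Proof.
have [->|p0] := eqVneq p 0.
  exists 0; split=> // [z|n _]; first by rewrite !horner0 mul0r.
  by rewrite !coef0 expr0n mulr0.
have [rs] := closed_field_poly_normal p; set k := lead_coef p => pE.
have k0 : k != 0 by rewrite lead_coef_eq0.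
have sp : size p = (size rs).+1 by rewrite pE size_scale // size_prod_XsubC.
pose N := (k ^+ 2 * (-1) ^+ size rs) *: \prod_(r <- rs) ('X - (r ^+ 2)%:P).
have c0 : k ^+ 2 * (-1) ^+ size rs != 0.
  by rewrite mulf_neq0 ?expf_neq0 // oppr_eq0 oner_eq0.
have sN : size N = (size rs).+1 by rewrite size_scale // size_prod_XsubC.
exists N; split; first by rewrite sN sp.
  move=> z; rewrite /N pE !hornerZ !horner_prod.
  rewrite mulrACA -expr2 -big_split /= -mulrA; congr (_ * _).
  elim: (rs) => [|r l IH]; first by rewrite !big_nil expr0 mulr1.
  rewrite !big_cons -IH /= exprS !hornerXsubC; ring.
move=> n; rewrite leq_eqVlt => /orP[/eqP spn|lt]; last first.
  rewrite !nth_default ?expr0n ?mulr0 //; first by rewrite sN -sp.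
have nE : n = size rs by apply: succn_inj; rewrite -spn sp.
have -> : p`_n = k by rewrite /k lead_coefE spn.
have -> : N`_n = lead_coef N by rewrite lead_coefE sN nE.
rewrite lead_coefZ.
have /monicP -> := monic_prod_XsubC rs xpredT (fun r => r ^+ 2).
by rewrite mulr1 nE mulrC.
Qed.

Definition sqmap : sphere R -> sphere R := ratmap (quad 1 0 0) (quad 0 0 1).

Lemma sqmap_pt a b : 0 < hnorm a b -> sqmap (pt a b) = pt (a ^+ 2) (b ^+ 2).
Proof.
move=> ab; rewrite /sqmap; have [||_ ->] // := @quad_ratmap R 1 0 0 0 0 1.
- move=> c d; rewrite !mul0r !addr0 !mul1r !add0r => /eqP e1 /eqP e2.
  by move: e1 e2; rewrite !sqrf_eq0 => /eqP -> /eqP ->.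
- by apply: quad_neq0; rewrite oner_eq0 orbT.
by congr pt; ring.
Qed.

(* The map F with F(z^2) = f(z)^2; oddness gives f(z)^2 = - f(z) f(-z), whose
   numerator and denominator are visibly even. *)
Lemma odd_square_descent (d : nat) f : (0 < d)%N -> odd_map f -> rational_of_degree d f ->
  exists2 F, rational_of_degree d F & forall x, sqmap (f x) = F (sqmap x).
Proof.
move=> d0 of_ [p [q [cpq q0 dpq fE]]]; rewrite fE in of_ *.
have [P [sP PE Pn]] := even_product p; have [Q [sQ QE Qn]] := even_product q.
have nd z := coprimep_horner z cpq.
have rel z : p.[z] * q.[- z] = - (p.[- z] * q.[z]).
  have := of_ (finpt z); rewrite /= -[if _ then _ else _]/(pt p.[- z] q.[- z]).
  rewrite -[if _ then _ else _]/(pt p.[z] q.[z]) sopp_pt.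
  move=> /(pt_cross _ _).1 H; rewrite H ?hnorm_opp ?hnorm_gt0 ?nd //.
  by rewrite mulrN opprK mulrC.
(* If both products vanish, then by [rel] p and q have a common zero at -z. *)
have ndPQ z : 0 < hnorm (- (p.[z] * p.[- z])) (q.[z] * q.[- z]).
  rewrite hnorm_gt0 oppr_eq0 !mulf_eq0 -negb_and; apply/negP => /andP[h1 h2].
  have := nd z; have := nd (- z); have := rel z.
  have [pz|pz] := eqVneq p.[z] 0.
    rewrite pz mul0r => /esym/eqP; rewrite oppr_eq0 mulf_eq0.
    move: h2; case: (eqVneq q.[z] 0) => //= qz; rewrite orbF => /eqP -> /eqP ->.
    by rewrite eqxx.
  move: h1; rewrite (negPf pz) /= => /eqP ->; rewrite mul0r oppr0 eqxx => /eqP.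
  by rewrite mulf_eq0 (negPf pz) /= => ->.
have cPQ : coprimep (- P) Q.
  apply: Pdiv.ClosedField.root_coprimep => w /eqP Pw; apply/negP => /eqP Qw.
  have := ndPQ (sqrtc w); rewrite -PE -QE sqr_sqrtc hnorm_gt0 -hornerN Pw Qw.
  by rewrite !eqxx.
have Q0 : Q != 0 by rewrite -size_poly_gt0 sQ size_poly_gt0.
have dPQ : ratdeg (- P) Q = d by rewrite /ratdeg size_polyN sP sQ -dpq.
exists (ratmap (- P) Q); first by exists (- P), Q.
case=> [z|].
- rewrite -[Some z]/(finpt z) ratmap_fin sqmap_pt ?hnorm_gt0 ?nd //.
  rewrite pt_fin sqmap_pt; last by rewrite hnorm_gt0 oner_eq0 orbT.
  rewrite expr1n -pt_fin ratmap_fin hornerN PE QE.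
  apply/pt_cross; rewrite ?ndPQ // ?hnorm_gt0 ?sqrf_eq0 ?nd //.
  have -> : p.[z] ^+ 2 * (q.[z] * q.[- z]) = p.[z] * q.[z] * (p.[z] * q.[- z]) by ring.
  by rewrite rel; ring.
- have E0 : sqmap infty = infty.
    by rewrite {1}pt_inf sqmap_pt ?hnorm_gt0 ?oner_eq0 // expr1n expr0n -pt_inf.
  rewrite -[None]/(infty : sphere R) E0.
  have sp : (size p <= d.+1)%N by rewrite -dpq size_ratdeg_l.
  have sq : (size q <= d.+1)%N by rewrite -dpq size_ratdeg_r.
  have ndn := coef_ratdeg p q0; rewrite dpq in ndn.
  have E1 : ratmap p q infty = pt p`_d q`_d by rewrite /= dpq.
  have E2 : ratmap (- P) Q infty = pt (- P`_d) Q`_d by rewrite /= dPQ coefN.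
  (* An odd map sends infinity to 0 or infinity, so one of the two top coefficients vanishes; this
     disposes of the signs in the top coefficients of P and Q. *)
  have pq0 : p`_d * q`_d = 0.
    have := of_ infty; rewrite -[sopp infty]/(infty : sphere R) E1 sopp_pt.
    move=> /(pt_cross _ _).1 H; have {H} := H _ _.
    rewrite hnorm_opp hnorm_gt0 ndn => /(_ isT isT) /eqP.
    rewrite mulrN [q`_d * _]mulrC -addr_eq0 -mulr2n mulrn_eq0 /=.
    by move/eqP.
  rewrite E1 E2 sqmap_pt ?hnorm_gt0 ?ndn // Pn // Qn //.
  apply/pt_cross.
  + by rewrite hnorm_gt0 !sqrf_eq0.
  + by rewrite hnorm_gt0 oppr_eq0 !mulf_eq0 !signr_eq0 /= !orbb.
  + have -> : p`_d ^+ 2 * ((-1) ^+ d * q`_d ^+ 2) = (-1) ^+ d * (p`_d * q`_d) ^+ 2 by ring.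
    have -> : q`_d ^+ 2 * - ((-1) ^+ d * p`_d ^+ 2) = - ((-1) ^+ d * (p`_d * q`_d) ^+ 2) by ring.
    by rewrite pq0 expr0n !mulr0 oppr0.
Qed.

(** phi is z |-> z^2 followed by M(z) = (z - 1) / (z + 1); with I the inverse of M, the conjugate of
    F by M does the job and has the degree of f. *)
Lemma odd_phi_descent f : odd_map f -> rational_ge2 f ->
  exists2 ft, rational_ge2 ft & phi \o f = ft \o phi.
Proof.
move=> of_ [d d2 rf]; have d0 : (0 < d)%N by apply: leq_trans d2.
have [F rF FE] := odd_square_descent d0 of_ rf.
have two : (1 + 1 : R[i]) != 0 by rewrite -[1 + 1]/(2%:R) pnatr_eq0.
have [|rM ME] := @lin_ratmap R 1 (-1) 1 1; first by rewrite !mulr1 opprK.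
have [|rI IE] := @lin_ratmap R 1 1 (-1) 1; first by rewrite !mulr1 mulrN1 opprK.
set M := ratmap _ _ in rM ME; set I := ratmap _ _ in rI IE.
have phiE x : phi x = M (sqmap x).
  have [a [b [ab ->]]] := ptP x; rewrite (phi_spec R).2 // sqmap_pt // ME.
    by congr pt; ring.
  by rewrite hnorm_gt0 !sqrf_eq0 -hnorm_gt0.
have MK x : I (M x) = x.
  have [a [b [ab ->]]] := ptP x; rewrite ME // IE.
    rewrite -[RHS](pt_scale a b two); congr pt; ring.
  rewrite hnorm_gt0 -negb_and; apply/negP => /andP[/eqP e1 /eqP e2].
  have a0 : (1 + 1) * a = (1 * a + -1 * b) + (1 * a + 1 * b) by ring.
  have b0 : (1 + 1) * b = (1 * a + 1 * b) - (1 * a + -1 * b) by ring.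
  move/eqP: a0; move/eqP: b0; rewrite e1 e2 addr0 subr0 !mulf_eq0 !(negPf two) /=.
  by move=> /eqP b0 /eqP a0; move: ab; rewrite hnorm_gt0 a0 b0 eqxx.
exists (M \o (F \o I)).
  exists d => //; rewrite -[d]mul1n; apply: rational_comp => //.
  by rewrite -[d]muln1; exact: rational_comp.
by apply/funext => x; rewrite /= !phiE MK FE.
Qed.

(** For t in [-1, 1), phi(z) = t amounts to z^2 = (1 + t) / (1 - t) >= 0, so z is real; the value t
    = 1 is taken only at infinity. *)
Lemma phi_segment x : segment (phi x) <-> extended_reals x.
Proof.
rewrite extended_realsP; split.
  case: x => [z|]; last by left.
  move=> [t /andP[t1 t2]]; rewrite -[Some z]/(finpt z) => E; right.
  move: E; rewrite [finpt z]pt_fin (phi_spec R).2 ?hnorm_gt0 ?oner_eq0 ?orbT // expr1n /pt oner_eq0.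
  case: ifP => // /negbT z1 [E].
  have zE : t%:C * (z ^+ 2 + 1) = z ^+ 2 - 1 by rewrite E divfK.
  have [z0|z0] := eqVneq (Im z) 0; first by exists (Re z); rewrite -(real_of_Im0 z0) divr1.
  exfalso; have := congr1 (@complex.Im R) zE; have := congr1 (@complex.Re R) zE.
  case: z z0 {E zE z1} => a b /= b0; rewrite !mul0r !subr0 !addr0 ?subr0.
  move=> e1 e2; have tn1 : t != 1 by apply/eqP => t1'; move: e1; rewrite t1'; lra.
  have ab : a * b = 0.
    have : (t - 1) * (a * b) = 0 by move: e2; lra.
    by move/eqP; rewrite mulf_eq0 subr_eq0 (negPf tn1) /= => /eqP.
  have a0 : a = 0 by move/eqP: ab; rewrite mulf_eq0 (negPf b0) orbF => /eqP.
  have b2 : 0 < b * b by rewrite -expr2 exprn_even_gt0.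
  have tb : (1 - t) * (b * b) = - (1 + t) by move: e1; rewrite a0; lra.
  have : 0 < (1 - t) * (b * b) by rewrite mulr_gt0 // subr_gt0 lt_neqAle tn1.
  by rewrite tb; lra.
case=> [->|[t ->]].
  rewrite pt_inf (phi_spec R).2 ?hnorm_gt0 ?oner_eq0 // expr0n subr0 addr0 expr1n.
  by exists 1; [rewrite /= lexx andbT; lra | rewrite pt_fin].
rewrite pt_fin (phi_spec R).2 ?hnorm_gt0 ?oner_eq0 ?orbT // expr1n.
have t1 : 0 < t ^+ 2 + 1 by rewrite ltr_wpDl ?sqr_ge0.
exists ((t ^+ 2 - 1) / (t ^+ 2 + 1)).
  have t2 := sqr_ge0 t.
  by rewrite /= ler_pdivlMr // ler_pdivrMr //; apply/andP; split; lra.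
have nz : t%:C ^+ 2 + 1 != 0 :> R[i].
  by rewrite -rmorphXn -(rmorph1 (real_complex R)) -rmorphD -cabs_eq0 cabs_real normr_eq0 gt_eqF.
rewrite /pt (negPf nz); congr finpt.
by rewrite rmorphM fmorphV rmorphB rmorphD rmorph1 rmorphXn.
Qed.

Lemma extended_reals_closed : closed (@extended_reals R).
Proof.
rewrite -[X in closed X]setCK; apply: open_closedC.
apply/sphere_open_chordP => x xR.
have [z xE] : exists z, x = finpt z.
  by case: x xR => [z|] xR; [exists z | case: xR; apply/extended_realsP; left].
rewrite xE in xR *.
have z0 : Im z != 0 by apply/eqP => z0; apply: xR; exact/extended_reals_fin.
have [e e0 He] := @chord_nbhs_fin R z `|Im z| ltac:(by rewrite normr_gt0).
exists e => // y /He[w -> zw] /extended_reals_fin w0.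
have := Im_le_cabs (z - w); rewrite Im_add Im_opp w0 subr0.
by rewrite leNgt zw.
Qed.

Lemma phi_image_reals : phi @` extended_reals = @segment R.
Proof.
apply/seteqP; split=> [_ [x xR <-]|y]; first exact/phi_segment.
by have [x ->] := phi_surj y; move=> /phi_segment xR; exists x.
Qed.

(** Its complement is the image, under the open map phi, of the complement of the extended real
    line. *)
Lemma segment_closed : closed (@segment R).
Proof.
rewrite -[X in closed X]setCK; apply: open_closedC.
have -> : ~` @segment R = phi @` (~` @extended_reals R).
  apply/seteqP; split=> [y|_ [x xR <-] /phi_segment //].
  by have [x ->] := phi_surj y => ny; exists x => // xR; apply: ny; exact/phi_segment.
by apply: phi_open; apply: closed_openC; exact: extended_reals_closed.
Qed.

Lemma segment_three_points : has_three_points (@segment R).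
Proof.
have inj (s t : R) : s != t -> finpt s%:C <> finpt t%:C.
  by move=> st [E]; rewrite E eqxx in st.
exists (finpt (-1)%:C), (finpt 0%:C), (finpt 1%:C); split; split.
- by exists (-1); rewrite //= lexx; lra.
- by exists 0; rewrite //=; lra.
- by exists 1; rewrite //=; lra.
- by apply: inj; rewrite oppr_eq0 oner_eq0.
- by apply: inj; rewrite eq_sym oner_eq0.
- by apply: inj; rewrite lt_eqF //; lra.
Qed.

Lemma semigroup_gen_closed (A : set (sphere R -> sphere R)) :
  comp_closed (semigroup_gen A).
Proof. by move=> g h Gg Gh M [cM AM]; apply: (cM); [exact: Gg | exact: Gh]. Qed.

Lemma semigroup_gen_ind (A M : set (sphere R -> sphere R)) :
  comp_closed M -> A `<=` M -> semigroup_gen A `<=` M.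
Proof. by move=> cM AM g; apply. Qed.

Lemma semigroup_gen_sub (A : set (sphere R -> sphere R)) : A `<=` semigroup_gen A.
Proof. by move=> g Ag M [_]; apply. Qed.

Lemma rational_semigroup_gen (ft gt : sphere R -> sphere R) : rational_ge2 ft ->
  rational_ge2 gt -> rational_semigroup (semigroup_gen [set ft; gt]).
Proof.
move=> rf rg; split; first exact: semigroup_gen_closed.
apply: semigroup_gen_ind => [g h|g [->|->]] //; exact: rational_ge2_comp.
Qed.

Lemma segment_completely_invariant f ft : odd_map f -> rational_ge2 f ->
  f @` upper_half_plane = upper_half_plane -> phi \o f = ft \o phi ->
  completely_invariant ft segment.
Proof.
move=> of_ rf fU E; have E1 x : phi (f x) = ft (phi x) by move: (congr1 (@^~ x) E).
have inv := half_plane_extended_reals _ (rational_ge2_chord_cont rf) of_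
  (odd_half_plane of_ fU).
split=> [_ [y + <-]|y].
  have [x ->] := phi_surj y; rewrite -E1 => /phi_segment xR.
  by apply/phi_segment; exact: (inv x).1 xR.
rewrite /preimage /=; have [x ->] := phi_surj y; rewrite -E1 => /phi_segment xR.
by apply/phi_segment; exact: (inv x).2 xR.
Qed.

Lemma julia_segment f ft : rational_ge2 f -> rational_ge2 ft ->
  phi \o f = ft \o phi -> julia f = extended_reals <-> julia ft = segment.
Proof.
move=> rf rft E.
have H x := julia_phi x (rational_ge2_chord_cont rf) (rational_ge2_chord_cont rft) E.
split=> J; apply/seteqP; split=> y.
- by have [x ->] := phi_surj y => /H; rewrite J => xR; exact/phi_segment.
- by have [x ->] := phi_surj y => /phi_segment; rewrite -J => /H.
- by move=> /H; rewrite J => /phi_segment.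
- by move=> /phi_segment; rewrite -J => /H.
Qed.

Lemma semiconjugate_semigroup f g ft gt : odd_map f -> odd_map g ->
  rational_ge2 f -> rational_ge2 g -> rational_ge2 ft -> rational_ge2 gt ->
  f @` upper_half_plane = upper_half_plane ->
  g @` upper_half_plane = upper_half_plane ->
  julia f <> extended_reals -> julia g = extended_reals ->
  phi \o f = ft \o phi -> phi \o g = gt \o phi ->
  [/\ julia ft <> segment, julia gt = segment, julia ft <> julia gt &
      E_julia (semigroup_gen [set ft; gt]) = segment].
Proof.
move=> of_ og rf rg rft rgt fU gU Jf Jg Ef Eg.
have Jft : julia ft <> segment by move=> /(julia_segment rf rft Ef).
have Jgt : julia gt = segment by apply/(julia_segment rg rgt Eg).
split=> //; first by rewrite Jgt.
apply/seteqP; split.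
  move=> y; apply; split; [exact: segment_closed|exact: segment_three_points|].
  apply: semigroup_gen_ind => [h k [h1 h2] [k1 k2]|h [->|->]].
  - split=> [_ [x Sx <-]|x /= Sx].
      by apply: h1; exists (k x) => //; apply: k1; exists x.
    by apply: k2; apply: h2.
  - exact: segment_completely_invariant Ef.
  - exact: segment_completely_invariant Eg.
move=> y ysg S [cS [s1 [s2 [s3 [[S1 S2 _] [s12 _ _]]]]] inv].
have [i1 i2] : completely_invariant gt S.
  by apply: inv; apply: semigroup_gen_sub; right.
have E1 x : phi (g x) = gt (phi x) by move: (congr1 (@^~ x) Eg).
rewrite -phi_image_reals in ysg; case: ysg => x xR <-.
apply: (@julia_minimal R g (phi @^-1` S)) xR => //.
- rewrite -[X in closed X]setCK; apply: open_closedC.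
  have -> : ~` (phi @^-1` S) = phi @^-1` (~` S) by [].
  by apply: phi_preimage_open; exact: closed_openC.
- by move=> z; rewrite /= phi_sopp.
- move=> z /=; rewrite E1; split=> [Sz|]; [by apply: i1; exists (phi z)|exact: i2].
- have [x1 e1] := phi_surj s1; have [x2 e2] := phi_surj s2.
  by exists x1, x2; rewrite /= -e1 -e2.
Qed.

End Descent.

(** * The explicit pair of maps and their Julia sets *)

Section Examples.
Variable R : realType.
Implicit Types (x y : sphere R) (a b z w : R[i]).

Lemma two_neq0 : (2 : R[i]) != 0. Proof. by rewrite pnatr_eq0. Qed.

Lemma ex_f_spec : rational_of_degree 2 (ex_f R) /\
  forall a b, 0 < hnorm a b -> ex_f R (pt a b) = pt (2 * a ^+ 2 - b ^+ 2) (a * b).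
Proof.
have E1 : 2%:P * 'X^2 - 1 = quad 2 0 (-1) :> {poly R[i]}.
  by rewrite /quad polyC0 polyCN polyC1; ring.
have E2 : 'X = quad 0 1 0 :> {poly R[i]} by rewrite /quad !polyC0 polyC1; ring.
have -> : ex_f R = ratmap (quad 2 0 (-1)) (quad 0 1 0) by rewrite -E1 -E2.
have [||h1 h2] := @quad_ratmap R 2 0 (-1) 0 1 0.
- move=> a b e1 e2; have ab : a * b = 0 by rewrite -[RHS]e2; ring.
  have e3 : 2 * a ^+ 2 - b ^+ 2 = 0 by rewrite -[RHS]e1; ring.
  move/eqP: ab; rewrite mulf_eq0 => /orP[] /eqP ab0; move: e3; rewrite ab0.
    by rewrite expr0n mulr0 sub0r => /eqP; rewrite oppr_eq0 sqrf_eq0 => /eqP ->.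
  rewrite expr0n subr0 => /eqP; rewrite mulf_eq0 (negPf two_neq0) /=.
  by rewrite sqrf_eq0 => /eqP ->.
- by apply: quad_neq0; rewrite oner_eq0 orbT.
by split=> // a b ab; rewrite h2 //; congr pt; ring.
Qed.

Lemma ex_g_spec : rational_of_degree 2 (ex_g R) /\
  forall a b, 0 < hnorm a b -> ex_g R (pt a b) = pt (a ^+ 2 - b ^+ 2) (2 * (a * b)).
Proof.
have E1 : 'X^2 - 1 = quad 1 0 (-1) :> {poly R[i]}.
  by rewrite /quad polyC0 polyCN polyC1; ring.
have E2 : 2%:P * 'X = quad 0 2 0 :> {poly R[i]} by rewrite /quad !polyC0; ring.
rewrite /ex_g E1 E2; have [||h1 h2] := @quad_ratmap R 1 0 (-1) 0 2 0.
- move=> a b e1 e2; have ab : 2 * (a * b) = 0 by rewrite -[RHS]e2; ring.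
  have e3 : a ^+ 2 - b ^+ 2 = 0 by rewrite -[RHS]e1; ring.
  move/eqP: ab; rewrite !mulf_eq0 (negPf two_neq0) /= => /orP[] /eqP ab0; move: e3; rewrite ab0.
    by rewrite expr0n sub0r => /eqP; rewrite oppr_eq0 sqrf_eq0 => /eqP ->.
  by rewrite expr0n subr0 => /eqP; rewrite sqrf_eq0 => /eqP ->.
- by apply: quad_neq0; rewrite two_neq0 orbT.
by split=> // a b ab; rewrite h2 //; congr pt; ring.
Qed.

Lemma ex_ft_spec : rational_of_degree 2 (ex_ft R) /\
  forall a b, 0 < hnorm a b -> ex_ft R (pt a b) =
    pt (3 * (a * b) + 5 * a ^+ 2) (b ^+ 2 + 3 * (a * b) + 4 * a ^+ 2).
Proof.
have E1 : 3%:P * 'X + 5%:P * 'X^2 = quad 5 3 0 :> {poly R[i]}.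
  by rewrite /quad polyC0; ring.
have E2 : 1 + 3%:P * 'X + 4%:P * 'X^2 = quad 4 3 1 :> {poly R[i]}.
  by rewrite /quad polyC1; ring.
rewrite /ex_ft E1 E2; have [||h1 h2] := @quad_ratmap R 5 3 0 4 3 1.
- move=> a b e1 e2; have ab : a * (3 * b + 5 * a) = 0 by rewrite -[RHS]e1; ring.
  have e3 : b ^+ 2 + 3 * (a * b) + 4 * a ^+ 2 = 0 by rewrite -[RHS]e2; ring.
  move/eqP: ab; rewrite mulf_eq0 => /orP[] /eqP ab0.
    move: e3; rewrite ab0 mul0r mulr0 expr0n mulr0 !addr0 => /eqP.
    by rewrite sqrf_eq0 => /eqP ->.
  (* Elimination of b: nine times the denominator is 16 a^2 modulo 3 b + 5 a. *)
  have a2 : 16 * a ^+ 2 = 0.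
    have -> : 16 * a ^+ 2 = 9 * (b ^+ 2 + 3 * (a * b) + 4 * a ^+ 2)
      - (3 * b + 5 * a) * (3 * b + 4 * a) by ring.
    by rewrite e3 ab0 mul0r mulr0 subrr.
  have a0 : a = 0 by move/eqP: a2; rewrite mulf_eq0 pnatr_eq0 /= sqrf_eq0 => /eqP.
  by move/eqP: ab0; rewrite a0 mulr0 addr0 mulf_eq0 pnatr_eq0 /= => /eqP.
- by apply: quad_neq0; rewrite oner_eq0 !orbT.
by split=> // a b ab; rewrite h2 //; congr pt; ring.
Qed.

Lemma ex_gt_spec : rational_of_degree 2 (ex_gt R) /\
  forall a b, 0 < hnorm a b -> ex_gt R (pt a b) = pt (2 * a ^+ 2 - b ^+ 2) (b ^+ 2).
Proof.
have E1 : 2%:P * 'X^2 - 1 = quad 2 0 (-1) :> {poly R[i]}.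
  by rewrite /quad polyC0 polyCN polyC1; ring.
have E2 : 1 = quad 0 0 1 :> {poly R[i]} by rewrite /quad !polyC0 polyC1; ring.
have -> : ex_gt R = ratmap (quad 2 0 (-1)) (quad 0 0 1) by rewrite -E1 -E2.
have [||h1 h2] := @quad_ratmap R 2 0 (-1) 0 0 1.
- move=> a b e1 e2; have e3 : b ^+ 2 = 0 by rewrite -[RHS]e2; ring.
  move/eqP: e3; rewrite sqrf_eq0 => /eqP b0; move: e1.
  rewrite b0 !(mulr0, expr0n, addr0) /= ?mulr0 ?addr0 => /eqP.
  by rewrite mulf_eq0 (negPf two_neq0) /= sqrf_eq0 => /eqP ->.
- by apply: quad_neq0; rewrite oner_eq0 !orbT.
by split=> // a b ab; rewrite h2 //; congr pt; ring.
Qed.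

Lemma rational_ge2_of_2 (f : sphere R -> sphere R) : rational_of_degree 2 f -> rational_ge2 f.
Proof. by move=> rf; exists 2%N. Qed.

Lemma pair_gt0 a b (c d : R[i]) : 0 < hnorm a b ->
  (c = 0 -> d = 0 -> a = 0 /\ b = 0) -> 0 < hnorm c d.
Proof.
move=> ab H; rewrite hnorm_gt0 -negb_and; apply/negP => /andP[/eqP c0 /eqP d0].
by have [a0 b0] := H c0 d0; move: ab; rewrite a0 b0 hnorm_gt0 eqxx.
Qed.

Lemma ex_f_odd : odd_map (ex_f R).
Proof.
move=> x; have [a [b [ab ->]]] := ptP x; rewrite sopp_pt !(ex_f_spec).2 ?hnorm_opp //.
rewrite sopp_pt sqrrN mulNr; have n1 : -1 != 0 :> R[i] by rewrite oppr_eq0 oner_eq0.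
by rewrite -[LHS](pt_scale _ _ n1) !mulN1r opprK.
Qed.

Lemma ex_g_odd : odd_map (ex_g R).
Proof.
move=> x; have [a [b [ab ->]]] := ptP x; rewrite sopp_pt !(ex_g_spec).2 ?hnorm_opp //.
rewrite sopp_pt sqrrN mulNr mulrN; have n1 : -1 != 0 :> R[i] by rewrite oppr_eq0 oner_eq0.
by rewrite -[LHS](pt_scale _ _ n1) !mulN1r opprK.
Qed.

Lemma phi_pair_gt0 a b : 0 < hnorm a b -> 0 < hnorm (a ^+ 2 - b ^+ 2) (a ^+ 2 + b ^+ 2).
Proof.
move=> ab; apply: (pair_gt0 ab) => e1 e2.
have a2 : 2 * a ^+ 2 = (a ^+ 2 - b ^+ 2) + (a ^+ 2 + b ^+ 2) by ring.
have b2 : 2 * b ^+ 2 = (a ^+ 2 + b ^+ 2) - (a ^+ 2 - b ^+ 2) by ring.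
move/eqP: a2; move/eqP: b2; rewrite e1 e2 addr0 subr0 !mulf_eq0 !(negPf two_neq0) /= !orbb.
by move=> /eqP -> /eqP ->.
Qed.

Lemma ex_f_pair_gt0 a b : 0 < hnorm a b -> 0 < hnorm (2 * a ^+ 2 - b ^+ 2) (a * b).
Proof.
move=> ab; apply: (pair_gt0 ab) => e3 /eqP.
rewrite mulf_eq0 => /orP[] /eqP ab0; move: e3; rewrite ab0.
  by rewrite expr0n mulr0 sub0r => /eqP; rewrite oppr_eq0 sqrf_eq0 => /eqP ->.
rewrite expr0n subr0 => /eqP; rewrite mulf_eq0 (negPf two_neq0) /=.
by rewrite sqrf_eq0 => /eqP ->.
Qed.

Lemma ex_g_pair_gt0 a b : 0 < hnorm a b -> 0 < hnorm (a ^+ 2 - b ^+ 2) (2 * (a * b)).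
Proof.
move=> ab; apply: (pair_gt0 ab) => e3 /eqP.
rewrite !mulf_eq0 (negPf two_neq0) /= => /orP[] /eqP ab0; move: e3; rewrite ab0.
  by rewrite expr0n sub0r => /eqP; rewrite oppr_eq0 sqrf_eq0 => /eqP ->.
by rewrite expr0n subr0 => /eqP; rewrite sqrf_eq0 => /eqP ->.
Qed.

Lemma ex_f_phi : phi \o ex_f R = ex_ft R \o phi.
Proof.
apply/funext => x; have [a [b [ab ->]]] := ptP x => /=.
rewrite ex_f_spec.2 // !(phi_spec R).2 ?ex_f_pair_gt0 //.
(* As pairs, the two sides differ by the factor 2. *)
rewrite ex_ft_spec.2 ?phi_pair_gt0 // -[LHS](pt_scale _ _ two_neq0).
by congr pt; ring.
Qed.

Lemma ex_g_phi : phi \o ex_g R = ex_gt R \o phi.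
Proof.
apply/funext => x; have [a [b [ab ->]]] := ptP x => /=.
rewrite ex_g_spec.2 // !(phi_spec R).2 ?ex_g_pair_gt0 //.
by rewrite ex_gt_spec.2 ?phi_pair_gt0 //; congr pt; ring.
Qed.

(** The form s z - t / z covers both examples. Its imaginary part is Im z times the positive number
    s + t / |z|^2, so either root of s z^2 - w z - t = 0 lies on the same side as w, which gives
    surjectivity. *)
Lemma upper_half_plane_image (f : sphere R -> sphere R) (s t : R) : 0 < s -> 0 < t ->
  (forall z, z != 0 -> f (finpt z) = finpt (s%:C * z - t%:C * z^-1)) ->
  f @` upper_half_plane = upper_half_plane.
Proof.
move=> s0 t0 fE.
have ImE z : z != 0 -> Im (s%:C * z - t%:C * z^-1) = Im z * (s + t / cabs z ^+ 2).
  move=> z0; rewrite Im_add Im_opp !Im_mul Im_inv /= !mul0r !addr0; ring.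
have pos z : z != 0 -> 0 < s + t / cabs z ^+ 2.
  by move=> z0; rewrite addr_gt0 // divr_gt0 // exprn_gt0 // cabs_gt0.
apply/seteqP; split=> [_ [x /upper_half_planeP[z z0 ->] <-]|x /upper_half_planeP[w w0 ->]].
  have zn : z != 0 by apply: contraTneq z0 => ->; rewrite ltxx.
  apply/upper_half_planeP; exists (s%:C * z - t%:C * z^-1); last exact: fE.
  by rewrite ImE // mulr_gt0 // pos.
have sn : s%:C != 0 :> R[i] by rewrite -cabs_eq0 cabs_real normr_eq0 gt_eqF.
have tn : t%:C != 0 :> R[i] by rewrite -cabs_eq0 cabs_real normr_eq0 gt_eqF.
pose D := sqrtc (w ^+ 2 + 4 * s%:C * t%:C); pose z := (w + D) / (2 * s%:C).
have zE : s%:C * z ^+ 2 - w * z - t%:C = 0.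
  have -> : s%:C * z ^+ 2 - w * z - t%:C =
      (D ^+ 2 - (w ^+ 2 + 4 * s%:C * t%:C)) / (4 * s%:C).
    by rewrite /z; field; rewrite sn.
  by rewrite sqr_sqrtc subrr mul0r.
have zn : z != 0.
  apply/negP => /eqP z0; move/eqP: zE; rewrite z0 expr0n !mulr0 subrr sub0r oppr_eq0.
  by rewrite (negPf tn).
have wE : s%:C * z - t%:C * z^-1 = w.
  apply: (mulIf zn); rewrite mulrBl mulfVK //.
  by apply/eqP; rewrite -subr_eq0 -zE; apply/eqP; ring.
exists (finpt z); last by rewrite fE // wE.
apply/upper_half_planeP; exists z => //.
by move: w0; rewrite -wE ImE // pmulr_lgt0 // pos.
Qed.

Lemma ex_f_image : ex_f R @` upper_half_plane = upper_half_plane.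
Proof.
apply: (@upper_half_plane_image _ 2 1) => // z z0.
rewrite [finpt z]pt_fin ex_f_spec.2 ?hnorm_gt0 ?z0 // expr1n mulr1 /pt (negPf z0).
by congr finpt; rewrite rmorph_nat rmorph1; field.
Qed.

Lemma ex_g_image : ex_g R @` upper_half_plane = upper_half_plane.
Proof.
apply: (@upper_half_plane_image _ 2^-1 2^-1); rewrite ?invr_gt0 // => z z0.
rewrite [finpt z]pt_fin ex_g_spec.2 ?hnorm_gt0 ?z0 // expr1n mulr1 /pt mulf_eq0 (negPf z0).
rewrite (negPf two_neq0) /=; congr finpt; rewrite fmorphV rmorph_nat.
by field; rewrite z0.
Qed.

(** Uniform closeness to a constant takes care of all late iterates, and continuity of the finitely
    many early ones, one at a time. *)
Lemma equicont_of_unif_limit (h : sphere R -> sphere R) (W : set (sphere R)) (c : sphere R) :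
  chord_cont h -> open W ->
  (forall e : R, 0 < e -> exists N, forall n y, (N <= n)%N -> W y ->
     half_chord (fwd h n y) c < e) ->
  forall x, W x -> equicont (fwd h) x.
Proof.
move=> ch /sphere_open_chordP oW lim x Wx e e0.
have e2 : 0 < e / 2 by rewrite divr_gt0.
have [N HN] := lim _ e2; have [r r0 Hr] := oW x Wx.
have [d d0 Hd] : exists2 d : R, 0 < d & forall n y, (n < N)%N ->
    half_chord x y < d -> half_chord (fwd h n x) (fwd h n y) < e.
  elim: (N) => [|M [d d0 Hd]]; first by exists 1.
  have [d' d'0 Hd'] := @chord_cont_iter R h M.+1 ch x e e0.
  exists (Num.min d d'); first by rewrite lt_min d0.
  move=> n y; rewrite ltnS leq_eqVlt lt_min => /orP[/eqP ->|nM] /andP[h1 h2].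
    exact: Hd'.
  exact: Hd.
exists (Num.min d r); first by rewrite lt_min d0.
move=> n y; rewrite lt_min => /andP[h1 h2].
have [Nn|nN] := leqP N n; last exact: Hd.
have a1 := HN n x Nn Wx; have a2 := HN n y Nn (Hr _ h2).
have := half_chord_triangle c (fwd h n x) (fwd h n y).
rewrite (half_chordC c); lra.
Qed.

Lemma geometric_small (s e : R) : 0 <= s -> s < 1 -> 0 < e ->
  exists N, forall n, (N <= n)%N -> s ^+ n < e.
Proof.
move=> s0 s1 e0; have sn : `|s| < 1 by rewrite ger0_norm.
have /cvgrPdist_lt /(_ e e0) [N _ HN] := cvg_expr sn.
exists N => n Nn; have := HN n Nn; rewrite /= sub0r normrN.
by rewrite ger0_norm // exprn_ge0.
Qed.

(** In the coordinate c = 1/z the map is c |-> c / (2 - c^2), with multiplier 1/2 at 0. For |c| <=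
    1/2 the denominator has modulus at least 3/2, hence the rate 2/3. *)
Lemma ex_f_near_infty n b : cabs b <= 1 / 2 ->
  exists2 b', fwd (ex_f R) n (pt 1 b) = pt 1 b' & cabs b' <= (2 / 3) ^+ n.+1 * (1 / 2).
Proof.
move=> b2.
have step c : cabs c <= 1 / 2 ->
    exists2 c', ex_f R (pt 1 c) = pt 1 c' & cabs c' <= 2 / 3 * cabs c.
  move=> c2; have cc : cabs (c ^+ 2) <= 1 / 4.
    rewrite cabsX; have := cabs_ge0 c => c0; nra.
  have big : 3 / 2 <= cabs (2 - c ^+ 2).
    have := cabs_sub_le 2%:R (c ^+ 2); rewrite -(rmorph_nat (real_complex R)) cabs_real.
    rewrite ger0_norm //; lra.
  have nz : 2 - c ^+ 2 != 0 by rewrite -cabs_gt0; apply: lt_le_trans big; lra.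
  exists (c / (2 - c ^+ 2)).
    rewrite ex_f_spec.2 ?hnorm_gt0 ?oner_eq0 // expr1n mulr1 mul1r.
    rewrite -[RHS](pt_scale _ _ nz) mulr1; congr pt; by rewrite mulrC divfK.
  rewrite cabsM cabsV mulrC; apply: ler_wpM2r; first exact: cabs_ge0.
  have -> : 2 / 3 = (3 / 2)^-1 :> R by rewrite invf_div.
  rewrite lef_pV2 ?posrE //; apply: lt_le_trans big; lra.
elim: n => [|n [c E c1]].
  have [c' E c'1] := step b b2; exists c' => //.
  by apply: le_trans c'1 _; rewrite expr1 ler_pM2l ?divr_gt0.
have c2 : cabs c <= 1 / 2.
  apply: le_trans c1 _; rewrite -[leRHS]mul1r; apply: ler_wpM2r; first by lra.
  by apply: exprn_ile1; lra.
have [c' E' c'1] := step c c2; exists c'; first by rewrite /fwd iterS -/(fwd _ n _) E.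
apply: le_trans c'1 _.
have -> : (2 / 3) ^+ n.+2 * (1 / 2) = 2 / 3 * ((2 / 3) ^+ n.+1 * (1 / 2)) :> R.
  by rewrite [_ ^+ n.+2]exprS; ring.
by rewrite ler_pM2l // divr_gt0.
Qed.

Lemma julia_ex_f : julia (ex_f R) <> extended_reals.
Proof.
move=> J; have : extended_reals (infty : sphere R) by apply/extended_realsP; left.
rewrite -J; have cf := rational_ge2_chord_cont (rational_ge2_of_2 ex_f_spec.1).
have h2 : 0 < 1 / 2 :> R by lra.
have [e e0 He] := chord_nbhs_infty h2.
pose W : set (sphere R) := [set y | half_chord infty y < e].
have oW : open W by exact: chord_ball_open.
apply: (@normal_of_equicont _ _ _ W); first by split=> //; rewrite /W /= .
apply: (equicont_of_unif_limit cf oW (c := infty)) => r r0.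
have [| |N HN] := @geometric_small (2 / 3) r _ _ r0; [lra|lra|].
exists N => n y Nn /He[b -> /ltW/(ex_f_near_infty n)[b' -> b'1]].
have h1 : 1 <= hnorm 1 b' by rewrite -(cabs1 R) hnorm_l.
have h0 : 1 <= hnorm 1 (0 : R[i]) by rewrite -(cabs1 R) hnorm_l.
rewrite pt_inf half_chord_pt ?(lt_le_trans ltr01) // mulr0 sub0r mulr1 cabsN.
apply: (@le_lt_trans _ _ (cabs b')).
  rewrite ler_pdivrMr; last by apply: mulr_gt0; exact: lt_le_trans ltr01 _.
  rewrite -[leLHS]mulr1; apply: ler_wpM2l; first exact: cabs_ge0.
  by rewrite -[1]mulr1; apply: ler_pM.
apply: le_lt_trans b'1 _; have := HN n.+1 (leqW Nn).
have : 0 <= (2 / 3) ^+ n.+1 :> R by apply: exprn_ge0; lra.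
lra.
Qed.

(** For the ratio u of the distances to c and c', the hypothesis is u(g x) = u(x)^2 in product form,
    which remains meaningful at c'. Where u < 1 the iterates tend to c; the bound s^(n+1), weaker
    than the actual s^(2^(n+1)), is enough. *)
Lemma attracting_half (g : sphere R -> sphere R) (c c' : sphere R) : chord_cont g ->
  c <> c' ->
  (forall x, half_chord (g x) c * half_chord x c' ^+ 2 =
             half_chord (g x) c' * half_chord x c ^+ 2) ->
  forall x, half_chord x c < half_chord x c' ->
    ~ julia g x /\
    (forall e : R, 0 < e -> exists N, forall n, (N <= n)%N -> half_chord (fwd g n x) c < e).
Proof.
move=> cg cc' H x xc.
have step (s : R) y : 0 <= s -> half_chord y c <= s * half_chord y c' ->
    half_chord (g y) c <= s ^+ 2 * half_chord (g y) c'.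
  move=> s0 yc; have y0 : 0 < half_chord y c'.
    rewrite lt_neqAle half_chord_ge0 andbT eq_sym; apply/negP => /eqP y0.
    move: yc; rewrite y0 mulr0 => yc; apply: cc'.
    rewrite -(half_chord_eq0 y0); apply/esym/half_chord_eq0.
    by apply/eqP; rewrite eq_le yc half_chord_ge0.
  have y2 : 0 < half_chord y c' ^+ 2 by rewrite exprn_gt0.
  rewrite -(ler_pM2r y2) H mulrAC [leRHS]mulrC -exprMn.
  apply: ler_wpM2l; first exact: half_chord_ge0.
  by rewrite ler_sqr ?nnegrE ?half_chord_ge0 // mulr_ge0 // half_chord_ge0.
have iterP (s : R) n y : 0 <= s -> s <= 1 -> half_chord y c <= s * half_chord y c' ->
    half_chord (fwd g n y) c <= s ^+ n.+1 * half_chord (fwd g n y) c'.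
  move=> s0 s1 yc; elim: n => [|n IH].
    apply: le_trans (step s y s0 yc) _; apply: ler_wpM2r; first exact: half_chord_ge0.
    by rewrite expr1 expr2 -[leRHS]mul1r ler_wpM2r.
  rewrite /fwd iterS -/(fwd g n y).
  apply: le_trans (step _ _ (exprn_ge0 _ s0) IH) _.
  apply: ler_wpM2r; first exact: half_chord_ge0.
  rewrite [in leRHS]exprS expr2; apply: ler_wpM2r; first exact: exprn_ge0.
  by rewrite exprS -[leRHS]mulr1 ler_wpM2l // exprn_ile1.
have x0 : 0 < half_chord x c' by apply: le_lt_trans xc; exact: half_chord_ge0.
(* The midpoint between the ratio at x and 1: the bound by s is strict at x, hence holds nearby, and
   s is still below 1. *)
set s := (half_chord x c / half_chord x c' + 1) / 2.
have q1 : half_chord x c / half_chord x c' < 1 by rewrite ltr_pdivrMr // mul1r.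
have q0 : 0 <= half_chord x c / half_chord x c'.
  by rewrite divr_ge0 // half_chord_ge0.
have s0 : 0 <= s by rewrite /s; lra.
have s1 : s < 1 by rewrite /s; lra.
pose W : set (sphere R) := [set y | half_chord y c < s * half_chord y c'].
have Wx : W x by rewrite /W /= -ltr_pdivrMr // /s; lra.
have oW : open W.
  apply/sphere_open_chordP => y Wy.
  exists ((s * half_chord y c' - half_chord y c) / 2); first by rewrite divr_gt0 // subr_gt0.
  move=> z yz; rewrite /W /=.
  have t1 := half_chord_triangle y z c; have t2 := half_chord_triangle z y c'.
  rewrite (half_chordC z y) in t1.
  have t3 : s * half_chord y c' <= s * (half_chord y z + half_chord z c').
    by rewrite ler_wpM2l.
  have t4 : s * half_chord y z <= half_chord y z.
    by rewrite -[leRHS]mul1r ler_wpM2r ?half_chord_ge0 // ltW.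
  lra.
have lim (e : R) : 0 < e -> exists N, forall n y, (N <= n)%N -> W y ->
    half_chord (fwd g n y) c < e.
  move=> e0; have [N HN] := geometric_small s0 s1 e0; exists N => n y Nn Wy.
  apply: le_lt_trans (iterP s n y s0 (ltW s1) (ltW Wy)) _.
  apply: le_lt_trans (HN n.+1 (leqW Nn)).
  by rewrite -[leRHS]mulr1 ler_wpM2l ?exprn_ge0 // half_chord_le1.
split; last first.
  by move=> e e0; have [N HN] := lim e e0; exists N => n Nn; exact: HN.
apply: (@normal_of_equicont _ _ _ W) => //.
exact: equicont_of_unif_limit cg oW lim.
Qed.

Lemma chord_i a b : 0 < hnorm a b ->
  half_chord (pt a b) (finpt 'i) = cabs (a - 'i * b) / (hnorm a b * hnorm 'i (1 : R[i])) /\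
  half_chord (pt a b) (finpt (- 'i)) = cabs (a + 'i * b) / (hnorm a b * hnorm 'i (1 : R[i])).
Proof.
move=> ab; have h : 0 < hnorm 'i (1 : R[i]) by rewrite hnorm_gt0 oner_eq0 orbT.
rewrite !pt_fin !half_chord_pt ?hnorm_opp // !mulr1 mulrN opprK.
by rewrite [b * _]mulrC.
Qed.

(** (z - i) / (z + i) conjugates g to squaring; this is that identity in absolute value, without
    denominators. *)
Lemma ex_g_multiplier x :
  half_chord (ex_g R x) (finpt 'i) * half_chord x (finpt (- 'i)) ^+ 2 =
  half_chord (ex_g R x) (finpt (- 'i)) * half_chord x (finpt 'i) ^+ 2.
Proof.
have [a [b [ab ->]]] := ptP x; rewrite ex_g_spec.2 //.
have [-> ->] := chord_i (ex_g_pair_gt0 ab); have [-> ->] := chord_i ab.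
have -> : a ^+ 2 - b ^+ 2 - 'i * (2 * (a * b)) = (a - 'i * b) ^+ 2.
  by rewrite sqrrB exprMn sqr_i; ring.
have -> : a ^+ 2 - b ^+ 2 + 'i * (2 * (a * b)) = (a + 'i * b) ^+ 2.
  by rewrite sqrrD exprMn sqr_i; ring.
by rewrite !cabsX !exprMn; ring.
Qed.

Lemma chord_i_Im z :
  (0 < Im z -> half_chord (finpt z) (finpt 'i) < half_chord (finpt z) (finpt (- 'i))) /\
  (Im z < 0 -> half_chord (finpt z) (finpt (- 'i)) < half_chord (finpt z) (finpt 'i)).
Proof.
have h : 0 < hnorm z (1 : R[i]) by rewrite hnorm_gt0 oner_eq0 orbT.
have h' : 0 < hnorm 'i (1 : R[i]) by rewrite hnorm_gt0 oner_eq0 orbT.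
have hh : 0 < (hnorm z 1 * hnorm 'i (1 : R[i]))^-1 by rewrite invr_gt0 mulr_gt0.
rewrite [finpt z]pt_fin; have [-> ->] := chord_i h.
rewrite !(ltr_pM2r hh) mulr1.
rewrite -![cabs _ < cabs _]ltr_sqr ?nnegrE ?cabs_ge0 // !cabs_sqr.
case: z {h hh} => a b /=; split=> b0; lra.
Qed.

Lemma near_real x (d : R) : extended_reals x -> 0 < d -> exists z,
  [/\ 0 < Im z, half_chord x (finpt z) < d & half_chord x (finpt (conjc z)) < d].
Proof.
move=> /extended_realsP xR d0.
have : nbhs x [set y | half_chord x y < d] by apply/sphere_nbhsP; exists d.
case: xR => [->|[t ->]].
  move=> /infty_nbhsP[r r0 [_ H]]; exists (0 +i* (r + 1)).
  have r1 : 0 < r + 1 by lra.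
  have E : cabs (0 +i* (r + 1)) = r + 1.
    by rewrite /cabs /= expr0n add0r sqrtr_sqr gtr0_norm.
  by split=> //; apply: H; rewrite ?cabs_conj E; lra.
move=> /finpt_nbhsP[e e0 H]; exists (t +i* (e / 2)).
have e2 : 0 < e / 2 by lra.
have E : cabs (0 +i* (e / 2)) = e / 2.
  by rewrite /cabs /= expr0n add0r sqrtr_sqr gtr0_norm.
split=> //; apply: H.
  have -> : t%:C - (t +i* (e / 2)) = - (0 +i* (e / 2)).
    by apply: complexP; rewrite ?Re_add ?Im_add ?Re_opp ?Im_opp /=; ring.
  by rewrite cabsN E; lra.
have -> : t%:C - conjc (t +i* (e / 2)) = 0 +i* (e / 2).
  by apply: complexP; rewrite ?Re_add ?Im_add ?Re_opp ?Im_opp /=; ring.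
by rewrite E; lra.
Qed.

(** The half planes are attracted to i and -i, so they avoid the Julia set. Conjugate points
    arbitrarily close to a real point, or to infinity, have iterates tending to these two distinct
    limits, which contradicts equicontinuity. *)
Lemma julia_ex_g : julia (ex_g R) = extended_reals.
Proof.
have cg := rational_ge2_chord_cont (rational_ge2_of_2 ex_g_spec.1).
have ii : 'i <> - 'i :> R[i].
  by move=> /(congr1 (@complex.Im R)) /=; lra.
have cc : finpt 'i <> finpt (- 'i) :> sphere R.
  by move=> /(congr1 (fun s => if s is Some z then z else 0)).
have cc' : finpt (- 'i) <> finpt 'i :> sphere R by move=> /esym.
have up := attracting_half cg cc ex_g_multiplier.
have lo := attracting_half cg cc' (fun x => esym (ex_g_multiplier x)).
apply/seteqP; split=> x.
  move=> Jx; case: x Jx => [z|] Jx; last by apply/extended_realsP; left.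
  apply/extended_reals_fin; have [h1 h2] := chord_i_Im z.
  have [z0|z0|//] := ltgtP (Im z) 0.
    by have [] := lo (finpt z) (h2 z0).
  by have [] := up (finpt z) (h1 z0).
move=> xR; apply: contrapT => /(fatouP x cg)[W [_ Wx] eW].
(* Four errors of 1/8 remain below the distance 1 between the antipodal points i and -i. *)
have e8 : 0 < 1 / 8 :> R by lra.
have [d d0 Hd] := eW x Wx _ e8.
have [z [z0 xz xz']] := near_real xR d0.
have z0' : Im (conjc z) < 0 by case: (z) z0 => a b /=; rewrite oppr_lt0.
have [_ lim1] := up (finpt z) ((chord_i_Im z).1 z0).
have [_ lim2] := lo (finpt (conjc z)) ((chord_i_Im (conjc z)).2 z0').
have [N1 H1] := lim1 _ e8; have [N2 H2] := lim2 _ e8.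
pose n := maxn N1 N2.
have a1 := H1 n (leq_maxl _ _); have a2 := H2 n (leq_maxr _ _).
have a3 := Hd n _ xz; have a4 := Hd n _ xz'.
have i1 : 0 < hnorm 'i (1 : R[i]) by rewrite hnorm_gt0 oner_eq0 orbT.
have one : half_chord (finpt 'i) (finpt (- 'i) : sphere R) = 1.
  rewrite !pt_fin half_chord_pt ?hnorm_opp // mulr1 mul1r opprK -expr2 hnorm_sqr.
  rewrite /cabs /= !addr0 !expr0n !add0r expr1n addr0 sqrtr1 expr1n sqrtr_sqr.
  by rewrite ger0_norm ?divff //; lra.
move: a1 a2 a3 a4; set u := fwd _ _ _; set v := fwd _ _ _; set w := fwd _ n x.
move=> a1 a2 a3 a4.
have t1 := half_chord_triangle u (finpt 'i) (finpt (- 'i)).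
have t2 := half_chord_triangle v u (finpt (- 'i)).
have t3 := half_chord_triangle w u v.
rewrite one (half_chordC _ u) in t1.
rewrite (half_chordC u w) in t3.
by clear -a1 a2 a3 a4 t1 t2 t3; lra.
Qed.

End Examples.

End Development.

Theorem mainTheorem1 (R : realType) :
  (forall f g : sphere R -> sphere R,
     odd_map f -> odd_map g -> rational_ge2 f -> rational_ge2 g ->
     f @` upper_half_plane = upper_half_plane ->
     g @` upper_half_plane = upper_half_plane ->
     julia f <> extended_reals -> julia g = extended_reals ->
     exists ft gt : sphere R -> sphere R,
       [/\ rational_map ft, rational_map gt, phi \o f = ft \o phi &
           phi \o g = gt \o phi] /\
       rational_semigroup (semigroup_gen [set ft; gt]) /\
       [/\ julia ft <> segment, julia gt = segment, julia ft <> julia gt &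
           E_julia (semigroup_gen [set ft; gt]) = segment])
  /\
  ([/\ odd_map (ex_f R), odd_map (ex_g R), rational_ge2 (ex_f R) &
       rational_ge2 (ex_g R)] /\
   [/\ ex_f R @` upper_half_plane = upper_half_plane,
       ex_g R @` upper_half_plane = upper_half_plane,
       julia (ex_f R) <> extended_reals & julia (ex_g R) = extended_reals] /\
   [/\ rational_map (ex_ft R), rational_map (ex_gt R), phi \o ex_f R = ex_ft R \o phi &
       phi \o ex_g R = ex_gt R \o phi] /\
   rational_semigroup (semigroup_gen [set ex_ft R; ex_gt R]) /\
   julia (ex_ft R) <> julia (ex_gt R) /\
   E_julia (semigroup_gen [set ex_ft R; ex_gt R]) = segment).
Proof.
have toM (h : sphere R -> sphere R) : rational_ge2 h -> rational_map h.
  by move=> [d _ rh]; exists d.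
split.
  move=> f g of_ og rf rg fU gU Jf Jg.
  have [ft rft Ef] := odd_phi_descent of_ rf.
  have [gt rgt Eg] := odd_phi_descent og rg.
  exists ft, gt; split; first by split=> //; exact: toM.
  split; first exact: rational_semigroup_gen.
  exact: (semiconjugate_semigroup of_ og rf rg).
have rf := rational_ge2_of_2 (ex_f_spec R).1.
have rg := rational_ge2_of_2 (ex_g_spec R).1.
have rft := rational_ge2_of_2 (ex_ft_spec R).1.
have rgt := rational_ge2_of_2 (ex_gt_spec R).1.
have [_ _ Jne E] := semiconjugate_semigroup (@ex_f_odd R) (@ex_g_odd R) rf rg
  rft rgt (@ex_f_image R) (@ex_g_image R) (@julia_ex_f R) (@julia_ex_g R)
  (@ex_f_phi R) (@ex_g_phi R).
split; first by split=> //; [exact: ex_f_odd | exact: ex_g_odd].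
split; first by split; [exact: ex_f_image | exact: ex_g_image
  | exact: julia_ex_f | exact: julia_ex_g].
split; first by split; [exact: toM | exact: toM | exact: ex_f_phi | exact: ex_g_phi].
by split; [exact: rational_semigroup_gen | split].
Qed.
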